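(* Let $\varphi:S^3\to S^2$ be the Hopf map between unit spheres, and let $\mathcal{J}_\varphi$ be its Jacobi operator as a harmonic map. The eigenvalues of $\mathcal{J}_\varphi$ are $n(n+2)+4k$, where $n$ is a non-negative integer and $k\in\{-n,-n+2,\dots,n-2,n\}$, each pair $(n,k)$ contributing multiplicity $2(n+1)$ (so that the real dimension of the eigenspace of an eigenvalue $\lambda$ is the sum of $2(n+1)$ over all such pairs $(n,k)$ with $n(n+2)+4k=\lambda$). In particular, the only negative eigenvalue arises from $n=1$, $k=-1$, and the direct sum of the negative eigenspaces of $\mathcal{J}_\varphi$ is $4$-dimensional; and the kernel of $\mathcal{J}_\varphi$ is $8$-dimensional.
   Context: The Hopf map is $\varphi(z_1,z_2)=(2\overline{z_1}z_2,\ |z_2|^2-|z_1|^2)\in\mathbb{C}\times\mathbb{R}\cong\mathbb{R}^3$ for $(z_1,z_2)\in\mathbb{C}^2$, $|z_1|^2+|z_2|^2=1$; both spheres have radius 1 and the standard metrics. A variation field is a section $w$ of the pullback bundle $\varphi^*TS^2$, regarded as a real vector bundle with the pullback connection $\nabla$. The Jacobi operator is $\mathcal{J}_\varphi(w)=\nabla^*\nabla w-\sum_j R(w,d\varphi(E_j))d\varphi(E_j)$, where $\nabla^*\nabla=-\operatorname{Tr}\nabla^2$, $\{E_j\}$ is a local orthonormal frame of $S^3$, and $R(X,Y)Z=\langle Y,Z\rangle X-\langle X,Z\rangle Y$ is the curvature of $S^2$. Dimensions and multiplicities are real. *)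

(* Defs.v *)
From HB Require Import structures.
From mathcomp Require Import all_boot all_order all_algebra.
From mathcomp Require Import complex.
From mathcomp Require Import all_classical all_reals all_analysis.
From mathcomp Require Import ring.

Set Implicit Arguments.
Unset Strict Implicit.
Unset Printing Implicit Defensive.

Import Order.TTheory GRing.Theory Num.Theory.
Import numFieldNormedType.Exports.

Local Open Scope classical_set_scope.
Local Open Scope ring_scope.

Definition dot (R : realType) (n : nat) (u v : 'rV[R]_n) : R :=
  \sum_i u 0 i * v 0 i.

Definition sphere (R : realType) (n : nat) : Type :=
  {p : 'rV[R]_n.+1 | dot p p == 1}.

Definition tangent (R : realType) (n : nat) (p : sphere R n)
    (v : 'rV[R]_n.+1) : Prop := dot v (val p) = 0.

Definition tproj (R : realType) (n : nat) (p : sphere R n)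
    (v : 'rV[R]_n.+1) : 'rV[R]_n.+1 := v - dot v (val p) *: val p.

(* Differential calculus on S^n.  A map [f] on the sphere is extended to
   R^(n+1) \ {0} by y |-> f (y / |y|); since y |-> y / |y| is a smooth
   retraction onto S^n, [f] is smooth (on a relatively open set) exactly when
   this extension is, and df_x(v), for v tangent at x, is the derivative of the
   extension along v.  The value of the extension at 0 is irrelevant. *)
Lemma base_pointP (R : realType) (n : nat) :
  dot (delta_mx 0 0 : 'rV[R]_n.+1) (delta_mx 0 0) == 1.
Proof.
rewrite /dot (bigD1 ord0) //= big1 ?addr0; last first.
  by move=> i /negPf i0; rewrite !mxE eqxx i0 mulr0.
by rewrite !mxE !eqxx mulr1.
Qed.

Definition base_point (R : realType) (n : nat) : sphere R n :=
  exist _ (delta_mx 0 0) (base_pointP R n).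

Definition normalize (R : realType) (n : nat) (y : 'rV[R]_n.+1) : sphere R n :=
  insubd (base_point R n) ((Num.sqrt (dot y y))^-1 *: y).

Definition radial_ext (R : realType) (n m : nat)
    (f : sphere R n -> 'rV[R]_m.+1) (y : 'rV[R]_n.+1) : 'rV[R]_m.+1 :=
  f (normalize y).

Definition sdiff (R : realType) (n m : nat)
    (f : sphere R n -> 'rV[R]_m.+1) (x : sphere R n) (v : 'rV[R]_n.+1) :
    'rV[R]_m.+1 := 'D_v (radial_ext f) (val x).

Definition iter_derive (R : realType) (n m : nat)
    (s : seq 'rV[R]_n.+1) (f : 'rV[R]_n.+1 -> 'rV[R]_m.+1) :
    'rV[R]_n.+1 -> 'rV[R]_m.+1 :=
  foldr (fun v g => fun y => 'D_v g y) f s.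

(* C^infinity on a relatively open set [A]: all iterated directional
   derivatives exist and are (Frechet) differentiable on [A]. *)
Definition smooth_on (R : realType) (n m : nat) (A : set (sphere R n))
    (f : sphere R n -> 'rV[R]_m.+1) : Prop :=
  forall (s : seq 'rV[R]_n.+1) (x : sphere R n), A x ->
    differentiable (iter_derive s (radial_ext f)) (val x).

Definition orthonormal_frame_at (R : realType) (n : nat)
    (E : 'I_n -> sphere R n -> 'rV[R]_n.+1) (x : sphere R n) : Prop :=
  (forall i, tangent x (E i x)) /\
  (forall i j, dot (E i x) (E j x) = (i == j)%:R).

(* [E] is a smooth orthonormal frame of TS^n on a neighbourhood of [x]; its
   values far from [x] are irrelevant. *)
Definition local_orthonormal_frame (R : realType) (n : nat)
    (x : sphere R n) (E : 'I_n -> sphere R n -> 'rV[R]_n.+1) : Prop :=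
  exists U : set 'rV[R]_n.+1, [/\ open U, U (val x),
    forall i, smooth_on [set y | U (val y)] (E i) &
    forall y : sphere R n, U (val y) -> orthonormal_frame_at E y].

(* (nabla_X Y)(x) for the Levi-Civita connection of S^n: tangential part of
   the Euclidean derivative. *)
Definition levi_civita (R : realType) (n : nat)
    (X Y : sphere R n -> 'rV[R]_n.+1) (x : sphere R n) : 'rV[R]_n.+1 :=
  tproj x (sdiff Y x (X x)).

Definition curv (R : realType) (n : nat) (X Y Z : 'rV[R]_n) : 'rV[R]_n :=
  dot Y Z *: X - dot X Z *: Y.

(* R^4 is C^2 through z1 = x_0 + i x_1, z2 = x_2 + i x_3, and C x R is R^3
   through (c, t) |-> (Re c, Im c, t); [normc z] is |z| as an element of R. *)
Definition hopf_vec (R : realType) (p : 'rV[R]_4) : 'rV[R]_3 :=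
  let z1 : R[i] := Complex (p 0 (inord 0)) (p 0 (inord 1)) in
  let z2 : R[i] := Complex (p 0 (inord 2)) (p 0 (inord 3)) in
  let c := 2%:R * conjc z1 * z2 in
  \row_(j < 3) [:: complex.Re c; complex.Im c;
                   Normc.normc z2 ^+ 2 - Normc.normc z1 ^+ 2]`_j.

Lemma hopf_vecP (R : realType) (x : sphere R 3) :
  dot (hopf_vec (val x)) (hopf_vec (val x)) == 1.
Proof.
case: x => p /= /eqP; rewrite /dot !big_ord_recr !big_ord0 /= !mxE /=.
set a := p 0 _; set b := p 0 _; set c := p 0 _; set d := p 0 _.
have -> : p 0 (inord 0) = a by congr (p 0 _); apply: val_inj; rewrite /= inordK.
have -> : p 0 (inord 1) = b by congr (p 0 _); apply: val_inj; rewrite /= inordK.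
have -> : p 0 (inord 2) = c by congr (p 0 _); apply: val_inj; rewrite /= inordK.
have -> : p 0 (inord 3) = d by congr (p 0 _); apply: val_inj; rewrite /= inordK.
rewrite !sqr_sqrtr ?addr_ge0 ?sqr_ge0 // => h; apply/eqP.
rewrite -[RHS](expr1n _ 2) -[in RHS]h; ring.
Qed.

Definition hopf (R : realType) (x : sphere R 3) : sphere R 2 :=
  exist _ (hopf_vec (val x)) (hopf_vecP x).

Definition dhopf (R : realType) (x : sphere R 3) (v : 'rV[R]_4) : 'rV[R]_3 :=
  sdiff (fun y => val (hopf y)) x v.

(* Smooth sections of the pullback of TS^2 by the Hopf map. *)
Definition variation_field (R : realType) (w : sphere R 3 -> 'rV[R]_3) : Prop :=
  smooth_on setT w /\ forall x, tangent (hopf x) (w x).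

(* Pullback by the Hopf map of the Levi-Civita connection of S^2. *)
Definition pullback_conn (R : realType) (X : sphere R 3 -> 'rV[R]_4)
    (w : sphere R 3 -> 'rV[R]_3) (x : sphere R 3) : 'rV[R]_3 :=
  tproj (hopf x) (sdiff w x (X x)).

Definition second_cov_deriv (R : realType) (X Y : sphere R 3 -> 'rV[R]_4)
    (w : sphere R 3 -> 'rV[R]_3) (x : sphere R 3) : 'rV[R]_3 :=
  pullback_conn X (pullback_conn Y w) x - pullback_conn (levi_civita X Y) w x.

(* In what follows [E x] is the local orthonormal frame used to compute the
   operators at the point [x]. *)
Definition rough_laplacian (R : realType)
    (E : sphere R 3 -> 'I_3 -> sphere R 3 -> 'rV[R]_4)
    (w : sphere R 3 -> 'rV[R]_3) (x : sphere R 3) : 'rV[R]_3 :=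
  - \sum_(j < 3) second_cov_deriv (E x j) (E x j) w x.

Definition jacobi (R : realType)
    (E : sphere R 3 -> 'I_3 -> sphere R 3 -> 'rV[R]_4)
    (w : sphere R 3 -> 'rV[R]_3) (x : sphere R 3) : 'rV[R]_3 :=
  rough_laplacian E w x -
  \sum_(j < 3) curv (w x) (dhopf x (E x j x)) (dhopf x (E x j x)).

Definition eigenspace_jacobi (R : realType)
    (E : sphere R 3 -> 'I_3 -> sphere R 3 -> 'rV[R]_4) (l : R) :
    set (sphere R 3 -> 'rV[R]_3) :=
  [set w | variation_field w /\ forall x, jacobi E w x = l *: w x].

Definition eigenvalue_jacobi (R : realType)
    (E : sphere R 3 -> 'I_3 -> sphere R 3 -> 'rV[R]_4) (l : R) : Prop :=
  exists2 w, eigenspace_jacobi E l w & exists x, w x <> 0.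

Definition kernel_jacobi (R : realType)
    (E : sphere R 3 -> 'I_3 -> sphere R 3 -> 'rV[R]_4) :
    set (sphere R 3 -> 'rV[R]_3) :=
  [set w | variation_field w /\ forall x, jacobi E w x = 0].

(* Sum of the eigenspaces of all negative eigenvalues; it is automatically
   direct, as eigenvectors for distinct eigenvalues are independent. *)
Definition negative_space_jacobi (R : realType)
    (E : sphere R 3 -> 'I_3 -> sphere R 3 -> 'rV[R]_4) :
    set (sphere R 3 -> 'rV[R]_3) :=
  [set w | exists (r : nat) (l : 'I_r -> R) (v : 'I_r -> sphere R 3 -> 'rV[R]_3),
    [/\ injective l,
        forall i, l i < 0 /\ eigenspace_jacobi E (l i) (v i) &
        forall x, w x = \sum_(i < r) v i x]].

(* [V] is a real vector space of functions with a basis of [d] elements. *)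
Definition has_dim (R : realType) (T : Type) (m : nat)
    (V : set (T -> 'rV[R]_m)) (d : nat) : Prop :=
  exists b : 'I_d -> T -> 'rV[R]_m,
    (forall a : 'I_d -> R,
       (forall x, \sum_(i < d) a i *: b i x = 0) -> forall i, a i = 0) /\
    (forall w : T -> 'rV[R]_m,
       V w <-> exists a : 'I_d -> R, forall x, w x = \sum_(i < d) a i *: b i x).

(* k belongs to {-n, -n+2, ..., n-2, n}. *)
Definition admissible (n : nat) (k : int) : Prop :=
  exists2 j : nat, (j <= n)%N & k = j.*2%:Z - n%:Z.

Definition hopf_value (n : nat) (k : int) : int :=
  (n * (n + 2))%N%:Z + 4%:Z * k.

Definition hopf_pairs (R : realType) (l : R) : set (nat * int) :=
  [set p | admissible p.1 p.2 /\ (hopf_value p.1 p.2)%:~R = l].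

(* Main.v *)
(** Let X0, X1, X2 be the orthonormal frame of S^3 given by left multiplication by
    the quaternions i, j, k; X0 is tangent to the fibres. Then dphi(X0) = 0, and
    e1 = dphi(X1) / 2, e2 = dphi(X2) / 2 trivialise phi^*TS^2. Writing a variation
    field as f1 e1 + f2 e2 and F = f1 + i f2, the Jacobi operator becomes
    F |-> - Delta F + 4 i X0 F. It acts triangularly on the monomials in z1, z2
    and their conjugates, with diagonal entries n (n + 2) - 4 (p - q), where
    n = p + q is the degree and (p, q) the bidegree; subtracting lower terms gives
    explicit eigenfunctions. In place of the surface measure, self-adjointness is
    obtained from an invariant mean: an ultrafilter limit of weighted lattice sums
    over a shell in R^4, for which the integral of a derivative along a linear
    skew field vanishes by telescoping. An eigenfunction orthogonal to the explicit
    ones is orthogonal to all polynomials, in particular to (1 + <x0, x>)^N for all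
    N; these concentrate at x0, so the eigenfunction vanishes there. *)

Require Import Defs.
From HB Require Import structures.
From mathcomp Require Import all_boot all_order all_algebra.
From mathcomp Require Import complex.
From mathcomp Require Import all_classical all_reals all_analysis.
From mathcomp Require Import ring lra zify.

Set Implicit Arguments.
Unset Strict Implicit.
Unset Printing Implicit Defensive.

Import Order.TTheory GRing.Theory Num.Theory.
Import numFieldNormedType.Exports.

Local Open Scope classical_set_scope.
Local Open Scope ring_scope.

(** * Calculus off the origin and on spheres *)

(** The operator is given through an arbitrary local frame [E x] at each point, so one needs that
    only the vectors [E x j x] matter and that they may be exchanged for the quaternion frame; the
    exchange rests on the trace of a bilinear form. The terms $\langle w,d\varphi(E_j)\rangle
    d\varphi(E_j)$ produced by the pullback connection cancel those in the curvature; what remains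
    of the curvature is $-8w$, with $8=|d\varphi|^2$, and the second derivatives of $e_1,e_2$ cancel
    it in turn. On the sphere $|z_1|^2=1-|z_2|^2$, so monomials in $z_2,\bar z_2$ and only one of
    $z_1,\bar z_1$ suffice. There are $n+1$ of each bidegree $(p,q)$ with $p+q=n$, and $F$, $iF$
    count separately over the reals: hence $2(n+1)$, with $k=q-p$. Eigenfunctions sharing an
    eigenvalue are separated by the commuting skew fields [A0] and [AY]. The mean only has to be
    linear, positive, zero on derivatives along skew fields and strictly positive on caps, so
    convergence of the lattice sums is never at issue. The shell stays away from the origin, where
    radial extensions are singular, and the weight is radial, hence killed by skew fields. *)

Section NearEq.
Context {R : realType} {V W : normedModType R}.

Lemma near_eq_diff (f g : V -> W) (x : V) : (\near x, f x = g x) ->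
  differentiable f x -> differentiable g x /\ 'd g x = 'd f x :> (V -> W).
Proof.
move=> fg df.
have fgx : f x = g x by exact: nbhs_singleton fg.
have E : g \o shift x = cst (g x) + 'd f x +o_0 id.
  apply/eqaddoP => _/posnumP[e].
  have /eqaddoP/(_ e%:num (gt0 e)) H := diff_locally df.
  near=> h.
  have -> : (g \o shift x - (cst (g x) + 'd f x)) h
          = (f \o shift x - (cst (f x) + 'd f x)) h.
    rewrite /= -fgx; congr (_ - _).
    suff: f (shift x h) = g (shift x h) by [].
    near: h.
    have := fg; rewrite (near_shift 0 x) subr0.
    by apply: filterS => z /=.
  by near: h.
have dE : 'd g x = 'd f x :> (V -> W).
  by apply: diff_unique => //; exact: diff_continuous.
split=> //; apply/diff_locallyP; rewrite dE; split=> //.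
exact: diff_continuous.
Unshelve. all: by end_near. Qed.

Lemma near_eq_differentiable (f g : V -> W) (x : V) : (\near x, f x = g x) ->
  differentiable f x -> differentiable g x.
Proof. by move=> fg /(near_eq_diff fg)[]. Qed.

End NearEq.

Section Punctured.
Context {R : realType} {n : nat}.
Notation V := 'rV[R]_n.+1.

Lemma near_neq0 (y : V) : y != 0 -> \forall z \near y, z != 0.
Proof.
move=> y0.
have: \forall z \near y, `|z| != 0.
  have C : {for y, continuous (fun z : V => `|z|)} by exact: norm_continuous.
  have /C : nbhs `|y| [set r : R | r != 0].
    by apply: open_nbhs_nbhs; split; [exact: open_neq|rewrite /= normr_eq0].
  by [].
by apply: filterS => z; rewrite normr_eq0.
Qed.

Lemma dotC (u v : V) : dot u v = dot v u.
Proof. by rewrite /dot; apply: eq_bigr => i _; rewrite mulrC. Qed.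

Lemma dot_ge0 (y : V) : 0 <= dot y y.
Proof. by apply: sumr_ge0 => i _; rewrite -expr2 sqr_ge0. Qed.

Lemma dot_eq0 (y : V) : (dot y y == 0) = (y == 0).
Proof.
apply/eqP/eqP => [h|->]; last by rewrite /dot big1 // => i _; rewrite mxE mul0r.
apply/rowP => i; rewrite mxE.
have := psumr_eq0P (fun j _ => sqr_ge0 (y 0 j)).
have h' : \sum_j y 0 j ^+ 2 = 0 by rewrite -[RHS]h; apply: eq_bigr.
move=> /(_ xpredT) -/(_ h' i isT) /eqP; by rewrite sqrf_eq0 => /eqP.
Qed.

Lemma dot_gt0 (y : V) : (0 < dot y y) = (y != 0).
Proof. by rewrite lt0r dot_ge0 andbT dot_eq0. Qed.

Lemma dotZl (a : R) (u v : V) : dot (a *: u) v = a * dot u v.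
Proof. by rewrite /dot mulr_sumr; apply: eq_bigr => i _; rewrite mxE mulrA. Qed.

Lemma dotZr (a : R) (u v : V) : dot u (a *: v) = a * dot u v.
Proof. by rewrite dotC dotZl dotC. Qed.

Lemma dotDl (u u' v : V) : dot (u + u') v = dot u v + dot u' v.
Proof.
by rewrite /dot -big_split; apply: eq_bigr => i _; rewrite mxE mulrDl.
Qed.

Lemma dotDr (u v v' : V) : dot u (v + v') = dot u v + dot u v'.
Proof. by rewrite dotC dotDl !(dotC u). Qed.

Lemma dotNl (u v : V) : dot (- u) v = - dot u v.
Proof. by rewrite -scaleN1r dotZl mulN1r. Qed.

Lemma dotBl (u u' v : V) : dot (u - u') v = dot u v - dot u' v.
Proof. by rewrite dotDl dotNl. Qed.

Lemma sphere_dot (x : sphere R n) : dot (val x) (val x) = 1.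
Proof. by case: x => p /= /eqP. Qed.

Lemma sphere_neq0 (x : sphere R n) : val x != 0.
Proof. by rewrite -dot_eq0 sphere_dot oner_eq0. Qed.

Definition enorm (y : V) : R := Num.sqrt (dot y y).

Lemma enorm_gt0 (y : V) : (0 < enorm y) = (y != 0).
Proof. by rewrite sqrtr_gt0 dot_gt0. Qed.

Lemma enorm_sqr (y : V) : enorm y ^+ 2 = dot y y.
Proof. by rewrite sqr_sqrtr // dot_ge0. Qed.

Lemma enormZ (t : R) (y : V) : 0 < t -> enorm (t *: y) = t * enorm y.
Proof.
move=> t0; rewrite /enorm dotZl dotZr mulrA sqrtrM ?mulr_ge0 ?ltW //.
by rewrite -expr2 sqrtr_sqr gtr0_norm.
Qed.

Lemma enorm_sphere (x : sphere R n) : enorm (val x) = 1.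
Proof. by rewrite /enorm sphere_dot sqrtr1. Qed.

Lemma normalizeE (y : V) : y != 0 -> val (normalize y) = (enorm y)^-1 *: y.
Proof.
move=> y0; rewrite /normalize insubdK // /in_mem /= dotZl dotZr mulrA -expr2.
by rewrite exprVn -/(enorm y) enorm_sqr mulVf // dot_eq0.
Qed.

Lemma enorm_normalize (y : V) : y != 0 -> y = enorm y *: val (normalize y).
Proof.
by move=> y0; rewrite normalizeE // scalerA divff ?scale1r // gt_eqF ?enorm_gt0.
Qed.

Lemma normalize_sphere (x : sphere R n) : normalize (val x) = x.
Proof.
apply: val_inj; rewrite normalizeE ?sphere_neq0 //.
by rewrite enorm_sphere invr1 scale1r.
Qed.

Lemma normalizeZ (t : R) (y : V) : 0 < t -> y != 0 ->
  normalize (t *: y) = normalize y.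
Proof.
move=> t0 y0; apply: val_inj.
rewrite !normalizeE //; last by rewrite scaler_eq0 gt_eqF //= (negPf y0).
rewrite enormZ // scalerA invfM -mulrA (mulrC _ t) mulrA mulVf ?gt_eqF //.
by rewrite mul1r.
Qed.

Section Homogeneous.
Context {W : normedModType R}.
Implicit Type g : V -> W.

(** Degree $-k$: radial extensions have [k = 0], and each directional derivative raises [k] by
    one. *)
Definition homog (k : nat) g :=
  forall t y, 0 < t -> y != 0 -> g (t *: y) = t^-1 ^+ k *: g y.

(** Near [t *: y] the function coincides with a multiple of its composite with the scaling by
    [t^-1], so the chain rule transports everything from [y]. *)
Lemma homog_diff (k : nat) g (t : R) (y : V) : homog k g -> 0 < t -> y != 0 ->
  differentiable g y ->
  differentiable g (t *: y) /\
  (forall v, 'D_v g (t *: y) = t^-1 ^+ k.+1 *: 'D_v g y).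
Proof.
move=> hg t0 y0 dg.
pose s (z : V) : V := t^-1 *: z.
have ds z : differentiable s z by exact: (@ex_diff _ _ _ _ _ _ _ (is_diff_scaler _ _)).
have sty : s (t *: y) = y by rewrite /s scalerA mulVf ?gt_eqF // scale1r.
have ty0 : t *: y != 0 by rewrite scaler_eq0 gt_eqF.
pose h := t^-1 ^+ k *: (g \o s).
have dgs : differentiable (g \o s) (t *: y).
  by apply: differentiable_comp => //; rewrite sty.
have dh : differentiable h (t *: y) by apply: differentiableZ.
have E : \forall z \near (t *: y), h z = g z.
  near=> z; rewrite /h /= /s.
  have z0 : z != 0 by near: z; exact: near_neq0.
  rewrite -[in RHS](scale1r z) -(@mulfV _ t) ?gt_eqF // -scalerA hg //.
  by rewrite scaler_eq0 invr_eq0 gt_eqF.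
have [dg' dE] := near_eq_diff E dh; split=> // v.
rewrite deriveE // dE -deriveE // deriveZ; last exact: diff_derivable.
have dgs' : differentiable g (s (t *: y)) by rewrite sty.
rewrite (deriveE _ dgs) (diff_comp (ds _) dgs') /= sty.
have -> : 'd s (t *: y) v = t^-1 *: v.
  by rewrite (@diff_val _ _ _ _ _ _ _ (is_diff_scaler _ _)).
by rewrite (deriveE _ dg) linearZ /= scalerA exprS mulrC.
Unshelve. all: by end_near. Qed.

(** [smooth_on] gives information at points of the sphere only; homogeneity spreads it over the
    punctured space. *)
Lemma homog_differentiable (k : nat) g : homog k g ->
  (forall x : sphere R n, differentiable g (val x)) ->
  forall y, y != 0 -> differentiable g y.
Proof.
move=> hg dg y y0; rewrite (enorm_normalize y0).
have [] // := @homog_diff k g (enorm y) (val (normalize y)) hg.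
  by rewrite enorm_gt0.
exact: sphere_neq0.
Qed.

Lemma homog_derive (k : nat) g v : homog k g ->
  (forall x : sphere R n, differentiable g (val x)) -> homog k.+1 ('D_v g).
Proof.
move=> hg dg t y t0 y0.
have [] // := homog_diff hg t0 y0; exact: (homog_differentiable hg).
Qed.

End Homogeneous.

(** Euler's relation in degree 0: the function is constant on the ray through [y], so the difference
    quotient is 0 once $|h|<1$. *)
Lemma homog0_euler {W : normedModType R} (g : V -> W) y :
  homog 0 g -> y != 0 -> 'D_y g y = 0.
Proof.
move=> hg y0; apply: cvg_lim => //.
apply: (@cvg_trans _ ((fun=> 0) @ (0 : R)^')); last exact: cvg_cst.
apply: near_eq_cvg; near=> h => /=.
have h1 : 0 < 1 + h.
  rewrite -ltrBlDl sub0r.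
  have : `|h| < 1 by near: h; exact: dnbhs0_lt.
  by rewrite ltr_norml => /andP[].
have -> : h *: y + y = (1 + h) *: y by rewrite scalerDl scale1r addrC.
by rewrite hg // expr0 scale1r subrr scaler0.
Unshelve. all: by end_near. Qed.

End Punctured.

(** * Smooth functions off the origin *)

Section Smooth.
Context {R : realType} {n : nat}.
Notation V := 'rV[R]_n.+1.
Implicit Types (f g : V -> R) (y v : V).

Definition iterD (s : seq V) (g : V -> R) : V -> R :=
  foldr (fun v h => fun y => 'D_v h y) g s.

Definition smooth_off0 (g : V -> R) : Prop :=
  forall s y, y != 0 -> differentiable (iterD s g) y.

(** Closing under equality off the origin discards the junk values of radial extensions and of [rho]
    at 0. *)
Inductive gen_algebra (P : (V -> R) -> Prop) : (V -> R) -> Prop :=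
| gen_algebra_base g : P g -> gen_algebra P g
| gen_algebra_cst c : gen_algebra P (fun=> c)
| gen_algebra_add f g : gen_algebra P f -> gen_algebra P g -> gen_algebra P (f + g)
| gen_algebra_mul f g : gen_algebra P f -> gen_algebra P g -> gen_algebra P (f * g)
| gen_algebra_ext f g : gen_algebra P f -> (forall y, y != 0 -> f y = g y) -> gen_algebra P g.

Lemma off0_near (P : V -> Prop) y : (forall z, z != 0 -> P z) -> y != 0 ->
  \forall z \near y, P z.
Proof. by move=> h y0; have := near_neq0 y0; apply: filterS. Qed.

(* The class [P] need not consist of smooth functions a priori: it suffices
   that derivatives of its members stay in the algebra it generates. *)
Lemma gen_algebra_derive (P : (V -> R) -> Prop) :
  (forall g, P g -> (forall y, y != 0 -> differentiable g y) /\
                    (forall v, gen_algebra P ('D_v g))) ->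
  forall g, gen_algebra P g -> (forall y, y != 0 -> differentiable g y) /\
                    (forall v, gen_algebra P ('D_v g)).
Proof.
move=> hP g; elim=> {g}
  [g /hP //|c|f g sf [df Df] sg [dg Dg]|f g sf [df Df] sg [dg Dg]|f g sf [df Df] fg].
- split=> [y _|v]; first exact: differentiable_cst.
  apply: gen_algebra_ext (gen_algebra_cst _ 0) _ => y _; by rewrite derive_cst.
- split=> [y y0|v]; first by apply: differentiableD; [exact: df|exact: dg].
  apply: gen_algebra_ext (gen_algebra_add (Df v) (Dg v)) _ => y y0.
  by rewrite deriveD //; apply: diff_derivable; [exact: df|exact: dg].
- split=> [y y0|v]; first by apply: differentiableM; [exact: df|exact: dg].
  apply: gen_algebra_ext
    (gen_algebra_add (gen_algebra_mul sf (Dg v)) (gen_algebra_mul sg (Df v))) _ => y y0.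
  by rewrite deriveM //; apply: diff_derivable; [exact: df|exact: dg].
- split=> [y y0|v].
    apply: near_eq_differentiable (df y y0); exact: off0_near.
  apply: gen_algebra_ext (Df v) _ => y y0.
  apply: near_eq_derive; exact: off0_near.
Qed.

Lemma gen_algebra_smooth (P : (V -> R) -> Prop) :
  (forall g, P g -> (forall y, y != 0 -> differentiable g y) /\
                    (forall v, gen_algebra P ('D_v g))) ->
  forall g, gen_algebra P g -> smooth_off0 g.
Proof.
move=> hP g sg s.
have : gen_algebra P (iterD s g).
  by elim: s => [|v s IH] //=; have [_] := gen_algebra_derive hP IH; apply.
by move=> /(gen_algebra_derive hP)[].
Qed.

Lemma smooth_diff g y : smooth_off0 g -> y != 0 -> differentiable g y.
Proof. by move=> sg; exact: (sg [::]). Qed.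

Lemma smooth_derivable g y v : smooth_off0 g -> y != 0 -> derivable g y v.
Proof. by move=> sg y0; apply: diff_derivable; exact: smooth_diff. Qed.

Lemma smooth_D g v : smooth_off0 g -> smooth_off0 ('D_v g).
Proof.
move=> sg s y y0; have := sg (rcons s v) y y0.
by rewrite /iterD foldr_rcons.
Qed.

Definition coordf (i : 'I_n.+1) : V -> R := fun y => y 0 i.
Definition rho : V -> R := fun y => (enorm y)^-1.

Lemma coordf_diff i y : differentiable (coordf i) y.
Proof. exact: differentiable_coord. Qed.

Lemma coordf_D i y v : 'D_v (coordf i) y = v 0 i.
Proof.
rewrite deriveE; last exact: coordf_diff.
pose c := (fun N : V => N 0 i) : V -> R.
have lc : linear c by move=> a u w; rewrite /c !mxE.
pose L := GRing.isLinear.Build _ _ _ _ c lc.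
pose cl : {linear V -> R} := HB.pack c L.
have -> : coordf i = cl by [].
by rewrite diff_lin // => z; apply: differentiable_continuous; exact: coordf_diff.
Qed.

Definition base_class (g : V -> R) : Prop :=
  [\/ smooth_off0 g, exists i, g = coordf i | g = rho].

Definition dotf : V -> R := \sum_(i < n.+1) (coordf i * coordf i).

Lemma dotfE y : dotf y = dot y y.
Proof. by rewrite /dotf fct_sumE. Qed.

Lemma dotf_diff y : differentiable dotf y.
Proof.
by apply: differentiable_sum => i; apply: differentiableM; exact: coordf_diff.
Qed.

Lemma dotf_D y v : 'D_v dotf y = 2 * dot y v.
Proof.
have dc i : derivable (coordf i) y v by apply: diff_derivable; exact: coordf_diff.
rewrite /dotf derive_sum; last by move=> i; exact: (derivableM (dc i) (dc i)).
rewrite /dot mulr_sumr; apply: eq_bigr => i _.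
by rewrite deriveM // coordf_D /coordf /GRing.scale /= mulr2n mulrDl mul1r.
Qed.

Lemma rho_diff y : y != 0 -> differentiable rho y.
Proof.
move=> y0; have dy : 0 < dotf y by rewrite dotfE dot_gt0.
apply: differentiableV; last by rewrite gt_eqF // enorm_gt0.
have -> : enorm = Num.sqrt \o dotf by apply/funext => z; rewrite /enorm /= dotfE.
apply: differentiable_comp; first exact: dotf_diff.
by apply/derivable1_diffP; have [] := is_derive1_sqrt dy.
Qed.

Lemma rho_D y v : y != 0 -> 'D_v rho y = - (dot y v * rho y ^+ 3).
Proof.
move=> y0.
have dr : derivable rho y v by apply: diff_derivable; exact: rho_diff.
have dd : derivable dotf y v by apply: diff_derivable; exact: dotf_diff.
have drr : derivable (rho * rho) y v by exact: (derivableM dr dr).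
(* Differentiating $\rho^2|y|^2=1$ determines the derivative of $\rho$ by algebra alone. *)
have E : 'D_v ((rho * rho) * dotf) y = 0.
  rewrite -[RHS](derive_cst (1 : R) y v); apply: near_eq_derive.
  apply: off0_near y0 => z z0.
  have : enorm z != 0 by rewrite gt_eqF // enorm_gt0.
  by rewrite !fctE dotfE -enorm_sqr /rho => z1; field.
have e0 : enorm y != 0 by rewrite gt_eqF // enorm_gt0.
move: E; rewrite (deriveM drr dd) (deriveM dr dr) dotf_D dotfE -enorm_sqr /GRing.scale /=.
rewrite !fctE /rho => E.
set d := 'D_v _ _ in E *.
have E1 : 2 * d * enorm y + 2 * dot y v * (enorm y)^-1 ^+ 2 = 0.
  by rewrite -[RHS]E; field.
apply: (mulIf e0); apply: (@mulfI _ 2) => //.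
apply/eqP; rewrite -subr_eq0; apply/eqP.
by rewrite -[RHS]E1; field.
Qed.

Lemma base_class_derive g : base_class g ->
  (forall y, y != 0 -> differentiable g y) /\ (forall v, gen_algebra base_class ('D_v g)).
Proof.
case=> [sg|[i ->]|->].
- split=> [y|v]; first exact: smooth_diff.
  by apply: gen_algebra_base; constructor 1; exact: smooth_D.
- split=> [y _|v]; first exact: coordf_diff.
  by apply: gen_algebra_ext (gen_algebra_cst _ (v 0 i)) _ => y _; rewrite coordf_D.
- split=> [y|v]; first exact: rho_diff.
  have srho : gen_algebra base_class rho by apply: gen_algebra_base; constructor 3.
  apply: (@gen_algebra_ext _
    ((fun=> -1) * ((\sum_i (coordf i * (fun=> v 0 i))) * (rho * (rho * rho))))).
    apply: gen_algebra_mul; first exact: gen_algebra_cst.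
    apply: gen_algebra_mul; last by do 2?apply: gen_algebra_mul.
    elim/big_ind: _ => [|f h sf sh|i _]; first exact: (gen_algebra_cst _ 0).
      exact: gen_algebra_add.
    by apply: gen_algebra_mul; [apply: gen_algebra_base; constructor 2; exists i|exact: gen_algebra_cst].
  move=> y y0; by rewrite rho_D // !fctE mulN1r fct_sumE; congr (- (_ * _)).
Qed.

Lemma smooth_base_class g : gen_algebra base_class g -> smooth_off0 g.
Proof. by apply: gen_algebra_smooth; exact: base_class_derive. Qed.

Lemma gen_algebra_smooth_off0 g : smooth_off0 g -> gen_algebra base_class g.
Proof. by move=> sg; apply: gen_algebra_base; constructor 1. Qed.

Lemma smooth_cst c : smooth_off0 (fun=> c).
Proof. by apply: smooth_base_class; exact: gen_algebra_cst. Qed.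

Lemma smooth_coord i : smooth_off0 (coordf i).
Proof. by apply: smooth_base_class; apply: gen_algebra_base; constructor 2; exists i. Qed.

Lemma smooth_rho : smooth_off0 rho.
Proof. by apply: smooth_base_class; apply: gen_algebra_base; constructor 3. Qed.

Lemma smooth_add f g : smooth_off0 f -> smooth_off0 g -> smooth_off0 (f + g).
Proof.
by move=> sf sg; apply: smooth_base_class; apply: gen_algebra_add; exact: gen_algebra_smooth_off0.
Qed.

Lemma smooth_mul f g : smooth_off0 f -> smooth_off0 g -> smooth_off0 (f * g).
Proof.
by move=> sf sg; apply: smooth_base_class; apply: gen_algebra_mul; exact: gen_algebra_smooth_off0.
Qed.

Lemma smooth_ext f g : (forall y, y != 0 -> f y = g y) -> smooth_off0 f ->
  smooth_off0 g.
Proof.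
move=> fg sf; apply: smooth_base_class; apply: gen_algebra_ext fg.
exact: gen_algebra_smooth_off0.
Qed.

Lemma smooth_sum (I : Type) (r : seq I) (P : pred I) (F : I -> V -> R) :
  (forall i, smooth_off0 (F i)) -> smooth_off0 (\sum_(i <- r | P i) F i).
Proof.
move=> sF; elim/big_ind: _ => [|f g|i _]; [exact: (smooth_cst 0)|exact: smooth_add|exact: sF].
Qed.

End Smooth.

(** * Functions on the sphere and linear vector fields *)

Section SphereCalculus.
Context {R : realType} {n : nat}.
Notation V := 'rV[R]_n.+1.
Notation S := (sphere R n).
Implicit Types (f g : S -> R) (y v : V) (x : S) (A : 'M[R]_n.+1).

Definition ext f : V -> R := fun y => f (normalize y).

Definition ssmooth f : Prop := smooth_off0 (ext f).

Definition partial (j : 'I_n.+1) (g : V -> R) : V -> R := 'D_(delta_mx 0 j) g.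

(* The vector field x |-> x A, tangent to the sphere when A is skew. *)
Definition lder A f : S -> R := fun x => 'D_(val x *m A) (ext f) (val x).

Lemma ext_sphere f x : ext f (val x) = f x.
Proof. by rewrite /ext normalize_sphere. Qed.

Lemma ext_homog f : homog 0 (ext f).
Proof. by move=> t y t0 y0; rewrite expr0 scale1r /ext normalizeZ. Qed.

Lemma derive_partial (g : V -> R) y v : differentiable g y ->
  'D_v g y = \sum_j v 0 j * partial j g y.
Proof.
move=> dg; rewrite /partial [in LHS](row_sum_delta v) deriveE // linear_sum /=.
by apply: eq_bigr => j _; rewrite linearZ /= deriveE.
Qed.

Lemma smooth_partial j (g : V -> R) : smooth_off0 g -> smooth_off0 (partial j g).
Proof. exact: smooth_D. Qed.

Lemma partial_homog j f : ssmooth f -> homog 1 (partial j (ext f)).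
Proof.
move=> sf; apply: (homog_derive _ (@ext_homog f)) => x.
by apply: smooth_diff sf _; exact: sphere_neq0.
Qed.

Lemma lderE A f x : ssmooth f ->
  lder A f x = \sum_j (val x *m A) 0 j * partial j (ext f) (val x).
Proof.
by move=> sf; rewrite /lder derive_partial //; apply: smooth_diff sf _; exact: sphere_neq0.
Qed.

(** The factor $|y|$ from the linear coefficients cancels the $|y|^{-1}$ from the partial
    derivatives, so the formula valid on the sphere holds off the origin and can be differentiated
    again. *)
Lemma ext_lder A f y : ssmooth f -> y != 0 ->
  ext (lder A f) y = \sum_j (y *m A) 0 j * partial j (ext f) y.
Proof.
move=> sf y0; rewrite /ext lderE //; apply: eq_bigr => j _.
have ey : 0 < enorm y by rewrite enorm_gt0.
have -> : (y *m A) 0 j = enorm y * (val (normalize y) *m A) 0 j.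
  by rewrite [in LHS](enorm_normalize y0) -scalemxAl mxE.
have -> : partial j (ext f) y = (enorm y)^-1 * partial j (ext f) (val (normalize y)).
  rewrite [in LHS](enorm_normalize y0) (partial_homog j sf ey (sphere_neq0 _)).
  by rewrite expr1.
by rewrite mulrACA divff ?mul1r // gt_eqF.
Qed.

Lemma ssmooth_cst c : ssmooth (fun=> c).
Proof. exact: smooth_cst. Qed.

Lemma ssmooth_add f g : ssmooth f -> ssmooth g -> ssmooth (fun x => f x + g x).
Proof. by move=> sf sg; exact: (smooth_add sf sg). Qed.

Lemma ssmooth_mul f g : ssmooth f -> ssmooth g -> ssmooth (fun x => f x * g x).
Proof. by move=> sf sg; exact: (smooth_mul sf sg). Qed.

Lemma ssmooth_opp f : ssmooth f -> ssmooth (fun x => - f x).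
Proof.
move=> sf; have := ssmooth_mul (ssmooth_cst (-1)) sf.
by congr ssmooth; apply/funext => x; rewrite mulN1r.
Qed.

Lemma ssmooth_sub f g : ssmooth f -> ssmooth g -> ssmooth (fun x => f x - g x).
Proof. by move=> sf sg; exact: ssmooth_add sf (ssmooth_opp sg). Qed.

Lemma ssmooth_lder A f : ssmooth f -> ssmooth (lder A f).
Proof.
move=> sf; apply: (@smooth_ext _ _
  (\sum_j ((\sum_i (coordf i * fun=> A i j)) * partial j (ext f)))).
  move=> y y0; rewrite ext_lder // fct_sumE; apply: eq_bigr => j _.
  by rewrite mxE; congr (_ * _); rewrite fct_sumE.
apply: smooth_sum => j; apply: smooth_mul; last exact: smooth_partial.
apply: smooth_sum => i; apply: smooth_mul; [exact: smooth_coord|exact: smooth_cst].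
Qed.

Definition coord (i : 'I_n.+1) : S -> R := fun x => val x 0 i.

Lemma ext_coord i y : y != 0 -> ext (coord i) y = coordf i y * rho y.
Proof. by move=> y0; rewrite /ext /coord normalizeE // mxE mulrC. Qed.

Lemma ssmooth_coord i : ssmooth (coord i).
Proof.
apply: smooth_ext (smooth_mul (smooth_coord i) smooth_rho) => y y0.
by rewrite ext_coord.
Qed.

Lemma lder_cst A c : lder A (fun=> c) = fun=> 0.
Proof. by apply/funext => x; rewrite /lder derive_cst. Qed.

Lemma ssmooth_derivable f x v : ssmooth f -> derivable (ext f) (val x) v.
Proof. by move=> sf; apply: smooth_derivable sf _; exact: sphere_neq0. Qed.

Lemma lderD A f g : ssmooth f -> ssmooth g ->
  lder A (fun x => f x + g x) = fun x => lder A f x + lder A g x.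
Proof.
move=> sf sg; apply/funext => x; rewrite /lder.
by rewrite -(deriveD (ssmooth_derivable sf) (ssmooth_derivable sg)).
Qed.

Lemma lderM A f g : ssmooth f -> ssmooth g ->
  lder A (fun x => f x * g x) = fun x => lder A f x * g x + f x * lder A g x.
Proof.
move=> sf sg; apply/funext => x; rewrite /lder.
rewrite -[ext _]/(ext f * ext g).
rewrite (deriveM (ssmooth_derivable sf) (ssmooth_derivable sg)).
by rewrite !ext_sphere /GRing.scale /= addrC mulrC.
Qed.

Lemma lderZ A c f : ssmooth f ->
  lder A (fun x => c * f x) = fun x => c * lder A f x.
Proof.
move=> sf; rewrite lderM //; last exact: ssmooth_cst.
by rewrite lder_cst; apply/funext => x; rewrite mul0r add0r.
Qed.

Lemma lderN A f : ssmooth f -> lder A (fun x => - f x) = fun x => - lder A f x.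
Proof.
move=> sf; rewrite (_ : (fun x => - f x) = fun x => -1 * f x); last first.
  by apply/funext => x; rewrite mulN1r.
by rewrite lderZ //; apply/funext => x; rewrite mulN1r.
Qed.

Lemma lderB A f g : ssmooth f -> ssmooth g ->
  lder A (fun x => f x - g x) = fun x => lder A f x - lder A g x.
Proof. by move=> sf sg; rewrite lderD ?lderN //; exact: ssmooth_opp. Qed.

Lemma skew_dot A (u : V) : A^T = - A -> dot u (u *m A) = 0.
Proof.
move=> skA; have E (w z : V) : dot w z = (w *m z^T) 0 0.
  by rewrite /dot mxE; apply: eq_bigr => i _; rewrite mxE.
have : dot u (u *m A) = - dot u (u *m A).
  rewrite {1}dotC (E (u *m A)) (E u) trmx_mul skA mulNmx mulmxN mulmxA.
  by rewrite [in RHS]mxE opprK.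
by move=> /eqP; rewrite -addr_eq0 -mulr2n mulrn_eq0 /= => /eqP.
Qed.

(** The factor [rho] of the radial extension contributes nothing, because $xA$ is orthogonal to
    $x$. *)
Lemma lder_coord A i : A^T = - A -> lder A (coord i) = fun x => (val x *m A) 0 i.
Proof.
move=> skA; apply/funext => x; rewrite /lder.
have x0 := sphere_neq0 x.
rewrite (@near_eq_derive _ _ _ _ (coordf i * rho)); last first.
  by apply: off0_near x0 => z z0; rewrite ext_coord.
rewrite (deriveM (smooth_derivable (smooth_coord i) x0) (smooth_derivable smooth_rho x0)).
rewrite rho_D // skew_dot // mul0r oppr0 scaler0 add0r coordf_D.
by rewrite /rho enorm_sphere invr1 scale1r.
Qed.

Lemma smooth_onE (m : nat) (w : S -> 'rV[R]_m.+1) :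
  smooth_on setT w <-> forall i, ssmooth (fun x => w x 0 i).
Proof.
have coordW (m' : nat) (W : V -> 'rV[R]_m'.+1) y i : differentiable W y ->
    differentiable (fun z => W z 0 i) y.
  move=> dW; exact: (differentiable_comp dW (differentiable_coord _ _ _)).
have Wcoord (m' : nat) (W : V -> 'rV[R]_m'.+1) y :
    (forall i, differentiable (fun z => W z 0 i) y) -> differentiable W y.
  move=> dW.
  have -> : W = \sum_(i < m'.+1) (fun z => W z 0 i *: (delta_mx 0 i : 'rV[R]_m'.+1)).
    by apply/funext => z; rewrite fct_sumE -row_sum_delta.
  by apply: differentiable_sum => i; apply: differentiableZl.
have DW (W : V -> 'rV[R]_m.+1) y v i : differentiable W y ->
    ('D_v W y) 0 i = 'D_v (fun z => W z 0 i) y.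
  by move=> dW; rewrite derive_mx ?mxE //; exact: diff_derivable.
split=> [sw i s|sw s x _].
  (* Homogeneity is carried through the induction because comparing derivatives requires the
     identity of components on a neighbourhood, not only on the sphere. *)
  have H : forall s, [/\ homog (size s) (iter_derive s (radial_ext w)),
    forall y, y != 0 -> differentiable (iter_derive s (radial_ext w)) y &
    forall y, y != 0 -> iterD s (ext (fun x => w x 0 i)) y = iter_derive s (radial_ext w) y 0 i].
    elim=> [|v t [hom dif E]] /=.
      have h0 : homog 0 (radial_ext w).
        by move=> t y t0 y0; rewrite expr0 scale1r /radial_ext normalizeZ.
      split=> //; apply: homog_differentiable h0 _ => x; exact: (sw [::]).
    have h1 : homog (size t).+1 ('D_v (iter_derive t (radial_ext w))).
      by apply: homog_derive hom _ => x; exact: (sw t).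
    split=> //.
      by apply: homog_differentiable h1 _ => x; exact: (sw (v :: t)).
    move=> y y0; rewrite (DW _ _ _ _ (dif y y0)); apply: near_eq_derive.
    exact: off0_near y0.
  move=> y y0; have [_ dif E] := H s.
  apply: near_eq_differentiable (coordW _ _ _ i (dif y y0)).
  by apply: off0_near y0 => z z0; rewrite E.
have H : forall s, (forall y, y != 0 -> differentiable (iter_derive s (radial_ext w)) y) /\
    forall i y, y != 0 -> iterD s (ext (fun x => w x 0 i)) y = iter_derive s (radial_ext w) y 0 i.
  move=> {}s.
  have E : forall i y, y != 0 -> iterD s (ext (fun x => w x 0 i)) y = iter_derive s (radial_ext w) y 0 i.
    elim: s => [//|v t IH] i y y0 /=.
    rewrite DW.
      by apply: near_eq_derive; apply: off0_near y0 => z z0; exact: IH.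
    apply: Wcoord => j; apply: near_eq_differentiable (sw j t y y0).
    by apply: off0_near y0 => z z0; exact: IH.
  split=> // y y0; apply: Wcoord => j; apply: near_eq_differentiable (sw j s y y0).
  by apply: off0_near y0 => z z0; exact: E.
by have [dif _] := H s; apply: dif; exact: sphere_neq0.
Qed.

End SphereCalculus.

(** * Taylor bounds away from the origin *)

Section Taylor.
Context {R : realType} {n : nat}.
Notation V := 'rV[R]_n.+1.
Implicit Types (g F : V -> R) (y v x : V).

Definition annulus (a b : R) : set V :=
  [set y | a <= dot y y /\ forall i, `|y 0 i| <= b].

Lemma dotf_continuous : continuous (@dotf R n).
Proof. by move=> y; apply: differentiable_continuous; exact: dotf_diff. Qed.

Lemma annulus_compact a b : compact (annulus a b).
Proof.
apply: (@subclosed_compact _ _ [set v : V | forall i, v ord0 i \in `[(- b), b]]).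
- have -> : annulus a b = (@dotf R n) @^-1` [set r | a <= r] `&`
     \bigcap_i ((fun y : V => y 0 i) @^-1` [set r | `|r| <= b]).
    apply/seteqP; split=> [y [h1 h2]|y [h1 h2]]; split.
    + by rewrite /= dotfE.
    + by move=> i _; exact: h2.
    + by move: h1; rewrite /= dotfE.
    + by move=> i; exact: (h2 i).
  apply: closedI.
    apply: preimage_closed; last exact: closed_ge.
    by move=> y _; exact: dotf_continuous.
  apply: closed_bigI => i _.
  rewrite (_ : _ @^-1` _ = (fun y : V => `|y 0 i|) @^-1` [set r | r <= b]) //.
  apply: preimage_closed; last exact: closed_le.
  move=> y _; apply: continuous_comp; last exact: norm_continuous.
  exact: coord_continuous.
- apply: (@rV_compact _  _ (fun=> `[(- b), b]%classic)).
  by move=> _; apply: segment_compact.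
- by move=> y [_ h] i; rewrite in_itv /= -ler_norml; exact: h.
Qed.

Lemma annulus_neq0 a b y : 0 < a -> annulus a b y -> y != 0.
Proof. by move=> a0 [ay _]; rewrite -dot_gt0; exact: lt_le_trans ay. Qed.

Lemma annulus_bounded a b g : 0 < a -> smooth_off0 g ->
  exists2 M, 0 < M & forall y, annulus a b y -> `|g y| <= M.
Proof.
move=> a0 sg.
have : compact (g @` annulus a b).
  apply: continuous_compact; last exact: annulus_compact.
  apply: continuous_in_subspaceT => y /set_mem /(annulus_neq0 a0) y0.
  by apply: differentiable_continuous; exact: smooth_diff.
move=> /compact_bounded /ex_strict_bound_gt0[M M0 HM].
by exists M => // y ay; apply: ltW; apply: HM; exists y.
Qed.

Lemma line_is_derive g x v t : derivable g (x + t *: v) v ->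
  is_derive t 1 (fun s : R => g (x + s *: v)) ('D_v g (x + t *: v)).
Proof.
have E : (fun h : R => h^-1 *: (((fun s : R => g (x + s *: v)) \o shift t) (h *: 1) - g (x + t *: v)))
   = (fun h : R => h^-1 *: ((g \o shift (x + t *: v)) (h *: v) - g (x + t *: v))).
  apply/funext => h; congr (_ *: (g _ - _)) => /=.
  by rewrite scalerDl [h *: 1]mulr1 addrCA addrC -addrA addrCA addrC.
move=> dg; split.
  by move: dg; rewrite /derivable E.
by rewrite /derive E.
Qed.

Lemma line_mvt g x v h : 0 <= h ->
  (forall t, 0 <= t <= h -> x + t *: v != 0) -> smooth_off0 g ->
  exists2 c, 0 <= c <= h & g (x + h *: v) - g x = h * 'D_v g (x + c *: v).
Proof.
move=> h0 hx sg.
have dr t : 0 <= t <= h -> is_derive t 1 (fun s : R => g (x + s *: v)) ('D_v g (x + t *: v)).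
  by move=> /hx th; apply: line_is_derive; exact: (smooth_derivable sg th).
have [] := @MVT_segment R (fun s => g (x + s *: v)) (fun t => 'D_v g (x + t *: v)) 0 h h0.
- move=> t; rewrite in_itv /= => /andP[t0 th]; apply: dr.
  by rewrite !ltW.
- apply: continuous_in_subspaceT => t; rewrite inE /= in_itv /= => th.
  apply: differentiable_continuous; apply/derivable1_diffP.
  by have [] := dr t th.
move=> c; rewrite in_itv /= => ch; rewrite scale0r addr0 subr0 => ->.
by exists c => //; rewrite mulrC.
Qed.

Lemma line_lipschitz g x v h M : 0 <= h ->
  (forall t, 0 <= t <= h -> x + t *: v != 0) -> smooth_off0 g ->
  (forall t, 0 <= t <= h -> `|'D_v g (x + t *: v)| <= M) ->
  `|g (x + h *: v) - g x| <= M * h.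
Proof.
move=> h0 hx sg hM; have [c ch ->] := line_mvt h0 hx sg.
by rewrite normrM ger0_norm // mulrC ler_wpM2r // hM.
Qed.

(** The mean value theorem is applied twice, which gives [M] in place of the sharp [M / 2]. *)
Lemma line_taylor g x v h M : 0 <= h ->
  (forall t, 0 <= t <= h -> x + t *: v != 0) -> smooth_off0 g ->
  (forall t, 0 <= t <= h -> `|'D_v ('D_v g) (x + t *: v)| <= M) ->
  `|g (x + h *: v) - g x - h * 'D_v g x| <= M * h ^+ 2.
Proof.
move=> h0 hx sg hM; have [c /andP[c0 ch] ->] := line_mvt h0 hx sg.
rewrite -mulrBr normrM (ger0_norm h0) expr2 mulrA [leLHS]mulrC ler_wpM2r //.
apply: le_trans (_ : M * c <= _); last first.
  by rewrite ler_wpM2l // (le_trans (normr_ge0 _) (hM 0 _)) // lexx.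
apply: (@line_lipschitz ('D_v g) x v c M) => //;
  last by move=> t /andP[t0 tc]; apply: hM; rewrite t0 (le_trans tc).
  by move=> t /andP[t0 tc]; apply: hx; rewrite t0 (le_trans tc).
exact: smooth_D.
Qed.

(* A step of size at most 1/32 from a point of the box to or from the shell
   |y|^2 >= 1/4 stays off the ball |y|^2 < 1/16. *)
Lemma segment_annulus x j s t : (forall i, `|x 0 i| <= 2) ->
  0 <= s <= 32^-1 -> 0 <= t <= 32^-1 ->
  4^-1 <= dot (x + s *: delta_mx 0 j) (x + s *: delta_mx 0 j) ->
  annulus 16^-1 3 (x + t *: (delta_mx 0 j : V)).
Proof.
move=> hx /andP[s0 s1] /andP[t0 t1].
have E r : dot (x + r *: delta_mx 0 j) (x + r *: delta_mx 0 j) =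
    dot x x + 2 * r * x 0 j + r ^+ 2.
  have D1 : dot x (delta_mx 0 j) = x 0 j.
    rewrite /dot (bigD1 j) //= big1 ?addr0 ?mxE ?eqxx ?mulr1 //.
    by move=> i ij; rewrite mxE (negPf ij) mulr0.
  have D2 : dot (delta_mx 0 j : V) (delta_mx 0 j) = 1.
    rewrite /dot (bigD1 j) //= big1 ?addr0 ?mxE ?eqxx ?mulr1 //.
    by move=> i ij; rewrite mxE (negPf ij) mulr0.
  rewrite !dotDl !dotDr !dotZl !dotZr (dotC _ x) D1 D2; ring.
have := hx j; rewrite ler_norml => /andP[xj1 xj2].
rewrite E => h; split.
  rewrite E; have : `|(t - s) * x 0 j| <= 32^-1 * 2.
    rewrite normrM ler_pM //.
    by rewrite ler_norml; apply/andP; split; lra.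
  rewrite ler_norml => /andP[h1 h2].
  have : s ^+ 2 <= 32^-1 * 32^-1 by rewrite expr2 ler_pM.
  have : 0 <= t ^+ 2 by exact: sqr_ge0.
  lra.
move=> i; rewrite !mxE eqxx /=.
apply: le_trans (ler_normD _ _) _.
have : `|t * (i == j)%:R| <= 32^-1.
  by case: (i == j); rewrite ?mulr1 ?mulr0 ?normr0 ?ger0_norm //; lra.
by have := hx i; lra.
Qed.

(** The condition at some [s] holds as soon as one end of the segment lies in the shell; the segment
    then stays in a compact set off the origin, where [F] and its derivatives are bounded. *)
Lemma partial_taylor F j : smooth_off0 F ->
  exists2 C, 0 < C & forall x h s, (forall i, `|x 0 i| <= 2) ->
    0 <= h <= 32^-1 -> 0 <= s <= h ->
    4^-1 <= dot (x + s *: delta_mx 0 j) (x + s *: delta_mx 0 j) ->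
  [/\ `|F x| <= C, `|partial j F x| <= C, `|F (x + h *: delta_mx 0 j)| <= C &
   `|F (x + h *: delta_mx 0 j) - F x - h * partial j F x| <= C * h ^+ 2].
Proof.
move=> sF.
have [M0 M00 H0] := @annulus_bounded 16^-1 3 F ltac:(lra) sF.
have [M1 M10 H1] := @annulus_bounded 16^-1 3 _ ltac:(lra) (smooth_partial j sF).
have [M2 M20 H2] := @annulus_bounded 16^-1 3 _ ltac:(lra) (smooth_partial j (smooth_partial j sF)).
exists (M0 + M1 + M2); first by lra.
move=> x h s hx /andP[h0 h1] /andP[s0 sh] hs.
have K t : 0 <= t <= h -> annulus 16^-1 3 (x + t *: (delta_mx 0 j : V)).
  move=> /andP[t0 th]; apply: segment_annulus hs => //.
    by rewrite s0 (le_trans sh).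
  by rewrite t0 (le_trans th).
have K0 : annulus 16^-1 3 x.
  by rewrite -[x]addr0 -(scale0r (delta_mx 0 j)); apply: K; rewrite lexx.
have Kh : annulus 16^-1 3 (x + h *: (delta_mx 0 j : V)) by apply: K; rewrite h0 lexx.
split.
- by have := H0 _ K0; lra.
- by have := H1 _ K0; lra.
- by have := H0 _ Kh; lra.
- apply: le_trans (_ : M2 * h ^+ 2 <= _).
    apply: (@line_taylor F x (delta_mx 0 j) h M2) => // t /K Kt; last exact: (H2 _ Kt).
    by apply: annulus_neq0 Kt; lra.
  by rewrite ler_wpM2r ?sqr_ge0 //; lra.
Qed.

End Taylor.

(** * An invariant mean on the 3-sphere *)

Section LatticeSum.
Context {R : realType}.

Definition idx4 (a b c d : nat) : 'I_4 -> nat := fun i => nth 0%N [:: a; b; c; d] i.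

(** Iterated sums, so that telescoping in one coordinate is a one-dimensional statement. *)
Definition sum4 (M : nat) (F : ('I_4 -> nat) -> R) : R :=
  \sum_(0 <= a < M) \sum_(0 <= b < M) \sum_(0 <= c < M) \sum_(0 <= d < M)
    F (idx4 a b c d).

Lemma sum4D M F G : sum4 M (fun k => F k + G k) = sum4 M F + sum4 M G.
Proof.
rewrite /sum4 -big_split; apply: eq_bigr => a _ /=.
rewrite -big_split; apply: eq_bigr => b _ /=.
by rewrite -big_split; apply: eq_bigr => c _ /=; rewrite -big_split.
Qed.

Lemma sum4Z M r F : sum4 M (fun k => r * F k) = r * sum4 M F.
Proof.
rewrite /sum4 mulr_sumr; apply: eq_bigr => a _.
rewrite mulr_sumr; apply: eq_bigr => b _.
by rewrite mulr_sumr; apply: eq_bigr => c _; rewrite mulr_sumr.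
Qed.

Lemma eq_sum4 M F G : (forall k, (forall i, (k i < M)%N) -> F k = G k) ->
  sum4 M F = sum4 M G.
Proof.
move=> FG; rewrite /sum4; apply: eq_big_nat => a /andP[_ ha].
apply: eq_big_nat => b /andP[_ hb]; apply: eq_big_nat => c /andP[_ hc].
apply: eq_big_nat => d /andP[_ hd]; apply: FG.
by case=> -[|[|[|[|//]]]].
Qed.

Lemma ler_sum4 M F G : (forall k, (forall i, (k i < M)%N) -> F k <= G k) ->
  sum4 M F <= sum4 M G.
Proof.
move=> FG; rewrite /sum4; apply: ler_sum_nat => a /andP[_ ha].
apply: ler_sum_nat => b /andP[_ hb]; apply: ler_sum_nat => c /andP[_ hc].
apply: ler_sum_nat => d /andP[_ hd]; apply: FG.
by case=> -[|[|[|[|//]]]].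
Qed.

Lemma sum4_cst M r : sum4 M (fun=> r) = M%:R ^+ 4 * r.
Proof.
rewrite /sum4 !sumr_const_nat !subn0 -!mulrnA -[LHS]mulr_natl !natrM.
by congr (_ * _); ring.
Qed.

Lemma ler_norm_sum4 M F r : (forall k, (forall i, (k i < M)%N) -> `|F k| <= r) ->
  `|sum4 M F| <= M%:R ^+ 4 * r.
Proof.
move=> Fr; rewrite ler_norml -mulrN -!sum4_cst.
by rewrite !ler_sum4 // => k /Fr; rewrite ler_norml => /andP[].
Qed.

Definition incr4 (j : 'I_4) (k : 'I_4 -> nat) : 'I_4 -> nat :=
  fun i => (k i + (i == j))%N.

Lemma sum4_telescope M j (g : ('I_4 -> nat) -> R) :
  (forall k, k j = 0%N \/ k j = M -> g k = 0) ->
  sum4 M (fun k => g (incr4 j k) - g k) = 0.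
Proof.
move=> g0.
have inc0 a b c d (h : (0 < 4)%N) : incr4 (Ordinal h) (idx4 a b c d) = idx4 a.+1 b c d.
  by apply/funext; case=> -[|[|[|[|//]]]] ?; rewrite /incr4 /idx4 /= ?addn0 ?addn1.
have inc1 a b c d (h : (1 < 4)%N) : incr4 (Ordinal h) (idx4 a b c d) = idx4 a b.+1 c d.
  by apply/funext; case=> -[|[|[|[|//]]]] ?; rewrite /incr4 /idx4 /= ?addn0 ?addn1.
have inc2 a b c d (h : (2 < 4)%N) : incr4 (Ordinal h) (idx4 a b c d) = idx4 a b c.+1 d.
  by apply/funext; case=> -[|[|[|[|//]]]] ?; rewrite /incr4 /idx4 /= ?addn0 ?addn1.
have inc3 a b c d (h : (3 < 4)%N) : incr4 (Ordinal h) (idx4 a b c d) = idx4 a b c d.+1.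
  by apply/funext; case=> -[|[|[|[|//]]]] ?; rewrite /incr4 /idx4 /= ?addn0 ?addn1.
have -> : sum4 M (fun k => g (incr4 j k) - g k) = sum4 M (fun k => g (incr4 j k)) - sum4 M g.
  rewrite -[X in _ = _ + X]mulN1r -sum4Z -sum4D; apply: eq_sum4 => k _.
  by rewrite mulN1r.
case: j g0 => -[|[|[|[|//]]]] h g0; rewrite {1}/sum4.
- under eq_bigr do (under eq_bigr do (under eq_bigr do (under eq_bigr do rewrite inc0))).
  rewrite -sumrB telescope_sumr //.
  by rewrite !big1 ?subrr // => b _; rewrite big1 // => c _; rewrite big1 // => d _;
    apply: g0; [left|right].
- under eq_bigr do (under eq_bigr do (under eq_bigr do (under eq_bigr do rewrite inc1))).
  rewrite -sumrB big1 // => a _; rewrite -sumrB telescope_sumr //.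
  by rewrite !big1 ?subrr // => b _; rewrite big1 // => c _;
    apply: g0; [left|right].
- under eq_bigr do (under eq_bigr do (under eq_bigr do (under eq_bigr do rewrite inc2))).
  rewrite -sumrB big1 // => a _; rewrite -sumrB big1 // => b _.
  rewrite -sumrB telescope_sumr //.
  by rewrite !big1 ?subrr // => c _; apply: g0; [left|right].
- under eq_bigr do (under eq_bigr do (under eq_bigr do (under eq_bigr do rewrite inc3))).
  rewrite -sumrB big1 // => a _; rewrite -sumrB big1 // => b _.
  rewrite -sumrB big1 // => c _; rewrite -sumrB telescope_sumr //.
  by rewrite !g0 ?subrr //; [left|right].
Qed.

End LatticeSum.

(** * A radial weight and its first-order expansion *)

Section Weight.
Context {R : realType}.
Notation V := 'rV[R]_4.
Implicit Types (x y : V) (F : V -> R).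

Definition cutoff x : R := (dot x x - 4^-1) * (4 - dot x x).

(* A C^1 weight, radial and supported in the shell 1/2 <= |x| <= 2. *)
Definition weight x : R := Num.max 0 (cutoff x) ^+ 2.

(** The partial derivative of [weight] in direction [j]: in $s=|x|^2$ the cutoff is $-s^2+17s/4-1$,
    with derivative $17/4-2s$. *)
Definition dweight (j : 'I_4) x : R :=
  2 * Num.max 0 (cutoff x) * ((17 / 4 - 2 * dot x x) * (2 * x 0 j)).

(** The squared positive part is $C^1$ with a 2-Lipschitz derivative, which is why the weight is a
    square: the remainder is quadratic even across the edge of the support. *)
Lemma max0_sqr_taylor (a b : R) :
  `|Num.max 0 b ^+ 2 - Num.max 0 a ^+ 2 - 2 * Num.max 0 a * (b - a)| <= (b - a) ^+ 2.
Proof.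
have H (c d : R) : `|c| <= d = (- d <= c <= d) by rewrite ler_norml.
have := sqr_ge0 (b - a); have := sqr_ge0 a; have := sqr_ge0 b.
rewrite H !expr2; case: (lerP 0 a) => a0; case: (lerP 0 b) => b0 q1 q2 q3.
- apply/andP; split; lra.
- have := mulr_ge0_le0 a0 (ltW b0) => ab; apply/andP; split; lra.
- have := mulr_le0_ge0 (ltW a0) b0 => ab; apply/andP; split; lra.
- apply/andP; split; lra.
Qed.

Lemma dot_box x : (forall i, `|x 0 i| <= 2) -> 0 <= dot x x <= 16.
Proof.
move=> hx; rewrite dot_ge0 /=.
apply: le_trans (_ : \sum_(i < 4) 4%:R <= _); last first.
  by rewrite sumr_const card_ord -mulrnA.
apply: ler_sum => i _; rewrite -expr2 -real_normK ?num_real //.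
have -> : 4%:R = 2 ^+ 2 :> R by rewrite expr2 -natrM.
by rewrite lerXn2r // nnegrE.
Qed.

Lemma max_cutoff x : 0 <= Num.max 0 (cutoff x) <= 4.
Proof.
rewrite le_max lexx /= ge_max ler0n /= /cutoff.
(* $17/8$ is the midpoint of $1/4$ and $4$, where the cutoff takes its maximum $(15/8)^2<4$. *)
have := sqr_ge0 (dot x x - 17 / 8); rewrite expr2; lra.
Qed.

Lemma weight_bound x : 0 <= weight x <= 16.
Proof.
have /andP[h1 h2] := max_cutoff x.
rewrite /weight sqr_ge0 /=; nra.
Qed.

Lemma dweight_bound j x : (forall i, `|x 0 i| <= 2) -> `|dweight j x| <= 1024.
Proof.
move=> hx; have /andP[h1 h2] := max_cutoff x.
have /andP[s0 s1] := dot_box hx.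
rewrite /dweight normrM.
have E1 : `|2 * Num.max 0 (cutoff x)| <= 8 by rewrite ger0_norm; lra.
have E2 : `|17 / 4 - 2 * dot x x| <= 32 by rewrite ler_norml; apply/andP; split; lra.
have E3 : `|2 * x 0 j| <= 4.
  by have := hx j; rewrite !ler_norml => /andP[??]; apply/andP; split; lra.
have -> : (1024 : R) = 8 * (32 * 4) by rewrite -!natrM.
by rewrite ler_pM // normrM ler_pM.
Qed.

Lemma dot_shift x j (h : R) :
  dot (x + h *: delta_mx 0 j) (x + h *: delta_mx 0 j) = dot x x + (2 * h * x 0 j + h ^+ 2).
Proof.
have D1 : dot x (delta_mx 0 j) = x 0 j.
  rewrite /dot (bigD1 j) //= big1 ?addr0 ?mxE ?eqxx ?mulr1 //.
  by move=> i ij; rewrite mxE (negPf ij) mulr0.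
have D2 : dot (delta_mx 0 j : V) (delta_mx 0 j) = 1.
  rewrite /dot (bigD1 j) //= big1 ?addr0 ?mxE ?eqxx ?mulr1 //.
  by move=> i ij; rewrite mxE (negPf ij) mulr0.
rewrite !dotDl !dotDr !dotZl !dotZr (dotC _ x) D1 D2; ring.
Qed.

(** On the box $|x|^2$ changes by $|d|\le 5h$ and $|17/4-2s|\le 32$, so the cutoff changes by at
    most $(32\cdot5+25)h=185h$. Replacing this change by its linear part costs
    $8(32+25)h^2=456h^2$. *)
Lemma weight_taylor x j (h : R) : (forall i, `|x 0 i| <= 2) -> 0 <= h <= 1 ->
  `|weight (x + h *: delta_mx 0 j) - weight x - h * dweight j x| <= (185 ^+ 2 + 456) * h ^+ 2.
Proof.
move=> hx /andP[h0 h1].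
have /andP[s0 s1] := dot_box hx.
have /andP[m0 m1] := max_cutoff x.
have := hx j; rewrite ler_norml => /andP[x1 x2].
pose b := cutoff (x + h *: delta_mx 0 j); pose a := cutoff x.
pose s := dot x x; rewrite -/s in s0 s1.
pose d := 2 * h * x 0 j + h ^+ 2.
rewrite -/a in m0 m1.
have Eb : b = (s + d - 4^-1) * (4 - (s + d)) by rewrite /b /cutoff dot_shift -/s -/d.
have Ea : a = (s - 4^-1) * (4 - s) by [].
have hd : `|d| <= 5 * h.
  by rewrite /d ler_norml expr2; apply/andP; split; nra.
have hba : b - a = (17 / 4 - 2 * s) * d - d ^+ 2 by rewrite Eb Ea; field.
have E2 : `|17 / 4 - 2 * s| <= 32 by rewrite ler_norml; apply/andP; split; lra.
have hd2 : d ^+ 2 <= 25 * h ^+ 2.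
  rewrite -real_normK ?num_real // (_ : 25 * h ^+ 2 = (5 * h) ^+ 2); last by ring.
  by rewrite lerXn2r // nnegrE; lra.
have hd20 : 0 <= d ^+ 2 by exact: sqr_ge0.
have hab : `|b - a| <= 185 * h.
  rewrite hba; apply: le_trans (ler_normB _ _) _.
  rewrite normrM (ger0_norm hd20).
  have : `|17 / 4 - 2 * s| * `|d| <= 32 * (5 * h) by rewrite ler_pM.
  by rewrite expr2 in hd2; nra.
have hab2 : (b - a) ^+ 2 <= 185 ^+ 2 * h ^+ 2.
  rewrite -real_normK ?num_real // -exprMn.
  by rewrite lerXn2r // nnegrE; lra.
have -> : weight (x + h *: delta_mx 0 j) - weight x - h * dweight j x =
  (Num.max 0 b ^+ 2 - Num.max 0 a ^+ 2 - 2 * Num.max 0 a * (b - a)) +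
  2 * Num.max 0 a * ((17 / 4 - 2 * s) * h ^+ 2 - d ^+ 2).
  by rewrite /weight /dweight -/a -/b -/s hba /d; ring.
apply: le_trans (ler_normD _ _) _.
have T1 := max0_sqr_taylor a b.
have T2 : `|2 * Num.max 0 a * ((17 / 4 - 2 * s) * h ^+ 2 - d ^+ 2)| <= 8 * (57 * h ^+ 2).
  rewrite normrM ler_pM //; first by rewrite ger0_norm; lra.
  apply: le_trans (ler_normB _ _) _.
  rewrite normrM (ger0_norm hd20) (ger0_norm (sqr_ge0 h)).
  have : `|17 / 4 - 2 * s| * h ^+ 2 <= 32 * h ^+ 2 by rewrite ler_wpM2r // sqr_ge0.
  lra.
rewrite [leRHS]mulrDl; apply: lerD; first exact: le_trans T1 hab2.
apply: le_trans T2 _; rewrite mulrA -natrM; exact: lexx.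
Qed.

Lemma weight_eq0 x : dot x x < 4^-1 -> Num.max 0 (cutoff x) = 0.
Proof.
by move=> hx; apply/max_idPl; rewrite /cutoff; apply: mulr_le0_ge0; lra.
Qed.

Lemma weight_prod_taylor F i j : smooth_off0 F -> i != j ->
  exists2 C, 0 < C & forall x h, (forall i, `|x 0 i| <= 2) -> 0 <= h <= 32^-1 ->
    let y := x + h *: delta_mx 0 j in
    `|weight y * y 0 i * F y - weight x * x 0 i * F x
      - h * (x 0 i * (weight x * partial j F x + dweight j x * F x))|
    <= C * h ^+ 2.
Proof.
move=> sF ij; have [C C0 HC] := partial_taylor j sF.
have [K K0 HK] : exists2 K : R, 0 < K & forall x h, (forall i, `|x 0 i| <= 2) ->
    0 <= h <= 1 -> `|weight (x + h *: delta_mx 0 j) - weight x - h * dweight j x| <= K * h ^+ 2.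
  exists (185 ^+ 2 + 456); last by move=> x h hx hh; exact: weight_taylor.
  by apply: ltr_wpDl; [exact: sqr_ge0|rewrite ltr0n].
have [D0 D00 HD] : exists2 D0 : R, 0 < D0 & forall x, (forall i, `|x 0 i| <= 2) -> `|dweight j x| <= D0.
  by exists 1024; [rewrite ltr0n|move=> x; exact: dweight_bound].
have KD : 0 < (K + (2 * D0 + 16)) * C by apply: mulr_gt0 => //; lra.
exists (2 * ((K + (2 * D0 + 16)) * C)); first by apply: mulr_gt0.
move=> x h hx hh /=.
have /andP[h0 h1] := hh.
set y := x + _.
have yi : y 0 i = x 0 i by rewrite !mxE (negPf ij) mulr0 addr0.
have h20 := sqr_ge0 h.
(* If the weight vanishes at both ends, every term is 0; otherwise one end satisfies $|\cdot|^2\ge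
   1/4$ and [F] is controlled along the whole segment. *)
have [/eqP|] := boolP [&& Num.max 0 (cutoff x) == 0 & Num.max 0 (cutoff y) == 0].
  rewrite eqb_id => /andP[/eqP zx /eqP zy].
  rewrite /weight /dweight zx zy.
  rewrite (_ : _ - _ = 0) ?normr0; last by ring.
  by rewrite !mulr_ge0 //; lra.
move=> nz.
have [s /andP[s0 sh] hs] : exists2 s, 0 <= s <= h &
    4^-1 <= dot (x + s *: delta_mx 0 j) (x + s *: delta_mx 0 j).
  move: nz; rewrite negb_and => /orP[nz|nz].
    exists 0; first by rewrite lexx.
    rewrite scale0r addr0 leNgt; apply: contra nz => /weight_eq0 ->; exact: eqxx.
  exists h; first by rewrite h0 lexx.
  by rewrite leNgt; apply: contra nz => /weight_eq0 ->.
have [b1 b2 b3 b4] := HC x h s hx hh ltac:(by rewrite s0 sh) hs.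
rewrite -/y in b3 b4.
(* A discrete Leibniz rule: the coordinate [x 0 i] is unchanged by a step along $j\ne i$ and factors
   out, and each of the three terms is $O(h^2)$. *)
rewrite yi (_ : _ - _ - _ = x 0 i * ((weight y - weight x - h * dweight j x) * F y
   + h * dweight j x * (F y - F x) + weight x * (F y - F x - h * partial j F x))); last by ring.
have h1' : h <= 1 by lra.
have h01 : 0 <= h <= 1 by rewrite h0 h1'.
have W := HK x h hx h01.
have D := HD x hx.
have /andP[w0 w1] := weight_bound x.
have FF : `|F y - F x| <= 2 * C * h.
  rewrite (_ : F y - F x = (F y - F x - h * partial j F x) + h * partial j F x); last by ring.
  apply: le_trans (ler_normD _ _) _; rewrite normrM (ger0_norm h0).
  have : h * `|partial j F x| <= h * C by rewrite ler_wpM2l.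
  have : C * h ^+ 2 <= C * h by rewrite expr2 ler_wpM2l ?(ltW C0) // ler_piMl.
  lra.
rewrite normrM -[leRHS]mulrA ler_pM //.
apply: le_trans (ler_normD _ _) _; apply: le_trans (lerD (ler_normD _ _) (lexx _)) _.
have T1 : `|(weight y - weight x - h * dweight j x) * F y| <= K * h ^+ 2 * C.
  by rewrite normrM ler_pM.
have T2 : `|h * dweight j x * (F y - F x)| <= h * D0 * (2 * C * h).
  by rewrite normrM ler_pM // normrM (ger0_norm h0) ler_wpM2l.
have T3 : `|weight x * (F y - F x - h * partial j F x)| <= 16 * (C * h ^+ 2).
  by rewrite normrM ler_pM // ger0_norm.
have -> : (K + (2 * D0 + 16)) * C * h ^+ 2 =
    K * h ^+ 2 * C + h * D0 * (2 * C * h) + 16 * (C * h ^+ 2) by ring.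
by apply: lerD T3; exact: lerD T1 T2.
Qed.

End Weight.

Section SumLowerBound.
Context {R : realType}.

Lemma sumr_ge_block M p m (f : nat -> R) r : (forall a, 0 <= f a) ->
  (p + m <= M)%N -> (forall a, (p <= a < p + m)%N -> r <= f a) ->
  m%:R * r <= \sum_(0 <= a < M) f a.
Proof.
move=> f0 pm fr.
rewrite (@big_cat_nat _ _ _ p) //=; last by apply: leq_trans pm; exact: leq_addr.
rewrite (@big_cat_nat _ _ _ (p + m)%N p M) ?leq_addr //=.
apply: le_trans (_ : \sum_(p <= a < p + m) f a <= _).
  apply: le_trans (_ : \sum_(p <= a < p + m) r <= _); last exact: ler_sum_nat.
  by rewrite sumr_const_nat addKn mulr_natl.
have s0 a b : 0 <= \sum_(a <= i < b) f i by apply: sumr_ge0.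
have := s0 0%N p; have := s0 (p + m)%N M; lra.
Qed.

Lemma sum4_ge_block M (p : 'I_4 -> nat) m (F : ('I_4 -> nat) -> R) r :
  0 <= r -> (forall k, 0 <= F k) ->
  (forall i, p i + m <= M)%N ->
  (forall k, (forall i, p i <= k i < p i + m)%N -> r <= F k) ->
  m%:R ^+ 4 * r <= sum4 M F.
Proof.
move=> r0 F0 pm Fr; rewrite /sum4.
have m0 : 0 <= m%:R :> R by exact: ler0n.
have -> : m%:R ^+ 4 * r = m%:R * (m%:R * (m%:R * (m%:R * r))) by ring.
have S0 (G : nat -> R) : (forall a, 0 <= G a) -> 0 <= \sum_(0 <= a < M) G a.
  by move=> G0; apply: sumr_ge0.
apply: (sumr_ge_block (p := p (inord 0))) => // [a|a ha].
  by apply: (S0) => b; apply: (S0) => c; apply: (S0) => d.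
apply: (sumr_ge_block (p := p (inord 1))) => // [b|b hb].
  by apply: (S0) => c; apply: (S0) => d.
apply: (sumr_ge_block (p := p (inord 2))) => // [c|c hc].
  by apply: (S0) => d.
apply: (sumr_ge_block (p := p (inord 3))) => // d hd.
apply: Fr => i; rewrite -(inord_val i).
by case: i => -[|[|[|[|//]]]] ? /=; rewrite /idx4 inordK.
Qed.

End SumLowerBound.

(** * Lattice sums and their invariance up to $O(1/N)$ *)

Section Mean.
Context {R : realType}.
Notation V := 'rV[R]_4.
Notation S := (sphere R 3).
Implicit Types (g F : V -> R) (f : S -> R).

Definition latpt (N : nat) (k : 'I_4 -> nat) : V :=
  \row_i ((k i)%:R / N%:R - 2).

(** A Riemann sum of mesh $1/N$ over the cube $[-2,2]^4$, which contains the support of [weight]. *)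
Definition mean (N : nat) g : R :=
  (N%:R^-1) ^+ 4 * sum4 (4 * N) (fun k => g (latpt N k)).

Lemma latpt_box N k : (forall i, (k i < 4 * N)%N) ->
  forall i, `|latpt N k 0 i| <= 2.
Proof.
move=> kN i; have N0 : (0 < N)%N by case: N kN => // /(_ i); rewrite muln0.
rewrite mxE ler_norml; apply/andP; split.
  by have : 0 <= (k i)%:R / N%:R :> R; [rewrite divr_ge0|lra].
have : (k i)%:R / N%:R <= 4 :> R; last by lra.
by rewrite ler_pdivrMr ?ltr0n // -natrM ler_nat ltnW.
Qed.

Lemma latpt_incr N k j : latpt N (incr4 j k) = latpt N k + N%:R^-1 *: delta_mx 0 j.
Proof.
by apply/rowP => i; rewrite !mxE /incr4 natrD eqxx /=; ring.
Qed.

(** On these faces one coordinate is $\pm2$, so $|x|^2\ge4$; this removes the boundary terms of the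
    telescoping sums. *)
Lemma latpt_boundary N k j : (0 < N)%N -> k j = 0%N \/ k j = (4 * N)%N ->
  weight (latpt N k) = 0.
Proof.
move=> N0 kj.
have E : latpt N k 0 j ^+ 2 = 4.
  case: kj => kj; rewrite mxE kj; first by rewrite mul0r sub0r sqrrN -natrX.
  by rewrite natrM mulfK ?pnatr_eq0 -?lt0n //; ring.
have d4 : 4 <= dot (latpt N k) (latpt N k).
  rewrite /dot (bigD1 j) //= -expr2 E lerDl.
  by apply: sumr_ge0 => i _; rewrite -expr2 sqr_ge0.
rewrite /weight (_ : Num.max _ _ = 0) ?expr0n //.
by apply/max_idPl; rewrite /cutoff; apply: mulr_ge0_le0; lra.
Qed.

Lemma meanD N g1 g2 : mean N (fun x => g1 x + g2 x) = mean N g1 + mean N g2.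
Proof. by rewrite /mean sum4D mulrDr. Qed.

Lemma meanZ N c g : mean N (fun x => c * g x) = c * mean N g.
Proof. by rewrite /mean sum4Z mulrCA. Qed.

Lemma mean_bound N g r : (0 < N)%N ->
  (forall k, (forall i, (k i < 4 * N)%N) -> `|g (latpt N k)| <= r) ->
  `|mean N g| <= 4 ^+ 4 * r.
Proof.
move=> N0 hg; rewrite /mean normrM.
have NR : N%:R != 0 :> R by rewrite pnatr_eq0 -lt0n.
rewrite ger0_norm ?exprn_ge0 ?invr_ge0 //.
have -> : 4 ^+ 4 * r = N%:R^-1 ^+ 4 * ((4 * N)%:R ^+ 4 * r) by rewrite natrM; field.
rewrite ler_wpM2l ?exprn_ge0 ?invr_ge0 //.
exact: ler_norm_sum4.
Qed.

(** The threshold 32 makes the mesh $1/N$ an admissible step for [partial_taylor]. *)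
Definition vanishing g : Prop :=
  exists2 C : R, 0 <= C & forall N, (32 <= N)%N -> `|mean N g| <= C / N%:R.

Lemma vanishingD g1 g2 : vanishing g1 -> vanishing g2 ->
  vanishing (fun x => g1 x + g2 x).
Proof.
move=> [C1 C10 H1] [C2 C20 H2]; exists (C1 + C2); first exact: addr_ge0.
move=> N hN; rewrite meanD mulrDl; apply: le_trans (ler_normD _ _) _.
by rewrite lerD ?H1 ?H2.
Qed.

Lemma vanishingZ c g : vanishing g -> vanishing (fun x => c * g x).
Proof.
move=> [C C0 H]; exists (`|c| * C); first by rewrite mulr_ge0.
by move=> N hN; rewrite meanZ normrM -mulrA ler_wpM2l // H.
Qed.

Lemma vanishing0 : vanishing (fun=> 0).
Proof.
exists 0 => // N hN.
by rewrite /mean sum4_cst !mulr0 normr0 mul0r.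
Qed.

Lemma vanishing_sum (I : finType) (g : I -> V -> R) :
  (forall i, vanishing (g i)) -> vanishing (fun x => \sum_i g i x).
Proof.
move=> H; pose P (h : V -> R) := vanishing h.
suff : P (\sum_i g i).
  by rewrite /P; congr vanishing; apply/funext => x; rewrite fct_sumE.
elim/big_ind: _ => [|h1 h2|i _]; [exact: vanishing0|exact: vanishingD|exact: H].
Qed.

(* Up to O(1/N) the summand is N times a difference of values of
   [weight * x_i * F] at neighbouring lattice points, and these telescope. *)
Lemma vanishing_divergence F i j : smooth_off0 F -> i != j ->
  vanishing (fun x => x 0 i * (weight x * partial j F x + dweight j x * F x)).
Proof.
move=> sF ij; have [C C0 HC] := weight_prod_taylor sF ij.
exists (4 ^+ 4 * C); first by rewrite mulr_ge0 ?exprn_ge0 // ltW.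
move=> N hN.
have N0 : (0 < N)%N by exact: leq_trans hN.
have NR : 0 < N%:R :> R by rewrite ltr0n.
set g := (fun x => _).
pose G x := weight x * x 0 i * F x.
pose h : R := N%:R^-1.
have hh : 0 <= h <= 32^-1.
  rewrite /h invr_ge0 ltW //= lef_pV2 ?posrE ?ltr0n //.
  by rewrite ler_nat.
pose g' x := g x + (- N%:R) * (G (x + h *: delta_mx 0 j) - G x).
have -> : mean N g = mean N g'.
  rewrite /g' meanD meanZ.
  suff -> : mean N (fun x => G (x + h *: delta_mx 0 j) - G x) = 0.
    by rewrite mulr0 addr0.
  rewrite /mean; apply/eqP; rewrite mulf_eq0; apply/orP; right; apply/eqP.
  rewrite -[RHS](@sum4_telescope R (4 * N) j (fun k => G (latpt N k))).
    by apply: eq_sum4 => k _; rewrite latpt_incr.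
  by move=> k kj; rewrite /G (latpt_boundary N0 kj) !mul0r.
rewrite -mulrA; apply: mean_bound => // k hk.
set x := latpt N k.
have := HC x h (latpt_box hk) hh; rewrite -/(G x) -/(G (x + h *: delta_mx 0 j)) -/(g x).
have -> : g' x = - N%:R * (G (x + h *: delta_mx 0 j) - G x - h * g x).
  by rewrite /g' /h; field; rewrite gt_eqF.
move=> HH; rewrite normrM normrN (gtr0_norm NR).
have -> : C / N%:R = N%:R * (C * h ^+ 2) by rewrite /h; field; rewrite gt_eqF.
by rewrite ler_wpM2l // ltW.
Qed.

(** A skew field kills the radial weight, so the integrand equals
    $\sum_{i,j}A_{ij}x_i\,\partial_j(\mathrm{weight}\cdot f)$. The diagonal of [A] is 0, which
    leaves the terms $i\ne j$ of [vanishing_divergence]. *)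
Lemma vanishing_lder (A : 'M[R]_4) f : A^T = - A -> ssmooth f ->
  vanishing (fun x => weight x * ext (lder A f) x).
Proof.
move=> skA sf.
pose g i j (x : V) := A i j * (x 0 i * (weight x * partial j (ext f) x + dweight j x * ext f x)).
have -> : (fun x => weight x * ext (lder A f) x) = fun x => \sum_i \sum_j g i j x.
  apply/funext => x.
  (* The origin may be a lattice point, where [ext_lder] says nothing; the weight is 0 there. *)
  have [->|x0] := eqVneq x 0.
    rewrite /weight weight_eq0 ?expr0n ?mul0r /=; last first.
      rewrite /dot big1 ?invr_gt0 // => i _; by rewrite mxE mul0r.
    by rewrite big1 // => i _; rewrite big1 // => j _; rewrite /g mxE mul0r mulr0.
  rewrite ext_lder // exchange_big /=.
  transitivity (\sum_j (weight x * ((x *m A) 0 j * partial j (ext f) x) +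
     (x *m A) 0 j * dweight j x * ext f x)).
    rewrite big_split /= -mulr_sumr -mulr_suml.
    have -> : \sum_j (x *m A) 0 j * dweight j x =
        4 * Num.max 0 (cutoff x) * (17 / 4 - 2 * dot x x) * dot x (x *m A).
      have -> : dot x (x *m A) = \sum_j x 0 j * (x *m A) 0 j by [].
      rewrite [RHS]mulr_sumr; apply: eq_bigr => j _; rewrite /dweight; ring.
    by rewrite skew_dot // mulr0 mul0r addr0.
  apply: eq_bigr => j _; rewrite /g.
  have -> : (x *m A) 0 j = \sum_i x 0 i * A i j by rewrite mxE.
  rewrite !mulr_suml mulr_sumr -big_split /=; apply: eq_bigr => i _; ring.
apply: vanishing_sum => i; apply: vanishing_sum => j.
have [ij|ij] := eqVneq i j; last by apply: vanishingZ; exact: vanishing_divergence.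
rewrite /g (_ : A i j = 0); last first.
  have := congr1 (fun M : 'M[R]_4 => M i i) skA; rewrite !mxE -ij => /eqP.
  by rewrite -addr_eq0 -mulr2n mulrn_eq0 /= => /eqP.
have := vanishing0; congr vanishing; by apply/funext => x; rewrite mul0r.
Qed.

End Mean.

(** * The ultrafilter limit *)

Section InvariantMean.
Context {R : realType}.
Notation V := 'rV[R]_4.
Notation S := (sphere R 3).
Implicit Types (f g : S -> R).

Definition bounded_on_sphere f := exists M : R, forall x, `|f x| <= M.

Lemma coord_le1 (x : S) i : `|val x 0 i| <= 1.
Proof.
have := sphere_dot x; rewrite /dot (bigD1 i) //= => h.
have : 0 <= \sum_(j < 4 | j != i) val x 0 j * val x 0 j.
  by apply: sumr_ge0 => j _; rewrite -expr2 sqr_ge0.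
move=> h0; rewrite -(@ler_pXn2r _ 2) ?nnegrE //.
by rewrite real_normK ?num_real // expr1n expr2; lra.
Qed.

Lemma ssmooth_bounded f : ssmooth f -> bounded_on_sphere f.
Proof.
move=> sf; have [M _ HM] := @annulus_bounded R 3 1 1 (ext f) ltr01 sf.
exists M => x; rewrite -(ext_sphere f x); apply: HM; split; first by rewrite sphere_dot.
by move=> i; exact: coord_le1.
Qed.

Definition wmean (N : nat) f : R := mean N (fun x => weight x * ext f x).

Lemma wmean_bound N f M : (0 < N)%N -> (forall x, `|f x| <= M) ->
  `|wmean N f| <= 4 ^+ 4 * (16 * M).
Proof.
move=> N0 fM; apply: mean_bound => // k _.
have /andP[w0 w1] := weight_bound (latpt N k : V).
rewrite normrM; apply: ler_pM => //; first by rewrite ger0_norm.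
exact: fM.
Qed.

(** A discontinuous indicator is good enough: the mean is linear and positive on all bounded
    functions, and the lower bound for caps is a count of lattice points. *)
Definition cap (x0 : S) (c : R) : S -> R :=
  fun y => if c < dot (val x0) (val y) then 1 else 0.

Lemma cap_bounded x0 c : bounded_on_sphere (cap x0 c).
Proof. by exists 1 => y; rewrite /cap; case: ifP; rewrite ?normr1 ?normr0. Qed.

Lemma cap_near (x0 : S) c : c < 1 -> exists2 d : R, 0 < d & forall y : V,
  (forall i, `|y 0 i - val x0 0 i| < d) -> 1 <= weight y * ext (cap x0 c) y.
Proof.
move=> c1.
have x00 := sphere_neq0 x0.
have C1 : {for val x0, continuous (@dotf R 3)} by exact: dotf_continuous.
pose D : V -> R := \sum_(i < 4) (fun y => val x0 0 i) * ext (coord i).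
have sD : smooth_off0 D.
  by apply: smooth_sum => i; apply: smooth_mul; [exact: smooth_cst|exact: ssmooth_coord].
have DE y : D y = dot (val x0) (val (normalize y)) by rewrite /D fct_sumE.
have C2 : {for val x0, continuous D}.
  by apply: differentiable_continuous; exact: smooth_diff.
have D1 : D (val x0) = 1 by rewrite DE normalize_sphere sphere_dot.
have N1 : \forall y \near val x0, c < D y.
  have /C2 : nbhs (D (val x0)) [set r | c < r] by rewrite D1; exact: lt_nbhsr.
  by [].
have N2 : \forall y \near val x0, 3 / 4 < dotf y.
  have /C1 : nbhs (dotf (val x0)) [set r | 3 / 4 < r].
    by rewrite dotfE sphere_dot; apply: lt_nbhsr; lra.
  by [].
have N3 : \forall y \near val x0, dotf y < 5 / 4.
  have /C1 : nbhs (dotf (val x0)) [set r | r < 5 / 4].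
    by rewrite dotfE sphere_dot; apply: lt_nbhsl; lra.
  by [].
have : \forall y \near val x0, [/\ c < D y, 3 / 4 < dotf y & dotf y < 5 / 4].
  by near=> y; split; near: y.
move=> /nbhs_ballP[d /= d0 Hd]; exists d => // y hy.
have [h1 h2 h3] : [/\ c < D y, 3 / 4 < dotf y & dotf y < 5 / 4].
  apply: Hd; split=> // i j; rewrite ord1 -ball_normE /= distrC; exact: hy.
rewrite /ext /cap -DE h1 mulr1 /weight; rewrite dotfE in h2 h3.
have : 1 <= cutoff y by rewrite /cutoff; nra.
move=> h4; apply: le_trans (_ : cutoff y ^+ 2 <= _); first by rewrite expr2; nra.
have c0 : 0 <= cutoff y by exact: le_trans ler01 h4.
by rewrite lerXn2r // ?nnegrE // le_max ?lexx ?c0 ?orbT.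
Unshelve. all: by end_near. Qed.

(** A cube of side about $d/2$ with corner at [x0] contains at least $(dN/4)^4$ lattice points, each
    contributing at least 1 by [cap_near]. *)
Lemma wmean_cap (x0 : S) c : c < 1 -> exists2 e : R, 0 < e &
  exists N0, forall N, (N0 <= N)%N -> e <= wmean N (cap x0 c).
Proof.
move=> c1; have [d0 d00 Hd0] := cap_near x0 c1.
(* Coordinates of [x0] are at most 1, so [d <= 1] keeps the block of indices below $4N$. *)
pose d := Num.min d0 1.
have d_gt0 : 0 < d by rewrite /d lt_min d00 ltr01.
have d_le1 : d <= 1 by rewrite /d ge_min lexx orbT.
have d_le : d <= d0 by rewrite /d ge_min lexx.
exists ((d / 4) ^+ 4); first by rewrite exprn_gt0 // divr_gt0.
(* $N>4/d$ ensures $\lfloor dN/2\rfloor\ge dN/4$. *)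
exists (Num.truncn (4 / d)).+1 => N hN.
have N4 : 4 / d < N%:R.
  by apply: lt_le_trans (_ : (Num.truncn (4 / d)).+1%:R <= _); [exact: truncnS_gt|rewrite ler_nat].
have NR : 0 < N%:R :> R by apply: lt_trans N4; rewrite divr_gt0.
have dN : 4 < d * N%:R by rewrite mulrC -ltr_pdivrMr.
pose m := Num.truncn (d * N%:R / 2).
pose p i := Num.truncn (N%:R * (val x0 0 i + 2)).
have dN0 : 0 <= d * N%:R / 2 by lra.
have /andP[m1 m2] := truncn_itv dN0.
rewrite -/m in m1 m2.
have px i : (p i)%:R <= N%:R * (val x0 0 i + 2) < (p i).+1%:R.
  apply: truncn_itv; apply: mulr_ge0; first exact: ltW.
  by have := coord_le1 x0 i; rewrite ler_norml => /andP[? ?]; lra.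
have mS : m.+1%:R = m%:R + 1 :> R by rewrite natr1.
have mN : d * N%:R / 4 <= m%:R by rewrite mS in m2; lra.
rewrite /wmean /mean.
apply: le_trans (_ : N%:R^-1 ^+ 4 * (m%:R ^+ 4 * 1) <= _).
  have h1 : d / 4 <= N%:R^-1 * m%:R by rewrite [leRHS]mulrC ler_pdivlMr //; lra.
  have h2 : 0 <= d / 4 by lra.
  by rewrite mulr1 -exprMn lerXn2r // nnegrE (le_trans h2 h1).
rewrite ler_wpM2l ?exprn_ge0 ?invr_ge0 //.
apply: (sum4_ge_block (p := p)) => //.
- move=> k; apply: mulr_ge0; first by have /andP[] := weight_bound (latpt N k : V).
  by rewrite /ext /cap; case: ifP.
- move=> i; rewrite -(ler_nat R) natrD natrM.
  have /andP[p1 _] := px i.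
  have := coord_le1 x0 i; rewrite ler_norml => /andP[_ xi].
  have : N%:R * (val x0 0 i + 2) <= N%:R * 3 by rewrite ler_wpM2l //; lra.
  have : d * N%:R <= 1 * N%:R by rewrite ler_wpM2r // ltW.
  lra.
- move=> k hk; apply: Hd0 => i; apply: lt_le_trans d_le.
  have /andP[k1 k2] := hk i.
  have /andP[p1 p2] := px i.
  rewrite mxE (_ : _ - _ = ((k i)%:R - N%:R * (val x0 0 i + 2)) / N%:R); last first.
    by field; rewrite gt_eqF.
  rewrite normrM normfV (gtr0_norm NR) ltr_pdivrMr //.
  have K1 : (p i)%:R <= (k i)%:R :> R by rewrite ler_nat.
  have K2 : (k i)%:R + 1 <= (p i)%:R + m%:R :> R by rewrite natr1 -natrD ler_nat.
  have pS : (p i).+1%:R = (p i)%:R + 1 :> R by rewrite natr1.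
  rewrite pS in p2.
  by rewrite ltr_norml; apply/andP; split; lra.
Qed.

(* A finitely additive substitute for the surface measure of the sphere; the
   positivity on caps replaces full support. *)
Definition invariant_mean (I : (S -> R) -> R) : Prop :=
  [/\ forall f g, bounded_on_sphere f -> bounded_on_sphere g ->
        I (fun x => f x + g x) = I f + I g,
      forall c f, bounded_on_sphere f -> I (fun x => c * f x) = c * I f,
      forall f, bounded_on_sphere f -> (forall x, 0 <= f x) -> 0 <= I f,
      forall (A : 'M[R]_4) f, A^T = - A -> ssmooth f -> I (lder A f) = 0 &
      forall x0 c, c < 1 -> 0 < I (cap x0 c)].

Lemma invariant_mean_exists : exists I, invariant_mean I.
Proof.
have [U [UU sU]] := @ultraFilterLemma nat \oo _.
have PU : ProperFilter U by exact: ultra_proper.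
have pos : U [set N | (0 < N)%N] by apply: sU; exists 1%N.
have near_N N0 : U [set N | (N0 <= N)%N] by apply: sU; exists N0.
pose I f : R := lim (wmean N f @[N --> U]).
(* The image of [U] is an ultrafilter on a compact segment, hence converges: every bounded sequence
   has a limit along [U]. *)
have cvgI f : bounded_on_sphere f -> wmean N f @[N --> U] --> I f.
  move=> [M fM].
  have K := @segment_compact R (- (4 ^+ 4 * (16 * M))) (4 ^+ 4 * (16 * M)).
  have US : UltraFilter (wmean N f @[N --> U]).
    split; first exact: fmap_proper_filter.
    move=> G PG sG; apply/seteqP; split=> // B GB.
    have [//|UC] := in_ultra_setVsetC ((fun N => wmean N f) @^-1` B) UU.
    have : G set0; last by move=> /filter_not_empty.
    have : G (~` B) by apply: sG.
    by move=> /(filterI GB); rewrite setICr.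
  rewrite compact_ultra in K.
  have [|l [_ /= Hl]] := K _ US.
    rewrite /= /fmap /=; apply: filterS pos => N /= N0.
    by rewrite in_itv /= -ler_norml; exact: wmean_bound.
  by apply/cvg_ex; exists l.
have cU (c : R) : (fun=> c) @ U --> c by exact: cvg_cst.
exists I; split.
- move=> f g bf bg; apply: cvg_lim => //.
  rewrite (_ : (fun N => _) = fun N => wmean N f + wmean N g).
    by apply: cvgD; exact: cvgI.
  apply/funext => N; rewrite /wmean -meanD; congr mean; apply/funext => x.
  by rewrite /ext mulrDr.
- move=> c f bf; apply: cvg_lim => //.
  rewrite (_ : (fun N => _) = fun N => c * wmean N f).
    by apply: cvgM; [exact: cU|exact: cvgI].
  apply/funext => N; rewrite /wmean -meanZ; congr mean; apply/funext => x.
  by rewrite /ext mulrCA.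
- move=> f bf f0; apply: limr_ge; first by apply/cvg_ex; exists (I f); exact: cvgI.
  near=> N; rewrite /wmean /mean mulr_ge0 ?exprn_ge0 ?invr_ge0 //.
  rewrite -[leLHS](_ : sum4 (4 * N) (fun=> 0) = 0); last by rewrite sum4_cst mulr0.
  apply: ler_sum4 => k _; apply: mulr_ge0; last exact: f0.
  by have /andP[] := weight_bound (latpt N k : V).
- move=> A f skA sf; have [C C0 HC] := vanishing_lder skA sf.
  apply: cvg_lim => //; apply/cvgrPdist_lt => e e0.
  have := near_N (maxn 32 (Num.truncn (C / e)).+1).
  apply: filterS => N; rewrite /= geq_max => /andP[h1 h2].
  rewrite sub0r normrN; apply: le_lt_trans (HC N h1) _.
  have NR : 0 < N%:R :> R by rewrite ltr0n; exact: leq_trans h1.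
  rewrite ltr_pdivrMr // mulrC -ltr_pdivrMr //.
  by apply: lt_le_trans (_ : (Num.truncn (C / e)).+1%:R <= _); [exact: truncnS_gt|rewrite ler_nat].
- move=> x0 c c1; have [e e0 [N0 HN]] := wmean_cap x0 c1.
  apply: lt_le_trans e0 _; apply: limr_ge.
    by apply/cvg_ex; exists (I (cap x0 c)); apply: cvgI; exact: cap_bounded.
  by apply: filterS (near_N N0) => N; exact: HN.
Unshelve. all: by end_near. Qed.

End InvariantMean.

(** * Concentration at a point *)

Section Concentration.
Context {R : realType}.
Notation V := 'rV[R]_4.
Notation S := (sphere R 3).
Implicit Types (f g : S -> R).

Lemma bounded_add f g : bounded_on_sphere f -> bounded_on_sphere g ->
  bounded_on_sphere (fun x => f x + g x).
Proof.
move=> [M HM] [N HN]; exists (M + N) => x.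
by apply: le_trans (ler_normD _ _) _; rewrite lerD.
Qed.

Lemma bounded_cst c : bounded_on_sphere (fun=> c : R).
Proof. by exists `|c|. Qed.

Lemma bounded_mul f g : bounded_on_sphere f -> bounded_on_sphere g ->
  bounded_on_sphere (fun x => f x * g x).
Proof. by move=> [M HM] [N HN]; exists (M * N) => x; rewrite normrM ler_pM. Qed.

Lemma ssmooth_exp f n : ssmooth f -> ssmooth (fun x => f x ^+ n).
Proof.
move=> sf; elim: n => [|n IH]; first exact: ssmooth_cst.
have := ssmooth_mul sf IH; congr ssmooth; by apply/funext => x; rewrite exprS.
Qed.

Lemma ssmooth_sum (J : finType) (F : J -> S -> R) : (forall i, ssmooth (F i)) ->
  ssmooth (fun x => \sum_i F i x).
Proof.
move=> sF; suff : ssmooth (\sum_i F i).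
  by congr ssmooth; apply/funext => x; rewrite fct_sumE.
by elim/big_ind: _ => [|f g|i _]; [exact: (ssmooth_cst 0)|exact: ssmooth_add|exact: sF].
Qed.

Lemma ssmooth_dot (x0 : V) : ssmooth (fun x : S => dot x0 (val x)).
Proof.
apply: ssmooth_sum => i; apply: ssmooth_mul; first exact: ssmooth_cst.
exact: ssmooth_coord.
Qed.

Variable I : (S -> R) -> R.
Hypothesis mI : invariant_mean I.

Lemma mean_add f g : bounded_on_sphere f -> bounded_on_sphere g ->
  I (fun x => f x + g x) = I f + I g.
Proof. by case: mI => H _ _ _ _; exact: H. Qed.

Lemma mean_scale c f : bounded_on_sphere f -> I (fun x => c * f x) = c * I f.
Proof. by case: mI => _ H _ _ _; exact: H. Qed.

Lemma mean_ge0 f : bounded_on_sphere f -> (forall x, 0 <= f x) -> 0 <= I f.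
Proof. by case: mI => _ _ H _ _; exact: H. Qed.

Lemma mean_lder (A : 'M[R]_4) f : A^T = - A -> ssmooth f -> I (lder A f) = 0.
Proof. by case: mI => _ _ _ H _; exact: H. Qed.

Lemma mean_cap x0 c : c < 1 -> 0 < I (cap x0 c).
Proof. by case: mI => _ _ _ _ H; exact: H. Qed.

Lemma mean_le f g : bounded_on_sphere f -> bounded_on_sphere g ->
  (forall x, f x <= g x) -> I f <= I g.
Proof.
move=> bf bg fg.
have bNf : bounded_on_sphere (fun x => -1 * f x).
  by apply: bounded_mul => //; exact: bounded_cst.
rewrite -subr_ge0 -[- I f]mulN1r -mean_scale // -mean_add //.
apply: mean_ge0; first exact: bounded_add.
by move=> x; rewrite mulN1r subr_ge0.
Qed.

(* The weights (1 + <x0, y>)^n concentrate at x0 as n grows. *)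
Lemma concentration_le0 f (x0 : S) : ssmooth f ->
  (forall n, I (fun y => f y * (1 + dot (val x0) (val y)) ^+ n) = 0) -> f x0 <= 0.
Proof.
move=> sf H; rewrite leNgt; apply/negP => f0.
pose c := f x0 / 2.
have c0 : 0 < c by rewrite divr_gt0.
have C : {for val x0, continuous (ext f)}.
  by apply: differentiable_continuous; apply: smooth_diff sf _; exact: sphere_neq0.
have /C : nbhs (ext f (val x0)) [set r | c < r].
  by rewrite ext_sphere; apply: lt_nbhsr; rewrite /c; lra.
move=> /nbhs_ballP[d /= d0 Hd].
(* Since $|x_0-y|^2=2-2t$ with $t=\langle x_0,y\rangle$, the condition $t>1-e$ puts [y] within [d]
   of [x0]. *)
pose e := Num.min (d ^+ 2 / 4) 1.
have e0 : 0 < e by rewrite /e lt_min ltr01 divr_gt0 // exprn_gt0.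
have e1 : e <= 1 by rewrite /e ge_min lexx orbT.
have ed : 2 * e < d ^+ 2.
  have : e <= d ^+ 2 / 4 by rewrite /e ge_min lexx.
  have : 0 < d ^+ 2 by rewrite exprn_gt0.
  lra.
pose t (y : S) := dot (val x0) (val y).
have tN1 y : 0 <= 1 + t y.
  have := dot_ge0 (val x0 + val y).
  by rewrite !dotDl !dotDr !sphere_dot (dotC (val y)) -/(t y); lra.
have fc y : 1 - e < t y -> c < f y.
  move=> ty; rewrite -(ext_sphere f y).
  apply: Hd; split=> // i j; rewrite ord1 -ball_normE /=.
  have E : dot (val x0 - val y) (val x0 - val y) = 2 - 2 * t y.
    rewrite dotBl (dotC _ (_ - _)) (dotC (val y)) !dotBl !sphere_dot (dotC (val y)) -/(t y); ring.
  rewrite -(@ltr_pXn2r _ 2) ?nnegrE ?(ltW d0) // real_normK ?num_real //.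
  apply: le_lt_trans (_ : dot (val x0 - val y) (val x0 - val y) < _); last first.
    by rewrite E; lra.
  rewrite /dot (bigD1 j) //= !mxE -expr2 lerDl.
  by apply: sumr_ge0 => k _; rewrite -expr2 sqr_ge0.
have bf := ssmooth_bounded sf; have [M HM] := bf.
have M0 : 0 <= M by exact: le_trans (normr_ge0 _) (HM x0).
(* The weight is at least $k_1^n$ on the cap $t>1-e/2$, where $f>c$, and at most $k_0^n$ where
   $t\le1-e$. In between [f] is still positive and can only help, so $k_0<k_1$ yields a
   contradiction as $n$ grows. *)
pose k1 := 2 - e / 2; pose k0 := 2 - e.
have k00 : 0 <= k0 by rewrite /k0; lra.
have k10 : 0 < k1 by rewrite /k1; lra.
pose b := cap x0 (1 - e / 2).
have bb : bounded_on_sphere b by exact: cap_bounded.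
have Ib : 0 < I b by apply: mean_cap; lra.
have I1 : 0 <= I (fun=> 1) by apply: mean_ge0 => //; exact: bounded_cst.
have K n : c * k1 ^+ n * I b <= M * k0 ^+ n * I (fun=> 1).
  have L y : c * k1 ^+ n * b y + (- (M * k0 ^+ n)) * 1 <= f y * (1 + t y) ^+ n.
    have t0 := tN1 y.
    have P0 : 0 <= (1 + t y) ^+ n by rewrite exprn_ge0.
    have Mk : 0 <= M * k0 ^+ n by rewrite mulr_ge0 // exprn_ge0.
    rewrite /b /cap mulr1; case: ifP => [ty|/negbT].
      have fy : c < f y by apply: fc; rewrite /t; lra.
      rewrite mulr1; apply: le_trans (_ : c * k1 ^+ n <= _); first by lra.
      apply: ler_pM; [exact: ltW|by rewrite exprn_ge0 // ltW|exact: ltW|].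
      apply: lerXn2r; rewrite ?nnegrE ?(ltW k10) //.
      by rewrite /k1 /t; lra.
    rewrite -leNgt -/(t y) mulr0 add0r => ty.
    have [ty'|ty'] := ltP (1 - e) (t y).
      apply: le_trans (_ : 0 <= _); first by lra.
      by rewrite mulr_ge0 // ltW // (lt_trans c0) // fc.
    have : `|f y * (1 + t y) ^+ n| <= M * k0 ^+ n.
      rewrite normrM ler_pM // ger0_norm //; apply: lerXn2r; rewrite ?nnegrE //.
      by rewrite /k0; lra.
    by rewrite ler_norml => /andP[].
  have B1 : bounded_on_sphere (fun y => c * k1 ^+ n * b y).
    by apply: bounded_mul => //; exact: bounded_cst.
  have B2 : bounded_on_sphere (fun y : S => - (M * k0 ^+ n) * 1) by exact: bounded_cst.
  have B3 : bounded_on_sphere (fun y => f y * (1 + t y) ^+ n).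
    apply: bounded_mul => //; apply: ssmooth_bounded; apply: ssmooth_exp.
    by apply: ssmooth_add; [exact: ssmooth_cst|exact: ssmooth_dot].
  have := mean_le (bounded_add B1 B2) B3 L.
  rewrite (H n) mean_add // !mean_scale //; last exact: bounded_cst.
  by rewrite mulNr subr_le0.
pose q := k0 / k1.
have q0 : 0 <= q by rewrite divr_ge0 // ltW.
have q1 : q < 1 by rewrite ltr_pdivrMr // mul1r /k0 /k1; lra.
have K' n : c * I b <= M * I (fun=> 1) * q ^+ n.
  rewrite /q expr_div_n mulrA ler_pdivlMr ?exprn_gt0 //.
  by have := K n; rewrite mulrAC [leRHS]mulrAC.
have cv : M * I (fun=> 1) * q ^+ n @[n --> \oo] --> M * I (fun=> 1) * 0.
  apply: cvgM; first exact: cvg_cst.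
  by apply: cvg_expr; rewrite ger0_norm.
have : c * I b <= M * I (fun=> 1) * 0.
  by apply: (ler_cvg_to (cvg_cst _) cv); near=> n; exact: K'.
by rewrite mulr0 leNgt mulr_gt0.
Unshelve. all: by end_near. Qed.

Lemma concentration f : ssmooth f ->
  (forall (x0 : S) n, I (fun y => f y * (1 + dot (val x0) (val y)) ^+ n) = 0) ->
  forall x, f x = 0.
Proof.
move=> sf H x; apply/eqP; rewrite eq_le (concentration_le0 sf (H x)) /=.
rewrite -oppr_le0; apply: (concentration_le0 (ssmooth_opp sf)) => n.
rewrite (_ : (fun _ => _) = fun y => -1 * (f y * (1 + dot (val x) (val y)) ^+ n)).
  rewrite mean_scale ?H ?mulr0 //; apply: bounded_mul; first exact: ssmooth_bounded.
  apply: ssmooth_bounded; apply: ssmooth_exp.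
  by apply: ssmooth_add; [exact: ssmooth_cst|exact: ssmooth_dot].
by apply/funext => y; rewrite mulN1r mulNr.
Qed.

End Concentration.

(** * The Jacobi operator in a global frame *)

Section TangentialProjection.
Context {R : realType} {n : nat}.
Notation V := 'rV[R]_n.+1.
Implicit Types (x : sphere R n) (u v : V).

Lemma tprojD x u v : tproj x (u + v) = tproj x u + tproj x v.
Proof. by rewrite /tproj dotDl scalerDl opprD addrACA. Qed.

Lemma tprojZ x a u : tproj x (a *: u) = a *: tproj x u.
Proof. by rewrite /tproj dotZl scalerBr scalerA. Qed.

Lemma tprojN x u : tproj x (- u) = - tproj x u.
Proof. by rewrite -scaleN1r tprojZ scaleN1r. Qed.

Lemma tprojB x u v : tproj x (u - v) = tproj x u - tproj x v.
Proof. by rewrite tprojD tprojN. Qed.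

Lemma tproj_normal x : tproj x (val x) = 0.
Proof. by rewrite /tproj sphere_dot scale1r subrr. Qed.

Lemma tproj_id x u : tangent x u -> tproj x u = u.
Proof. by rewrite /tangent /tproj => ->; rewrite scale0r subr0. Qed.

Lemma tproj_sum x (I : finType) (F : I -> V) :
  tproj x (\sum_i F i) = \sum_i tproj x (F i).
Proof.
apply: (big_morph (tproj x)) => [u v|]; first exact: tprojD.
by rewrite /tproj /dot big1 ?scale0r ?subrr // => i _; rewrite mxE mul0r.
Qed.

End TangentialProjection.

Section SecondDerivative.
Context {R : realType}.
Notation V := 'rV[R]_4.
Notation S := (sphere R 3).
Implicit Types (f : S -> R) (x : S) (v : V) (w : S -> 'rV[R]_3).

Definition dirder f x v : R := 'D_v (ext f) (val x).

(** On tangent vectors this is the Hessian of [f] on the sphere, because the radial extension has no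
    normal derivative. *)
Definition hess f x v : R := \sum_a v 0 a * 'D_v (partial a (ext f)) (val x).

Lemma sdiffE (m : nat) (w : S -> 'rV[R]_m.+1) x v :
  (forall i, ssmooth (fun x => w x 0 i)) ->
  sdiff w x v = \row_i dirder (fun x => w x 0 i) x v.
Proof.
move=> sw; rewrite /sdiff derive_mx; last first.
  by apply/derivable_mxP => i j; rewrite ord1; exact: (ssmooth_derivable (sw j)).
by apply/rowP => i; rewrite !mxE.
Qed.

Lemma dirderE f x v : ssmooth f ->
  dirder f x v = \sum_a v 0 a * partial a (ext f) (val x).
Proof.
move=> sf; rewrite /dirder derive_partial //.
by apply: smooth_diff sf _; exact: sphere_neq0.
Qed.

Lemma dirder_normal f x : ssmooth f -> dirder f x (val x) = 0.
Proof. by move=> sf; apply: homog0_euler; [exact: ext_homog|exact: sphere_neq0]. Qed.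

Lemma dirderM f g x v : ssmooth f -> ssmooth g ->
  dirder (fun x => f x * g x) x v = dirder f x v * g x + f x * dirder g x v.
Proof.
move=> sf sg; rewrite /dirder -[ext _]/(ext f * ext g).
rewrite (deriveM (ssmooth_derivable sf) (ssmooth_derivable sg)).
by rewrite !ext_sphere /GRing.scale /= addrC mulrC.
Qed.

Definition spartial (a : 'I_4) f : S -> R := fun x => partial a (ext f) (val x).

Lemma ext_spartial a f y : ssmooth f -> y != 0 ->
  ext (spartial a f) y = enorm y * partial a (ext f) y.
Proof.
move=> sf y0; have ey : 0 < enorm y by rewrite enorm_gt0.
rewrite /ext /spartial [X in _ = _ * partial a _ X](enorm_normalize y0).
rewrite (partial_homog a sf ey (sphere_neq0 _)) expr1 /GRing.scale /=.
by rewrite mulrA divff ?mul1r // gt_eqF.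
Qed.

Lemma smooth_dotf : smooth_off0 (@dotf R 3).
Proof. by apply: smooth_sum => i; apply: smooth_mul; exact: smooth_coord. Qed.

Lemma enormE (y : V) : y != 0 -> enorm y = (dotf * rho) y.
Proof.
move=> y0; rewrite !fctE dotfE -enorm_sqr /rho expr2 mulfK //.
by rewrite gt_eqF // enorm_gt0.
Qed.

Lemma ssmooth_spartial a f : ssmooth f -> ssmooth (spartial a f).
Proof.
move=> sf.
apply: smooth_ext (smooth_mul (smooth_mul smooth_dotf smooth_rho) (smooth_partial a sf)) => y y0.
by rewrite ext_spartial // enormE.
Qed.

(** Extending a partial derivative from the sphere changes it by the factor $|y|$, whose derivative
    in tangent directions is 0. *)
Lemma dirder_spartial a f x v : ssmooth f -> tangent x v ->
  dirder (spartial a f) x v = 'D_v (partial a (ext f)) (val x).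
Proof.
move=> sf tv; have x0 := sphere_neq0 x.
rewrite /dirder (@near_eq_derive _ _ _ _ ((dotf * rho) * partial a (ext f))); last first.
  apply: off0_near x0 => y y0; rewrite ext_spartial // enormE //.
have d1 : derivable (@dotf R 3) (val x) v := smooth_derivable smooth_dotf x0.
have d2 : derivable (@rho R 3) (val x) v := smooth_derivable smooth_rho x0.
have d3 : derivable (partial a (ext f)) (val x) v := smooth_derivable (smooth_partial a sf) x0.
have e : dot (val x) v = 0 by rewrite dotC.
rewrite (deriveM (derivableM d1 d2) d3) (deriveM d1 d2) rho_D // dotf_D e.
rewrite -(enormE x0) enorm_sphere /GRing.scale /=.
by rewrite !(mul0r, mulr0, oppr0, addr0) mul1r.
Qed.

End SecondDerivative.

(** * Second covariant derivatives along the Hopf map *)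

Section Hopf.
Context {R : realType}.
Notation V := 'rV[R]_4.
Notation S := (sphere R 3).
Implicit Types (x : S) (v : V).

Definition c0 : S -> R := coord (inord 0).
Definition c1 : S -> R := coord (inord 1).
Definition c2 : S -> R := coord (inord 2).
Definition c3 : S -> R := coord (inord 3).

Definition hcomp (i : 'I_3) : S -> R := fun x => val (hopf x) 0 i.

Lemma hcompE (i : 'I_3) x : hcomp i x =
  [:: 2 * (c0 x * c2 x + c1 x * c3 x); 2 * (c0 x * c3 x - c1 x * c2 x);
      c2 x ^+ 2 + c3 x ^+ 2 - (c0 x ^+ 2 + c1 x ^+ 2)]`_i.
Proof.
rewrite /hcomp mxE; case: i => -[|[|[|//]]] ? /=.
- rewrite /c0 /c1 /c2 /c3 /coord; ring.
- rewrite /c0 /c1 /c2 /c3 /coord; ring.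
- by rewrite !sqr_sqrtr ?addr_ge0 ?sqr_ge0.
Qed.

Lemma ssmooth_sqr (f : S -> R) : ssmooth f -> ssmooth (fun x => f x ^+ 2).
Proof. exact: ssmooth_exp. Qed.

Lemma ssmooth_hcomp i : ssmooth (hcomp i).
Proof.
have -> : hcomp i = fun x => [:: 2 * (c0 x * c2 x + c1 x * c3 x); 2 * (c0 x * c3 x - c1 x * c2 x);
      c2 x ^+ 2 + c3 x ^+ 2 - (c0 x ^+ 2 + c1 x ^+ 2)]`_i.
  by apply/funext => x; exact: hcompE.
have s0 := ssmooth_coord (inord 0 : 'I_4) : ssmooth c0.
have s1 := ssmooth_coord (inord 1 : 'I_4) : ssmooth c1.
have s2 := ssmooth_coord (inord 2 : 'I_4) : ssmooth c2.
have s3 := ssmooth_coord (inord 3 : 'I_4) : ssmooth c3.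
case: i => -[|[|[|//]]] ? /=.
- by apply: ssmooth_mul; [exact: ssmooth_cst|apply: ssmooth_add; exact: ssmooth_mul].
- by apply: ssmooth_mul; [exact: ssmooth_cst|apply: ssmooth_sub; exact: ssmooth_mul].
- by apply: ssmooth_sub; apply: ssmooth_add; exact: ssmooth_sqr.
Qed.

Lemma dhopfE x v : dhopf x v = \row_i dirder (hcomp i) x v.
Proof. by apply: sdiffE => i; exact: ssmooth_hcomp. Qed.

Lemma dhopf_entry x v i : dhopf x v 0 i = dirder (hcomp i) x v.
Proof. by rewrite dhopfE mxE. Qed.

Lemma dirder_cst c x v : dirder (fun _ : S => c) x v = 0.
Proof. by rewrite /dirder derive_cst. Qed.

Lemma dirder3 (F : 'I_3 -> S -> R) x v : (forall i, ssmooth (F i)) ->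
  dirder (fun x => \sum_i F i x) x v = \sum_i dirder (F i) x v.
Proof.
move=> sF; rewrite /dirder.
have -> : ext (fun x => \sum_i F i x) = \sum_(i < 3) ext (F i).
  by apply/funext => y; rewrite fct_sumE.
by rewrite derive_sum // => i; exact: ssmooth_derivable.
Qed.

(** Differentiate $|\varphi|^2=1$. *)
Lemma dhopf_tangent x v : dot (dhopf x v) (val (hopf x)) = 0.
Proof.
have : dirder (fun y => \sum_i hcomp i y * hcomp i y) x v = 0.
  rewrite (_ : (fun y => _) = fun=> 1) ?dirder_cst //.
  by apply/funext => y; exact: sphere_dot.
rewrite dirder3; last by move=> i; apply: ssmooth_mul; exact: ssmooth_hcomp.
have -> : \sum_i dirder (fun y => hcomp i y * hcomp i y) x v = 2 * dot (dhopf x v) (val (hopf x)).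
  rewrite /dot mulr_sumr; apply: eq_bigr => i _.
  rewrite dirderM; try exact: ssmooth_hcomp.
  by rewrite dhopfE mxE -/(hcomp i x); ring.
by move=> /eqP; rewrite mulf_eq0 pnatr_eq0 /= => /eqP.
Qed.

Variable w : S -> 'rV[R]_3.
Hypothesis vw : variation_field w.

Definition wcomp (i : 'I_3) : S -> R := fun x => w x 0 i.

Lemma ssmooth_wcomp i : ssmooth (wcomp i).
Proof. by case: vw => /smooth_onE sw _; exact: sw. Qed.

Lemma sdiff_wE x v : sdiff w x v = \row_i dirder (wcomp i) x v.
Proof. by apply: sdiffE => i; exact: ssmooth_wcomp. Qed.

Lemma sdiff_w_entry x v i : sdiff w x v 0 i = dirder (wcomp i) x v.
Proof. by rewrite sdiff_wE mxE. Qed.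

(** Differentiate $\langle w,\varphi\rangle=0$. *)
Lemma sdiff_w_normal x v :
  dot (sdiff w x v) (val (hopf x)) = - dot (w x) (dhopf x v).
Proof.
have : dirder (fun y => \sum_i wcomp i y * hcomp i y) x v = 0.
  rewrite (_ : (fun y => _) = fun=> 0) ?dirder_cst //.
  by apply/funext => y; case: vw => _ /(_ y).
rewrite dirder3; last first.
  by move=> i; apply: ssmooth_mul; [exact: ssmooth_wcomp|exact: ssmooth_hcomp].
have -> : \sum_i dirder (fun y => wcomp i y * hcomp i y) x v =
    dot (sdiff w x v) (val (hopf x)) + dot (w x) (dhopf x v).
  rewrite /dot -big_split; apply: eq_bigr => i _ /=.
  rewrite dirderM; [|exact: ssmooth_wcomp|exact: ssmooth_hcomp].
  by rewrite sdiff_w_entry dhopf_entry.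
by move=> /eqP; rewrite addr_eq0 => /eqP.
Qed.

(** Radial extensions have no normal derivative; hence the tangential projection in [levi_civita]
    does not affect the derivative of [w]. *)
Lemma sdiff_w_shift x v a : sdiff w x (v - a *: val x) = sdiff w x v.
Proof.
apply/rowP => i; rewrite [LHS]sdiff_w_entry [RHS]sdiff_w_entry.
rewrite [LHS]dirderE ?[RHS]dirderE; try exact: ssmooth_wcomp.
have := dirder_normal x (ssmooth_wcomp i); rewrite dirderE; last exact: ssmooth_wcomp.
move=> e.
transitivity (\sum_b v 0 b * partial b (ext (wcomp i)) (val x)
   - a * \sum_b val x 0 b * partial b (ext (wcomp i)) (val x)).
  rewrite mulr_sumr -sumrB; apply: eq_bigr => b _.
  by rewrite [in LHS]mxE [X in _ + X]mxE [X in - X]mxE mulrBl mulrA.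
by rewrite e mulr0 subr0.
Qed.

Definition hessrow x v : 'rV[R]_3 := \row_i hess (wcomp i) x v.

Section Frame.
Variables (X : S -> V) (x : S).
Hypothesis dX : differentiable (radial_ext X) (val x).
Hypothesis tX : tangent x (X x).

Let v := X x.
Let dXv : V := sdiff X x v.

(** Leibniz rule for $dw(X)-\langle dw(X),\varphi\rangle\varphi$. The coefficient [a] is left
    unspecified because the outer projection kills multiples of $\varphi$. *)
Lemma sdiff_pullback_conn : exists a : R,
  sdiff (pullback_conn X w) x v =
  (sdiff w x dXv + hessrow x v) - a *: val (hopf x)
   - dot (sdiff w x v) (val (hopf x)) *: dhopf x v.
Proof.
have x0 := sphere_neq0 x.
pose Xa (a : 'I_4) : V -> R := fun y => radial_ext X y 0 a.
have dXa a : derivable (Xa a) (val x) v.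
  apply: diff_derivable.
  exact: (differentiable_comp dX (differentiable_coord _ _ _)).
pose P a i : V -> R := ext (spartial a (wcomp i)).
have dP a i : derivable (P a i) (val x) v.
  by apply: ssmooth_derivable; apply: ssmooth_spartial; exact: ssmooth_wcomp.
have dXP a i : derivable (Xa a * P a i) (val x) v := derivableM (dXa a) (dP a i).
pose u i : V -> R := \sum_(a < 4) (Xa a * P a i).
have du i : derivable (u i) (val x) v by apply: derivable_sum => a; exact: dXP.
have dh i : derivable (ext (hcomp i)) (val x) v.
  by apply: ssmooth_derivable; exact: ssmooth_hcomp.
have duh i : derivable (u i * ext (hcomp i)) (val x) v := derivableM (du i) (dh i).
pose c : V -> R := \sum_(k < 3) (u k * ext (hcomp k)).
have dc : derivable c (val x) v by apply: derivable_sum => a; exact: duh.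
have uE i y : u i y = sdiff w (normalize y) (X (normalize y)) 0 i.
  rewrite sdiff_w_entry dirderE; last exact: ssmooth_wcomp.
  by rewrite /u fct_sumE; apply: eq_bigr => a _.
have cE y : c y = dot (sdiff w (normalize y) (X (normalize y))) (val (hopf (normalize y))).
  rewrite /c fct_sumE; apply: eq_bigr => k _.
  by rewrite !fctE uE.
have dch i : derivable (c * ext (hcomp i)) (val x) v := derivableM dc (dh i).
have E i : (fun y => radial_ext (pullback_conn X w) y 0 i) = u i - c * ext (hcomp i).
  apply/funext => y; rewrite /radial_ext /pullback_conn /tproj mxE [in LHS]mxE !fctE uE cE.
  by congr (_ + _); rewrite mxE.
have Dx i : derivable (fun y => radial_ext (pullback_conn X w) y 0 i) (val x) v.
  by rewrite E; exact: (derivableB (du i) (dch i)).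
have duE i : 'D_v (u i) (val x) = (sdiff w x dXv + hessrow x v) 0 i.
  rewrite mxE sdiff_w_entry [X in _ = _ + X]mxE dirderE; last exact: ssmooth_wcomp.
  rewrite /u derive_sum; last by move=> a; exact: dXP.
  rewrite /hess -big_split; apply: eq_bigr => a _ /=.
  have e1 : Xa a (val x) = v 0 a by rewrite /Xa /radial_ext normalize_sphere.
  have e2 : P a i (val x) = partial a (ext (wcomp i)) (val x).
    by rewrite /P ext_sphere.
  have e3 : 'D_v (P a i) (val x) = 'D_v (partial a (ext (wcomp i))) (val x).
    by apply: dirder_spartial => //; exact: ssmooth_wcomp.
  have e4 : 'D_v (Xa a) (val x) = dXv 0 a.
    rewrite /dXv /sdiff derive_mx; last exact: diff_derivable.
    by rewrite mxE.
  by rewrite (deriveM (dXa a) (dP a i)) e1 e2 e3 e4 [LHS]addrC [X in X + _]mulrC.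
exists ('D_v c (val x)).
rewrite /sdiff derive_mx; last first.
  by apply/derivable_mxP => i j; rewrite ord1; exact: Dx.
apply/rowP => i; rewrite mxE E (deriveB (du i) (dch i)) (deriveM dc (dh i)) duE.
rewrite -/(sdiff w x v) -/(sdiff w x dXv).
set z := sdiff w x dXv + hessrow x v.
have -> (a b : R) (p q : 'rV[R]_3) : (z - a *: p - b *: q) 0 i = z 0 i - a * p 0 i - b * q 0 i.
  by rewrite !mxE.
rewrite dhopf_entry cE ext_sphere /GRing.scale /= normalize_sphere -/v -/(hcomp i x) /dirder.
ring.
Qed.

Lemma levi_civita_tproj : sdiff w x (levi_civita X X x) = sdiff w x dXv.
Proof. exact: sdiff_w_shift. Qed.

(* The derivative of the frame drops out: what is left depends on [X x] only. *)
Lemma second_cov_derivE : second_cov_deriv X X w x =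
  tproj (hopf x) (hessrow x v) + dot (w x) (dhopf x v) *: dhopf x v.
Proof.
have [a E] := sdiff_pullback_conn.
rewrite /second_cov_deriv /pullback_conn -/v levi_civita_tproj.
rewrite -/(pullback_conn X w) E !tprojB !tprojZ tprojD tproj_normal scaler0 subr0.
rewrite (tproj_id (dhopf_tangent x v)) sdiff_w_normal scaleNr opprK.
by apply/eqP; rewrite subr_eq; apply/eqP; rewrite -addrA addrC.
Qed.

End Frame.

End Hopf.

(** * Independence of the orthonormal frame *)

Section Trace.
Context {R : realType}.
Notation V := 'rV[R]_4.
Notation S := (sphere R 3).
Implicit Types (f : S -> R) (x : S).

Definition onb (x : S) (v : 'I_3 -> V) : Prop :=
  (forall i, tangent x (v i)) /\ (forall i j, dot (v i) (v j) = (i == j)%:R).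

Definition bform (C : 'M[R]_4) (u v : V) : R := \sum_a \sum_b u 0 a * v 0 b * C a b.

(** Adjoining the normal [x] gives an orthonormal basis of $\mathbb{R}^4$, over which the form sums
    to the trace; the right side no longer depends on the tangent basis. *)
Lemma onb_trace x v C : onb x v ->
  \sum_j bform C (v j) (v j) = \tr C - bform C (val x) (val x).
Proof.
move=> [tv ov].
pose r (i : 'I_4) : V := oapp v (val x) (unlift ord0 i).
pose M : 'M[R]_4 := \matrix_(i, a) r i 0 a.
have MM : M *m M^T = 1%:M.
  apply/matrixP => i j; rewrite [LHS]mxE [RHS]mxE.
  transitivity (dot (r i) (r j)).
    by rewrite /dot; apply: eq_bigr => a _; rewrite !mxE.
  rewrite /r; case: unliftP => [i'|] ->; case: unliftP => [j'|] -> /=.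
  - by rewrite ov (inj_eq lift_inj).
  - by rewrite tv.
  - by rewrite dotC tv.
  - by rewrite sphere_dot.
have MTM : M^T *m M = 1%:M := mulmx1C MM.
have T : \sum_i bform C (r i) (r i) = \tr C.
  rewrite /bform exchange_big /=; apply: eq_bigr => a _.
  rewrite exchange_big /= (bigD1 a) //= [X in _ + X]big1 ?addr0.
    rewrite -mulr_suml -[RHS]mul1r; congr (_ * _).
    have <- : (M^T *m M) a a = 1 by rewrite MTM mxE eqxx.
    by rewrite [RHS]mxE; apply: eq_bigr => i _; rewrite !mxE.
  move=> b ba; rewrite -mulr_suml; apply/eqP; rewrite mulf_eq0; apply/orP; left.
  have /eqP : (M^T *m M) a b = 0 by rewrite MTM mxE eq_sym (negPf ba).
  by rewrite mxE; congr (_ == _); apply: eq_bigr => i _; rewrite !mxE.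
rewrite -T [in RHS]big_ord_recl.
have -> : r ord0 = val x by rewrite /r unlift_none.
rewrite [RHS]addrC addKr; apply: eq_bigr => j _.
by rewrite /r liftK.
Qed.

Lemma hessE f x v : ssmooth f ->
  hess f x v = bform (\matrix_(a, b) partial b (partial a (ext f)) (val x)) v v.
Proof.
move=> sf; rewrite /hess /bform; apply: eq_bigr => a _.
rewrite derive_partial; last first.
  by apply: smooth_diff (sphere_neq0 x); exact: smooth_partial.
by rewrite mulr_sumr; apply: eq_bigr => b _; rewrite mxE mulrA.
Qed.

Lemma hess_onb f x u v : ssmooth f -> onb x u -> onb x v ->
  \sum_j hess f x (u j) = \sum_j hess f x (v j).
Proof.
move=> sf ou ov.
have [C H] : exists C, forall z, hess f x z = bform C z z.
  by eexists=> z; exact: hessE.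
transitivity (\sum_j bform C (u j) (u j)); first by apply: eq_bigr => j _; exact: H.
rewrite (onb_trace C ou) -(onb_trace C ov).
by apply: eq_bigr => j _; rewrite H.
Qed.

Lemma dirder_sqr_onb f x u v : ssmooth f -> onb x u -> onb x v ->
  \sum_j dirder f x (u j) ^+ 2 = \sum_j dirder f x (v j) ^+ 2.
Proof.
move=> sf ou ov.
have [C E] : exists C, forall z, dirder f x z ^+ 2 = bform C z z.
  exists (\matrix_(a, b) (partial a (ext f) (val x) * partial b (ext f) (val x))) => z.
  rewrite dirderE // expr2 mulr_suml; apply: eq_bigr => a _.
  rewrite mulr_sumr; apply: eq_bigr => b _.
  by rewrite mxE [LHS]mulrACA.
transitivity (\sum_j bform C (u j) (u j)); first by apply: eq_bigr => j _; exact: E.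
rewrite (onb_trace C ou) -(onb_trace C ov).
by apply: eq_bigr => j _; rewrite E.
Qed.

(** The orbits of the field are great circles: the first-order term is the derivative along
    $xA^2=-x$, which is normal and contributes 0. *)
Lemma lder_lder (A : 'M[R]_4) f x : A *m A = - 1%:M -> ssmooth f ->
  lder A (lder A f) x = hess f x (val x *m A).
Proof.
move=> A2 sf; have x0 := sphere_neq0 x.
set v := val x *m A.
pose L (j : 'I_4) : V -> R := \sum_(i < 4) (coordf i * fun=> A i j).
have LE j y : L j y = (y *m A) 0 j by rewrite /L fct_sumE mxE.
have sL j : smooth_off0 (L j).
  by apply: smooth_sum => i; apply: smooth_mul; [exact: smooth_coord|exact: smooth_cst].
have dL j : derivable (L j) (val x) v := smooth_derivable (sL j) x0.
have dP j : derivable (partial j (ext f)) (val x) v := smooth_derivable (smooth_partial j sf) x0.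
have dLP j : derivable (L j * partial j (ext f)) (val x) v := derivableM (dL j) (dP j).
rewrite /lder -/v.
rewrite (@near_eq_derive _ _ _ _ (\sum_(j < 4) (L j * partial j (ext f)))); last first.
  apply: off0_near x0 => y y0; rewrite ext_lder // fct_sumE; apply: eq_bigr => j _.
  by rewrite !fctE LE.
rewrite derive_sum; last by move=> j; exact: dLP.
have DL j : 'D_v (L j) (val x) = - val x 0 j.
  have dc i : derivable (coordf i * fun=> A i j) (val x) v.
    by apply: smooth_derivable x0; apply: smooth_mul; [exact: smooth_coord|exact: smooth_cst].
  rewrite /L derive_sum; last by move=> i; exact: dc.
  transitivity ((v *m A) 0 j).
    rewrite mxE; apply: eq_bigr => i _.
    have d1 : derivable (@coordf R 3 i) (val x) v := smooth_derivable (smooth_coord i) x0.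
    rewrite (deriveM d1 (derivable_cst _ _ _)) derive_cst scaler0 add0r coordf_D.
    by rewrite /GRing.scale /= mulrC.
  by rewrite /v -mulmxA A2 mulmxN mulmx1 mxE.
transitivity (\sum_j (v 0 j * 'D_v (partial j (ext f)) (val x) - val x 0 j * partial j (ext f) (val x))).
  apply: eq_bigr => j _; rewrite (deriveM (dL j) (dP j)) DL LE -/v.
  by congr (_ + _); rewrite /GRing.scale /= mulrN mulrC.
have e : \sum_j val x 0 j * partial j (ext f) (val x) = 0.
  by rewrite -[RHS](dirder_normal x sf) [RHS]dirderE.
by rewrite sumrB e subr0.
Qed.

End Trace.

(** * The quaternion frame of the 3-sphere *)

Section QuaternionFields.
Context {R : realType}.
Notation V := 'rV[R]_4.
Notation S := (sphere R 3).
Implicit Types (f g : S -> R) (x : S).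

Definition mx4 (s : seq (seq R)) : 'M[R]_4 :=
  \matrix_(i, j) nth 0 (nth [::] s i) j.

(* In the coordinates (z1, z2) of C^2: A0 is z |-> i z, A1 is
   (z1, z2) |-> (- conj z2, conj z1), A2 is i A1 and AY is (z1, z2) |-> (i z1, 0). *)
Definition A0 := mx4 [:: [:: 0; 1; 0; 0]; [:: -1; 0; 0; 0]; [:: 0; 0; 0; 1]; [:: 0; 0; -1; 0]].
Definition A1 := mx4 [:: [:: 0; 0; 1; 0]; [:: 0; 0; 0; -1]; [:: -1; 0; 0; 0]; [:: 0; 1; 0; 0]].
Definition A2 := mx4 [:: [:: 0; 0; 0; 1]; [:: 0; 0; 1; 0]; [:: 0; -1; 0; 0]; [:: -1; 0; 0; 0]].
Definition AY := mx4 [:: [:: 0; 1; 0; 0]; [:: -1; 0; 0; 0]; [:: 0; 0; 0; 0]; [:: 0; 0; 0; 0]].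

Lemma ord4P (P : 'I_4 -> Prop) : P (inord 0) -> P (inord 1) -> P (inord 2) ->
  P (inord 3) -> forall i, P i.
Proof. by move=> p0 p1 p2 p3 i; rewrite -(inord_val i); case: i => -[|[|[|[|//]]]]. Qed.

Lemma ord3P (P : 'I_3 -> Prop) : P (inord 0) -> P (inord 1) -> P (inord 2) ->
  forall i, P i.
Proof. by move=> p0 p1 p2 i; rewrite -(inord_val i); case: i => -[|[|[|//]]]. Qed.

Lemma sum_ord4 (F : 'I_4 -> R) :
  \sum_i F i = F (inord 0) + F (inord 1) + F (inord 2) + F (inord 3).
Proof.
rewrite !big_ord_recr big_ord0 /= add0r.
by congr (F _ + F _ + F _ + F _); apply: val_inj; rewrite /= inordK.
Qed.

Lemma sum_ord3 (F : 'I_3 -> R) :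
  \sum_i F i = F (inord 0) + F (inord 1) + F (inord 2).
Proof.
rewrite !big_ord_recr big_ord0 /= add0r.
by congr (F _ + F _ + F _); apply: val_inj; rewrite /= inordK.
Qed.

Lemma mulA0 (y : V) : y *m A0 =
  \row_j [:: - y 0 (inord 1); y 0 (inord 0); - y 0 (inord 3); y 0 (inord 2)]`_j.
Proof.
apply/rowP; elim/ord4P; rewrite !mxE sum_ord4 !mxE !inordK //=; ring.
Qed.

Lemma mulA1 (y : V) : y *m A1 =
  \row_j [:: - y 0 (inord 2); y 0 (inord 3); y 0 (inord 0); - y 0 (inord 1)]`_j.
Proof.
apply/rowP; elim/ord4P; rewrite !mxE sum_ord4 !mxE !inordK //=; ring.
Qed.

Lemma mulA2 (y : V) : y *m A2 =
  \row_j [:: - y 0 (inord 3); - y 0 (inord 2); y 0 (inord 1); y 0 (inord 0)]`_j.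
Proof.
apply/rowP; elim/ord4P; rewrite !mxE sum_ord4 !mxE !inordK //=; ring.
Qed.

Lemma mulAY (y : V) : y *m AY =
  \row_j [:: - y 0 (inord 1); y 0 (inord 0); 0; 0]`_j.
Proof.
apply/rowP; elim/ord4P; rewrite !mxE sum_ord4 !mxE !inordK //=; ring.
Qed.

Lemma skew_A0 : A0^T = - A0.
Proof. by apply/matrixP; elim/ord4P; elim/ord4P; rewrite !mxE !inordK //= ?oppr0 ?opprK. Qed.

Lemma skew_A1 : A1^T = - A1.
Proof. by apply/matrixP; elim/ord4P; elim/ord4P; rewrite !mxE !inordK //= ?oppr0 ?opprK. Qed.

Lemma skew_A2 : A2^T = - A2.
Proof. by apply/matrixP; elim/ord4P; elim/ord4P; rewrite !mxE !inordK //= ?oppr0 ?opprK. Qed.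

Lemma skew_AY : AY^T = - AY.
Proof. by apply/matrixP; elim/ord4P; elim/ord4P; rewrite !mxE !inordK //= ?oppr0 ?opprK. Qed.

Lemma sqr_eqN1 (A : 'M[R]_4) : (forall y : V, y *m A *m A = - y) -> A *m A = - 1%:M.
Proof. by move=> h; apply/row_matrixP => i; rewrite row_mul rowE h linearN /= rowE mulmx1. Qed.

Lemma A0_sqr : A0 *m A0 = - 1%:M.
Proof.
apply: sqr_eqN1 => y; rewrite !mulA0; apply/rowP; elim/ord4P; by rewrite !mxE !inordK //= ?opprK.
Qed.

Lemma A1_sqr : A1 *m A1 = - 1%:M.
Proof.
apply: sqr_eqN1 => y; rewrite !mulA1; apply/rowP; elim/ord4P; by rewrite !mxE !inordK //= ?opprK.
Qed.

Lemma A2_sqr : A2 *m A2 = - 1%:M.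
Proof.
apply: sqr_eqN1 => y; rewrite !mulA2; apply/rowP; elim/ord4P; by rewrite !mxE !inordK //= ?opprK.
Qed.

Definition qframe (x : S) (j : 'I_3) : V := val x *m nth 0 [:: A0; A1; A2] j.

Lemma dot4 (u v : V) : dot u v = u 0 (inord 0) * v 0 (inord 0) + u 0 (inord 1) * v 0 (inord 1)
  + u 0 (inord 2) * v 0 (inord 2) + u 0 (inord 3) * v 0 (inord 3).
Proof. exact: sum_ord4. Qed.

Lemma qframe_onb x : onb x (qframe x).
Proof.
have := sphere_dot x; rewrite dot4 => h.
split.
  elim/ord3P; rewrite /tangent /qframe !inordK //= dotC skew_dot //;
    [exact: skew_A0|exact: skew_A1|exact: skew_A2].
elim/ord3P; elim/ord3P; rewrite /qframe !inordK //= -!(inj_eq val_inj) /= !inordK //=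
  ?mulA0 ?mulA1 ?mulA2 dot4 !mxE !inordK //= -?[RHS]h; ring.
Qed.

End QuaternionFields.

Section Derivations.
Context {R : realType}.
Notation S := (sphere R 3).
Implicit Types (f g : S -> R) (x : S) (A : 'M[R]_4).

(** Smoothness and derivative are bundled so that [isder_tac] finds the derivative by unification
    while discharging smoothness along the way. *)
Definition isder A f f' := ssmooth f /\ lder A f = f'.

Lemma isder_smooth A f : ssmooth f -> isder A f (lder A f).
Proof. by []. Qed.

Lemma isder_cst A c : isder A (fun=> c) (fun=> 0).
Proof. by split; [exact: ssmooth_cst|rewrite lder_cst]. Qed.

Lemma isder_add A f g f' g' : isder A f f' -> isder A g g' ->
  isder A (fun x => f x + g x) (fun x => f' x + g' x).
Proof. by move=> [sf <-] [sg <-]; split; [exact: ssmooth_add|rewrite lderD]. Qed.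

Lemma isder_sub A f g f' g' : isder A f f' -> isder A g g' ->
  isder A (fun x => f x - g x) (fun x => f' x - g' x).
Proof. by move=> [sf <-] [sg <-]; split; [exact: ssmooth_sub|rewrite lderB]. Qed.

Lemma isder_mul A f g f' g' : isder A f f' -> isder A g g' ->
  isder A (fun x => f x * g x) (fun x => f' x * g x + f x * g' x).
Proof. by move=> [sf <-] [sg <-]; split; [exact: ssmooth_mul|rewrite lderM]. Qed.

Lemma isder_val A f f' g : isder A f f' -> (forall x, f' x = g x) -> lder A f = g.
Proof. by move=> [_ ->] fg; apply/funext. Qed.

Definition cc (k : nat) : S -> R := coord (inord k).

Lemma ssmooth_cc k : ssmooth (cc k).
Proof. exact: ssmooth_coord. Qed.

Lemma lderA0 k : (k < 4)%N ->
  lder A0 (cc k) = fun x => [:: - cc 1 x; cc 0 x; - cc 3 x; cc 2 x]`_k.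
Proof.
by move=> k4; rewrite lder_coord ?skew_A0 //; apply/funext => x; rewrite mulA0 mxE inordK.
Qed.

Lemma lderA1 k : (k < 4)%N ->
  lder A1 (cc k) = fun x => [:: - cc 2 x; cc 3 x; cc 0 x; - cc 1 x]`_k.
Proof.
by move=> k4; rewrite lder_coord ?skew_A1 //; apply/funext => x; rewrite mulA1 mxE inordK.
Qed.

Lemma lderA2 k : (k < 4)%N ->
  lder A2 (cc k) = fun x => [:: - cc 3 x; - cc 2 x; cc 1 x; cc 0 x]`_k.
Proof.
by move=> k4; rewrite lder_coord ?skew_A2 //; apply/funext => x; rewrite mulA2 mxE inordK.
Qed.

Lemma lderAY k : (k < 4)%N ->
  lder AY (cc k) = fun x => [:: - cc 1 x; cc 0 x; 0; 0]`_k.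
Proof.
by move=> k4; rewrite lder_coord ?skew_AY //; apply/funext => x; rewrite mulAY mxE inordK.
Qed.

Lemma isder_cc A k : isder A (cc k) (lder A (cc k)).
Proof. by split => //; exact: ssmooth_cc. Qed.

End Derivations.

Ltac isder_tac := lazymatch goal with
  | |- isder _ (fun x => @?f x - @?g x) _ =>
      eapply (@isder_sub _ _ f g); isder_tac
  | |- isder _ (fun x => @?f x + @?g x) _ =>
      eapply (@isder_add _ _ f g); isder_tac
  | |- isder _ (fun x => @?f x * @?g x) _ =>
      eapply (@isder_mul _ _ f g); isder_tac
  | |- isder ?A (fun x => cc ?k x) _ => exact (isder_cc A k)
  | |- isder ?A (cc ?k) _ => exact (isder_cc A k)
  | |- isder ?A (fun _ => ?c) _ => exact (isder_cst A c)
  | |- isder ?A (fun x => ?h x) _ => apply (@isder_smooth _ A h);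
      first [assumption | apply ssmooth_lder; assumption]
  | |- isder _ _ _ =>
      apply isder_smooth; first [assumption | apply ssmooth_lder; assumption]
  end.

Ltac atoms_ring := repeat match goal with
  | |- context [lder ?A ?f ?x] => generalize (lder A f x); intro
  end; repeat match goal with
  | x : sphere _ _ |- context [?f ?x] =>
      match type of f with sphere _ _ -> Real.sort _ => generalize (f x); intro end
  end; ring.

Section Frame.
Context {R : realType}.
Notation S := (sphere R 3).
Implicit Types (f g : S -> R) (x : S).

(** The components of the Hopf map, written with products only, a shape that [isder_tac] can
    traverse. *)
Definition hf (i : 'I_3) : S -> R := nth (fun=> 0)
  [:: fun x => 2 * (cc 0 x * cc 2 x + cc 1 x * cc 3 x);
      fun x => 2 * (cc 0 x * cc 3 x - cc 1 x * cc 2 x);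
      fun x => cc 2 x * cc 2 x + cc 3 x * cc 3 x - (cc 0 x * cc 0 x + cc 1 x * cc 1 x)] i.

(* [e1] and [e2] are the components of dphi(X1) / 2 and dphi(X2) / 2, where X_j
   is the field x |-> x A_j; X0 spans the fibres of phi. *)
Definition e1 (i : 'I_3) : S -> R := nth (fun=> 0)
  [:: fun x => cc 0 x * cc 0 x - cc 1 x * cc 1 x - cc 2 x * cc 2 x + cc 3 x * cc 3 x;
      fun x => -2 * (cc 0 x * cc 1 x + cc 2 x * cc 3 x);
      fun x => 2 * (cc 0 x * cc 2 x - cc 1 x * cc 3 x)] i.

Definition e2 (i : 'I_3) : S -> R := nth (fun=> 0)
  [:: fun x => 2 * (cc 0 x * cc 1 x - cc 2 x * cc 3 x);
      fun x => cc 0 x * cc 0 x - cc 1 x * cc 1 x + cc 2 x * cc 2 x - cc 3 x * cc 3 x;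
      fun x => 2 * (cc 1 x * cc 2 x + cc 0 x * cc 3 x)] i.

Lemma hcomp_hf i : hcomp i = hf i.
Proof.
apply/funext => x; rewrite hcompE /c0 /c1 /c2 /c3 -!/(cc _).
by move: i; elim/ord3P; rewrite /hf inordK //= !expr2.
Qed.

Lemma ssmooth_hf i : ssmooth (hf i).
Proof. rewrite -hcomp_hf; exact: ssmooth_hcomp. Qed.

Ltac sm := repeat first [exact: ssmooth_cc|exact: ssmooth_cst|apply: ssmooth_sub|
  apply: ssmooth_add|apply: ssmooth_mul].

Lemma ssmooth_e1 i : ssmooth (e1 i).
Proof. by move: i; elim/ord3P; rewrite /e1 inordK //=; sm. Qed.

Lemma ssmooth_e2 i : ssmooth (e2 i).
Proof. by move: i; elim/ord3P; rewrite /e2 inordK //=; sm. Qed.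

Ltac fder L := elim/ord3P; rewrite ?/hf ?/e1 ?/e2 inordK //=;
  (eapply isder_val; [isder_tac|move=> x /=; rewrite ?L //=; ring]).

Lemma X0_h : forall i, lder A0 (hf i) = fun=> 0.
Proof. fder (@lderA0 R). Qed.

Lemma X1_h : forall i, lder A1 (hf i) = fun x => 2 * e1 i x.
Proof. fder (@lderA1 R). Qed.

Lemma X2_h : forall i, lder A2 (hf i) = fun x => 2 * e2 i x.
Proof. fder (@lderA2 R). Qed.

(** The frame rotates along the fibres, although $\varphi$ is constant there; this rotation is the
    source of the first-order term in [X0]. *)
Lemma X0_e1 : forall i, lder A0 (e1 i) = fun x => - 2 * e2 i x.
Proof. fder (@lderA0 R). Qed.

Lemma X1_e1 : forall i, lder A1 (e1 i) = fun x => - 2 * hf i x.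
Proof. fder (@lderA1 R). Qed.

Lemma X2_e1 : forall i, lder A2 (e1 i) = fun x => 0.
Proof. fder (@lderA2 R). Qed.

Lemma X0_e2 : forall i, lder A0 (e2 i) = fun x => 2 * e1 i x.
Proof. fder (@lderA0 R). Qed.

Lemma X1_e2 : forall i, lder A1 (e2 i) = fun x => 0.
Proof. fder (@lderA1 R). Qed.

Lemma X2_e2 : forall i, lder A2 (e2 i) = fun x => - 2 * hf i x.
Proof. fder (@lderA2 R). Qed.

End Frame.

(** * The Jacobi operator as a scalar system *)

Section JacobiFrame.
Context {R : realType}.
Notation V := 'rV[R]_4.
Notation S := (sphere R 3).
Implicit Types (f g : S -> R) (x : S) (w : S -> 'rV[R]_3).

Lemma cc_sphere x :
  cc 0 x * cc 0 x + cc 1 x * cc 1 x + cc 2 x * cc 2 x + cc 3 x * cc 3 x = 1.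
Proof. by have := sphere_dot x; rewrite dot4. Qed.

Definition quad x : R :=
  cc 0 x * cc 0 x + cc 1 x * cc 1 x + cc 2 x * cc 2 x + cc 3 x * cc 3 x.

Lemma frame_columns i k x :
  e1 i x * e1 k x + e2 i x * e2 k x + hf i x * hf k x = (i == k)%:R.
Proof.
(* The factor $|x|^4=1$ makes both sides homogeneous of degree 4, so the relation becomes a
   polynomial identity. *)
rewrite (_ : (i == k)%:R = quad x ^+ 2 * (i == k)%:R); last first.
  by rewrite /quad cc_sphere expr1n mul1r.
move: i k; elim/ord3P; elim/ord3P; rewrite /e1 /e2 /hf -(inj_eq val_inj) /= !inordK //= /quad; ring.
Qed.

Definition e1v x : 'rV[R]_3 := \row_i e1 i x.
Definition e2v x : 'rV[R]_3 := \row_i e2 i x.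

Lemma val_hopf x : val (hopf x) = \row_i hf i x.
Proof. by apply/rowP => i; rewrite [RHS]mxE -hcomp_hf. Qed.

Lemma dot3 (u v : 'rV[R]_3) : dot u v = u 0 (inord 0) * v 0 (inord 0) +
  u 0 (inord 1) * v 0 (inord 1) + u 0 (inord 2) * v 0 (inord 2).
Proof. exact: sum_ord3. Qed.

Lemma dot_e1e1 x : dot (e1v x) (e1v x) = 1.
Proof.
rewrite -[RHS](expr1n _ 2) -[in RHS](cc_sphere x) dot3 !mxE /e1 !inordK //=; ring.
Qed.

Lemma dot_e2e2 x : dot (e2v x) (e2v x) = 1.
Proof.
rewrite -[RHS](expr1n _ 2) -[in RHS](cc_sphere x) dot3 !mxE /e2 !inordK //=; ring.
Qed.

Lemma dot_e1e2 x : dot (e1v x) (e2v x) = 0.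
Proof. rewrite dot3 !mxE /e1 /e2 !inordK //=; ring. Qed.

Lemma tangent_e1 x : tangent (hopf x) (e1v x).
Proof. rewrite /tangent val_hopf dot3 !mxE /e1 /hf !inordK //=; ring. Qed.

Lemma tangent_e2 x : tangent (hopf x) (e2v x).
Proof. rewrite /tangent val_hopf dot3 !mxE /e2 /hf !inordK //=; ring. Qed.

Lemma frame_decomp x (u : 'rV[R]_3) : tangent (hopf x) u ->
  u = dot u (e1v x) *: e1v x + dot u (e2v x) *: e2v x.
Proof.
move=> tu; apply/rowP => k.
transitivity (\sum_i u 0 i * (e1 i x * e1 k x + e2 i x * e2 k x + hf i x * hf k x)).
  rewrite (bigD1 k) //= frame_columns eqxx mulr1 big1 ?addr0 // => i ik.
  by rewrite frame_columns (negPf ik) mulr0.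
transitivity (dot u (e1v x) * e1 k x + dot u (e2v x) * e2 k x + dot u (val (hopf x)) * hf k x).
  have D (g : 'I_3 -> R) : dot u (\row_i g i) = \sum_i u 0 i * g i.
    by apply: eq_bigr => i _; rewrite mxE.
  rewrite val_hopf !D !mulr_suml -!big_split; apply: eq_bigr => i _; rewrite [RHS]/=; ring.
by rewrite tu mul0r addr0 !mxE.
Qed.

Definition lap f : S -> R := fun x =>
  lder A0 (lder A0 f) x + lder A1 (lder A1 f) x + lder A2 (lder A2 f) x.

Lemma sum_qframe_hess f x : ssmooth f -> \sum_j hess f x (qframe x j) = lap f x.
Proof.
move=> sf; rewrite sum_ord3 /qframe !inordK //=.
by rewrite -!lder_lder //; [exact: A2_sqr|exact: A1_sqr|exact: A0_sqr].
Qed.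

Variable E : S -> 'I_3 -> S -> V.
Hypothesis hE : forall x, local_orthonormal_frame x (E x).

Lemma frame_onb x : onb x (fun j => E x j x).
Proof. by have [U [_ Ux _ /(_ x Ux)]] := hE x. Qed.

Lemma frame_diff x j : differentiable (radial_ext (E x j)) (val x).
Proof. by have [U [_ Ux /(_ j) sE _]] := hE x; exact: (sE [::] x Ux). Qed.

Lemma energy_density x : \sum_j dot (dhopf x (E x j x)) (dhopf x (E x j x)) = 8.
Proof.
transitivity (\sum_i \sum_j dirder (hcomp i) x (E x j x) ^+ 2).
  rewrite [RHS]exchange_big; apply: eq_bigr => j _; apply: eq_bigr => i _.
  by rewrite !dhopf_entry expr2.
transitivity (\sum_i (4 * (e1 i x * e1 i x) + 4 * (e2 i x * e2 i x))).
  apply: eq_bigr => i _.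
  rewrite (dirder_sqr_onb (ssmooth_hcomp i) (frame_onb x) (qframe_onb x)).
  have L A f : dirder f x (val x *m A) = lder A f x by [].
  rewrite sum_ord3 /qframe !inordK //= !L hcomp_hf X0_h X1_h X2_h.
  ring.
have N1 : \sum_i e1 i x * e1 i x = 1.
  by rewrite -[RHS](dot_e1e1 x); apply: eq_bigr => i _; rewrite !mxE.
have N2 : \sum_i e2 i x * e2 i x = 1.
  by rewrite -[RHS](dot_e2e2 x); apply: eq_bigr => i _; rewrite !mxE.
rewrite big_split /= -!mulr_sumr N1 N2; ring.
Qed.

(** The sums of $\langle w,d\varphi(E_j)\rangle d\varphi(E_j)$ from the connection and from the
    curvature cancel; [energy_density] supplies the 8. *)
Lemma jacobi_lap w x : variation_field w ->
  jacobi E w x = - tproj (hopf x) (\row_i lap (wcomp w i) x) - 8 *: w x.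
Proof.
move=> vw; rewrite /jacobi /rough_laplacian.
have -> : \sum_j curv (w x) (dhopf x (E x j x)) (dhopf x (E x j x)) =
   8 *: w x - \sum_j dot (w x) (dhopf x (E x j x)) *: dhopf x (E x j x).
  by rewrite -(energy_density x) scaler_suml -sumrB; apply: eq_bigr => j _.
have -> : \sum_j second_cov_deriv (E x j) (E x j) w x =
   tproj (hopf x) (\row_i lap (wcomp w i) x) +
   \sum_j dot (w x) (dhopf x (E x j x)) *: dhopf x (E x j x).
  have -> : \row_i lap (wcomp w i) x = \sum_j hessrow w x (E x j x).
    apply/rowP => i; rewrite mxE summxE -(sum_qframe_hess x (ssmooth_wcomp vw i)).
    rewrite (hess_onb (ssmooth_wcomp vw i) (qframe_onb x) (frame_onb x)).
    by apply: eq_bigr => j _; rewrite mxE.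
  rewrite tproj_sum -big_split; apply: eq_bigr => j _ /=.
  apply: second_cov_derivE => //; first exact: frame_diff.
  by have [tE _] := frame_onb x; exact: tE.
have G (a b c : 'rV[R]_3) : - (a + b) - (c - b) = - a - c.
  by rewrite opprB opprD -addrA addKr.
exact: G.
Qed.

Definition frame_field (f1 f2 : S -> R) : S -> 'rV[R]_3 :=
  fun x => f1 x *: e1v x + f2 x *: e2v x.

Lemma frame_field_variation f1 f2 : ssmooth f1 -> ssmooth f2 ->
  variation_field (frame_field f1 f2).
Proof.
move=> s1 s2; split.
  apply/smooth_onE => i.
  have : ssmooth (fun x => f1 x * e1 i x + f2 x * e2 i x).
    by apply: ssmooth_add; apply: ssmooth_mul => //; [exact: ssmooth_e1|exact: ssmooth_e2].
  by congr ssmooth; apply/funext => x; rewrite !mxE.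
move=> x; rewrite /tangent /frame_field dotDl !dotZl.
by rewrite [dot _ _]tangent_e1 [dot _ _]tangent_e2 !mulr0 addr0.
Qed.

(** Each frame vector is multiplied by $-4$ under $X_0^2$ and under one of $X_1^2,X_2^2$, whence
    $-8f_i$, which offsets the curvature. The cross term with [X0] couples [f1] and [f2]; those with
    [X1] and [X2] are normal. *)
Lemma lap_frame f1 f2 i : ssmooth f1 -> ssmooth f2 ->
  lap (wcomp (frame_field f1 f2) i) = fun x =>
    (lap f1 x + 4 * lder A0 f2 x - 8 * f1 x) * e1 i x +
    (lap f2 x - 4 * lder A0 f1 x - 8 * f2 x) * e2 i x -
    4 * (lder A1 f1 x + lder A2 f2 x) * hf i x.
Proof.
move=> s1 s2.
have -> : wcomp (frame_field f1 f2) i = fun x => f1 x * e1 i x + f2 x * e2 i x.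
  by apply/funext => x; rewrite /wcomp !mxE.
have se1 := @ssmooth_e1 R i; have se2 := @ssmooth_e2 R i; have sh := @ssmooth_hf R i.
have D0 : lder A0 (fun x => f1 x * e1 i x + f2 x * e2 i x) = fun x =>
    (lder A0 f1 x + 2 * f2 x) * e1 i x + (lder A0 f2 x - 2 * f1 x) * e2 i x.
  eapply isder_val; first isder_tac.
  by move=> x /=; rewrite X0_e1 X0_e2; atoms_ring.
have D1 : lder A1 (fun x => f1 x * e1 i x + f2 x * e2 i x) = fun x =>
    lder A1 f1 x * e1 i x + lder A1 f2 x * e2 i x - 2 * f1 x * hf i x.
  eapply isder_val; first isder_tac.
  by move=> x /=; rewrite X1_e1 X1_e2; atoms_ring.
have D2 : lder A2 (fun x => f1 x * e1 i x + f2 x * e2 i x) = fun x =>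
    lder A2 f1 x * e1 i x + lder A2 f2 x * e2 i x - 2 * f2 x * hf i x.
  eapply isder_val; first isder_tac.
  by move=> x /=; rewrite X2_e1 X2_e2; atoms_ring.
have D00 : lder A0 (fun x => (lder A0 f1 x + 2 * f2 x) * e1 i x + (lder A0 f2 x - 2 * f1 x) * e2 i x)
   = fun x => (lder A0 (lder A0 f1) x + 4 * lder A0 f2 x - 4 * f1 x) * e1 i x +
              (lder A0 (lder A0 f2) x - 4 * lder A0 f1 x - 4 * f2 x) * e2 i x.
  eapply isder_val; first isder_tac.
  by move=> x /=; rewrite X0_e1 X0_e2; atoms_ring.
have D11 : lder A1 (fun x => lder A1 f1 x * e1 i x + lder A1 f2 x * e2 i x - 2 * f1 x * hf i x)
   = fun x => (lder A1 (lder A1 f1) x - 4 * f1 x) * e1 i x + lder A1 (lder A1 f2) x * e2 i x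
              - 4 * lder A1 f1 x * hf i x.
  eapply isder_val; first isder_tac.
  by move=> x /=; rewrite X1_e1 X1_e2 X1_h; atoms_ring.
have D22 : lder A2 (fun x => lder A2 f1 x * e1 i x + lder A2 f2 x * e2 i x - 2 * f2 x * hf i x)
   = fun x => lder A2 (lder A2 f1) x * e1 i x + (lder A2 (lder A2 f2) x - 4 * f2 x) * e2 i x
              - 4 * lder A2 f2 x * hf i x.
  eapply isder_val; first isder_tac.
  by move=> x /=; rewrite X2_e1 X2_e2 X2_h; atoms_ring.
by apply/funext => x; rewrite /lap D0 D1 D2 D00 D11 D22; atoms_ring.
Qed.

Lemma jacobi_frame f1 f2 x : ssmooth f1 -> ssmooth f2 ->
  jacobi E (frame_field f1 f2) x =
  frame_field (fun x => - lap f1 x - 4 * lder A0 f2 x)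
              (fun x => - lap f2 x + 4 * lder A0 f1 x) x.
Proof.
move=> s1 s2; rewrite jacobi_lap; last exact: frame_field_variation.
have -> : \row_i lap (wcomp (frame_field f1 f2) i) x =
    (lap f1 x + 4 * lder A0 f2 x - 8 * f1 x) *: e1v x +
    (lap f2 x - 4 * lder A0 f1 x - 8 * f2 x) *: e2v x -
    (4 * (lder A1 f1 x + lder A2 f2 x)) *: val (hopf x).
  apply/rowP => i; rewrite mxE lap_frame // val_hopf.
  by rewrite !mxE.
rewrite tprojB tprojD !tprojZ tproj_normal scaler0 subr0.
rewrite (tproj_id (tangent_e1 x)) (tproj_id (tangent_e2 x)) /frame_field.
apply/rowP => i; rewrite !mxE; atoms_ring.
Qed.

Lemma variation_frame w : variation_field w -> exists f1 f2,
  [/\ ssmooth f1, ssmooth f2 & w = frame_field f1 f2].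
Proof.
move=> vw; exists (fun x => dot (w x) (e1v x)), (fun x => dot (w x) (e2v x)); split.
- apply: ssmooth_sum => i; apply: ssmooth_mul; first exact: ssmooth_wcomp.
  have := @ssmooth_e1 R i; congr ssmooth; by apply/funext => x; rewrite mxE.
- apply: ssmooth_sum => i; apply: ssmooth_mul; first exact: ssmooth_wcomp.
  have := @ssmooth_e2 R i; congr ssmooth; by apply/funext => x; rewrite mxE.
- by apply/funext => x; apply: frame_decomp; case: vw.
Qed.

Lemma frame_field_inj f1 f2 g1 g2 x :
  frame_field f1 f2 x = frame_field g1 g2 x -> f1 x = g1 x /\ f2 x = g2 x.
Proof.
rewrite /frame_field => h; split.
  have := congr1 (fun u => dot u (e1v x)) h; rewrite !dotDl !dotZl dot_e1e1 (dotC (e2v x)) dot_e1e2.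
  by rewrite !mulr1 !mulr0 !addr0.
have := congr1 (fun u => dot u (e2v x)) h; rewrite !dotDl !dotZl dot_e2e2 dot_e1e2.
by rewrite !mulr1 !mulr0 !add0r.
Qed.

End JacobiFrame.

(** * Spherical harmonics on C^2 *)

Section ComplexCalculus.
Context {R : realType}.
Notation C := (R[i]).
Notation S := (sphere R 3).
Implicit Types (F G : S -> C) (x : S) (A : 'M[R]_4).

Definition re F : S -> R := fun x => complex.Re (F x).
Definition im F : S -> R := fun x => complex.Im (F x).
Definition csmooth F : Prop := ssmooth (re F) /\ ssmooth (im F).
Definition cder A F : S -> C := fun x => Complex (lder A (re F) x) (lder A (im F) x).

Definition ii : C := Complex 0 1.

Lemma ii_sqr : ii * ii = -1.
Proof. by apply/eqP; rewrite eq_complex /= !mul0r !mulr0 mul1r addr0 sub0r oppr0 !eqxx. Qed.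

Lemma conj_ii : conjc ii = - ii.
Proof. by apply/eqP; rewrite eq_complex /= oppr0 !eqxx. Qed.

Lemma cReM (a b : C) : complex.Re (a * b) =
  complex.Re a * complex.Re b - complex.Im a * complex.Im b.
Proof. by case: a; case: b. Qed.

Lemma cImM (a b : C) : complex.Im (a * b) =
  complex.Re a * complex.Im b + complex.Im a * complex.Re b.
Proof. by case: a; case: b. Qed.

Lemma complexP (a b : C) : complex.Re a = complex.Re b -> complex.Im a = complex.Im b ->
  a = b.
Proof. by case: a => ? ?; case: b => ? ? /= -> ->. Qed.

Lemma csmooth_cst (c : C) : csmooth (fun=> c).
Proof. by split; exact: ssmooth_cst. Qed.

Lemma csmooth_add F G : csmooth F -> csmooth G -> csmooth (fun x => F x + G x).
Proof.
move=> [rF iF] [rG iG]; split.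
  have := ssmooth_add rF rG; congr ssmooth; apply/funext => x; rewrite /re.
  by case: (F x); case: (G x).
have := ssmooth_add iF iG; congr ssmooth; apply/funext => x; rewrite /im.
by case: (F x); case: (G x).
Qed.

Lemma csmooth_mul F G : csmooth F -> csmooth G -> csmooth (fun x => F x * G x).
Proof.
move=> [rF iF] [rG iG]; split.
  have := ssmooth_sub (ssmooth_mul rF rG) (ssmooth_mul iF iG).
  by congr ssmooth; apply/funext => x; rewrite /re cReM.
have := ssmooth_add (ssmooth_mul rF iG) (ssmooth_mul iF rG).
by congr ssmooth; apply/funext => x; rewrite /im cImM.
Qed.

Lemma csmooth_conj F : csmooth F -> csmooth (fun x => conjc (F x)).
Proof.
move=> [rF iF]; split.
  by move: rF; congr ssmooth; apply/funext => x; rewrite /re; case: (F x).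
by have := ssmooth_opp iF; congr ssmooth; apply/funext => x; rewrite /im; case: (F x).
Qed.

Lemma csmooth_exp F n : csmooth F -> csmooth (fun x => F x ^+ n).
Proof.
move=> sF; elim: n => [|n IH]; first exact: csmooth_cst.
have := csmooth_mul sF IH; congr csmooth; by apply/funext => x; rewrite exprS.
Qed.

Lemma csmooth_cder A F : csmooth F -> csmooth (cder A F).
Proof. by move=> [rF iF]; split; exact: ssmooth_lder. Qed.

Lemma cder_cst A (c : C) : cder A (fun=> c) = fun=> 0.
Proof. by apply/funext => x; rewrite /cder !lder_cst. Qed.

Lemma cderD A F G : csmooth F -> csmooth G ->
  cder A (fun x => F x + G x) = fun x => cder A F x + cder A G x.
Proof.
move=> [rF iF] [rG iG]; apply/funext => x; rewrite /cder.
have -> : re (fun x => F x + G x) = fun x => re F x + re G x.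
  by apply/funext => y; rewrite /re; case: (F y); case: (G y).
have -> : im (fun x => F x + G x) = fun x => im F x + im G x.
  by apply/funext => y; rewrite /im; case: (F y); case: (G y).
by rewrite !lderD.
Qed.

Lemma cderM A F G : csmooth F -> csmooth G ->
  cder A (fun x => F x * G x) = fun x => cder A F x * G x + F x * cder A G x.
Proof.
move=> [rF iF] [rG iG]; apply/funext => x; rewrite /cder.
have -> : re (fun x => F x * G x) = fun x => re F x * re G x - im F x * im G x.
  by apply/funext => y; rewrite /re cReM.
have -> : im (fun x => F x * G x) = fun x => re F x * im G x + im F x * re G x.
  by apply/funext => y; rewrite /im cImM.
rewrite lderB ?lderD ?lderM //; try exact: ssmooth_mul.
apply: complexP; rewrite /= ?cReM ?cImM /= /re /im; case: (F x) => a b; case: (G x) => c d /=;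
  rewrite ?cReM ?cImM /=; ring.
Qed.

Lemma cder_conj A F : csmooth F ->
  cder A (fun x => conjc (F x)) = fun x => conjc (cder A F x).
Proof.
move=> [rF iF]; apply/funext => x; rewrite /cder.
have -> : re (fun x => conjc (F x)) = re F.
  by apply/funext => y; rewrite /re; case: (F y).
have -> : im (fun x => conjc (F x)) = fun y => - im F y.
  by apply/funext => y; rewrite /im; case: (F y).
by rewrite lderN.
Qed.

Lemma cderZ A (c : C) F : csmooth F ->
  cder A (fun x => c * F x) = fun x => c * cder A F x.
Proof.
move=> sF; rewrite cderM //; last exact: csmooth_cst.
by rewrite cder_cst; apply/funext => x; rewrite mul0r add0r.
Qed.

Lemma csmooth_sum (J : finType) (F : J -> S -> C) : (forall i, csmooth (F i)) ->
  csmooth (fun x => \sum_i F i x).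
Proof.
move=> sF; suff : csmooth (\sum_i F i).
  by congr csmooth; apply/funext => x; rewrite fct_sumE.
by elim/big_ind: _ => [|f g|i _]; [exact: (csmooth_cst 0)|exact: csmooth_add|exact: sF].
Qed.

Lemma cder_sum A (J : finType) (F : J -> S -> C) : (forall i, csmooth (F i)) ->
  cder A (fun x => \sum_i F i x) = fun x => \sum_i cder A (F i) x.
Proof.
move=> sF; pose P (f g : S -> C) := csmooth f /\ cder A f = g.
have : P (\sum_i F i) (\sum_i cder A (F i)).
  elim/big_ind2: _ => [|f1 f2 g1 g2 [s1 <-] [s2 <-]|i _]; last by split.
  - by split; [exact: (csmooth_cst 0)|exact: (cder_cst A 0)].
  - by split; [exact: csmooth_add|exact: (cderD A s1 s2)].
rewrite (_ : (fun x => \sum_i F i x) = \sum_i F i); last by apply/funext => x; rewrite fct_sumE.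
by move=> [_ ->]; apply/funext => x; rewrite fct_sumE.
Qed.

Lemma cder_exp A F n x : csmooth F ->
  cder A (fun x => F x ^+ n) x = n%:R * F x ^+ n.-1 * cder A F x.
Proof.
move=> sF; elim: n => [|n IH].
  rewrite (_ : (fun x => _) = fun=> 1); last by apply/funext => y; rewrite expr0.
  by rewrite cder_cst !mul0r.
rewrite (_ : (fun x => _) = fun x => F x * F x ^+ n); last by apply/funext => y; rewrite exprS.
rewrite cderM //; last exact: csmooth_exp.
rewrite IH /=; case: n {IH} => [|n] /=; first by rewrite !expr0 !mul0r mulr0 addr0 !mul1r mulr1.
rewrite -[n.+2]addn1 natrD exprS; ring.
Qed.

(* The carre du champ of [clap]. *)
Definition gam F G : S -> C := fun x =>
  cder A0 F x * cder A0 G x + cder A1 F x * cder A1 G x + cder A2 F x * cder A2 G x.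

Definition clap F : S -> C := fun x =>
  cder A0 (cder A0 F) x + cder A1 (cder A1 F) x + cder A2 (cder A2 F) x.

Lemma clapD F G : csmooth F -> csmooth G ->
  clap (fun x => F x + G x) = fun x => clap F x + clap G x.
Proof.
move=> sF sG; apply/funext => x; rewrite /clap !cderD //; try exact: csmooth_cder.
move: (cder A0 (cder A0 F) x) (cder A1 (cder A1 F) x) (cder A2 (cder A2 F) x).
move: (cder A0 (cder A0 G) x) (cder A1 (cder A1 G) x) (cder A2 (cder A2 G) x).
by move=> *; ring.
Qed.

Lemma clapM F G x : csmooth F -> csmooth G ->
  clap (fun x => F x * G x) x = clap F x * G x + 2 * gam F G x + F x * clap G x.
Proof.
move=> sF sG.
have D A : cder A (cder A (fun x => F x * G x)) x =
    cder A (cder A F) x * G x + 2 * (cder A F x * cder A G x) + F x * cder A (cder A G) x.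
  rewrite cderM // cderD; try by apply: csmooth_mul => //; exact: csmooth_cder.
  rewrite !cderM //; try exact: csmooth_cder.
  move: (cder A (cder A F) x) (cder A (cder A G) x) (cder A F x) (cder A G x) (F x) (G x).
  by move=> a b c d e f; ring.
rewrite /clap !D /gam.
move: (cder A0 (cder A0 F) x) (cder A1 (cder A1 F) x) (cder A2 (cder A2 F) x).
move: (cder A0 (cder A0 G) x) (cder A1 (cder A1 G) x) (cder A2 (cder A2 G) x).
move: (cder A0 F x) (cder A1 F x) (cder A2 F x) (cder A0 G x) (cder A1 G x) (cder A2 G x) (F x) (G x).
by move=> *; ring.
Qed.

Lemma clapZ (c : C) F : csmooth F -> clap (fun x => c * F x) = fun x => c * clap F x.
Proof.
move=> sF; apply/funext => x; rewrite /clap !cderZ //; try exact: csmooth_cder.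
move: (cder A0 (cder A0 F) x) (cder A1 (cder A1 F) x) (cder A2 (cder A2 F) x).
by move=> *; ring.
Qed.

Lemma clap_sum (J : finType) (F : J -> S -> C) : (forall i, csmooth (F i)) ->
  clap (fun x => \sum_i F i x) = fun x => \sum_i clap (F i) x.
Proof.
move=> sF; apply/funext => x; rewrite /clap !cder_sum //.
  by rewrite -!big_split.
all: by move=> i; exact: csmooth_cder.
Qed.

Lemma gam_mulr F G H x : csmooth G -> csmooth H ->
  gam F (fun x => G x * H x) x = gam F G x * H x + G x * gam F H x.
Proof.
move=> sG sH; rewrite /gam !cderM //.
move: (cder A0 F x) (cder A1 F x) (cder A2 F x) (cder A0 G x) (cder A1 G x) (cder A2 G x) (G x) (H x).
move: (cder A0 H x) (cder A1 H x) (cder A2 H x).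
by move=> *; ring.
Qed.

Lemma gam_sym F G x : gam F G x = gam G F x.
Proof. rewrite /gam; move: (cder A0 F x) (cder A1 F x) (cder A2 F x).
move: (cder A0 G x) (cder A1 G x) (cder A2 G x).
by move=> *; ring. Qed.

Lemma gam_exp F G m n x : csmooth F -> csmooth G ->
  gam (fun x => F x ^+ m) (fun x => G x ^+ n) x =
  m%:R * F x ^+ m.-1 * (n%:R * G x ^+ n.-1) * gam F G x.
Proof.
move=> sF sG; rewrite /gam !cder_exp //.
move: (cder A0 F x) (cder A1 F x) (cder A2 F x) (cder A0 G x) (cder A1 G x) (cder A2 G x).
move: (m%:R * F x ^+ m.-1) (n%:R * G x ^+ n.-1).
by move=> *; ring.
Qed.

Lemma natr_pred_exp (a : C) n : n%:R * a ^+ n.-1 * a = n%:R * a ^+ n.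
Proof. by case: n => [|n] /=; rewrite ?mul0r // -mulrA -exprSr. Qed.

(* [clap F = -3 F] and [gam F F = - F^2] hold for each of the four coordinates. *)
Lemma clap_exp F n x : csmooth F -> (forall x, clap F x = - (3 * F x)) ->
  (forall x, gam F F x = - (F x * F x)) ->
  clap (fun x => F x ^+ n) x = - ((n * (n + 2))%:R * F x ^+ n).
Proof.
move=> sF H1 H2; elim: n x => [|n IH] x.
  rewrite (_ : (fun x => _) = fun=> 1); last by apply/funext => y; rewrite expr0.
  by rewrite /clap !cder_cst !addr0 mul0r oppr0.
rewrite (_ : (fun x => _) = fun x => F x * F x ^+ n); last by apply/funext => y; rewrite exprS.
rewrite clapM //; last exact: csmooth_exp.
have -> : gam F (fun x => F x ^+ n) x = - (n%:R * F x ^+ n.+1).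
  have := @gam_exp F F 1 n x sF sF.
  rewrite (_ : (fun x => F x ^+ 1) = F); last by apply/funext.
  move=> ->; rewrite expr0 !mul1r H2 mulrN; congr (- _).
  by rewrite mulrA natr_pred_exp -mulrA -exprSr.
rewrite IH H1 exprS !natrM !natrD -[n.+1]addn1 !natrD.
by move: (F x) (F x ^+ n) => u v; ring.
Qed.

End ComplexCalculus.

(** * Action on monomials *)

Section Monomials.
Context {R : realType}.
Notation C := (R[i]).
Notation S := (sphere R 3).
Implicit Types (F G : S -> C) (x : S) (A : 'M[R]_4).

Definition z1 : S -> C := fun x => Complex (cc 0 x) (cc 1 x).
Definition z2 : S -> C := fun x => Complex (cc 2 x) (cc 3 x).
Definition z1c : S -> C := fun x => conjc (z1 x).
Definition z2c : S -> C := fun x => conjc (z2 x).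

Lemma csmooth_z1 : csmooth z1. Proof. by split; exact: ssmooth_cc. Qed.
Lemma csmooth_z2 : csmooth z2. Proof. by split; exact: ssmooth_cc. Qed.
Lemma csmooth_z1c : csmooth z1c. Proof. exact: (csmooth_conj csmooth_z1). Qed.
Lemma csmooth_z2c : csmooth z2c. Proof. exact: (csmooth_conj csmooth_z2). Qed.

Lemma z_sphere x : z1 x * z1c x + z2 x * z2c x = 1.
Proof.
apply: complexP; rewrite /= ?cReM ?cImM /=; last by ring.
by rewrite -[RHS](cc_sphere x); ring.
Qed.

Lemma cder_z A k l : cder A (fun x => Complex (cc k x) (cc l x)) =
  fun x => Complex (lder A (cc k) x) (lder A (cc l) x).
Proof. by []. Qed.

Lemma cA0_z1 : cder A0 z1 = fun x => ii * z1 x.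
Proof.
apply/funext => x; rewrite cder_z !lderA0 //=; apply: complexP; rewrite ?cReM ?cImM /=; ring.
Qed.

Lemma cA0_z2 : cder A0 z2 = fun x => ii * z2 x.
Proof.
apply/funext => x; rewrite cder_z !lderA0 //=; apply: complexP; rewrite ?cReM ?cImM /=; ring.
Qed.

Lemma cA1_z1 : cder A1 z1 = fun x => - z2c x.
Proof. by apply/funext => x; rewrite cder_z !lderA1 //=; apply: complexP; rewrite //= opprK. Qed.

Lemma cA1_z2 : cder A1 z2 = fun x => z1c x.
Proof. by apply/funext => x; rewrite cder_z !lderA1 //=; apply: complexP. Qed.

Lemma cA2_z1 : cder A2 z1 = fun x => - (ii * z2c x).
Proof.
apply/funext => x; rewrite cder_z !lderA2 //=; apply: complexP; rewrite /= ?cReM ?cImM /=; ring.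
Qed.

Lemma cA2_z2 : cder A2 z2 = fun x => ii * z1c x.
Proof.
apply/funext => x; rewrite cder_z !lderA2 //=; apply: complexP; rewrite /= ?cReM ?cImM /=; ring.
Qed.

Lemma cAY_z1 : cder AY z1 = fun x => ii * z1 x.
Proof.
apply/funext => x; rewrite cder_z !lderAY //=; apply: complexP; rewrite ?cReM ?cImM /=; ring.
Qed.

Lemma cAY_z2 : cder AY z2 = fun x => 0.
Proof. by apply/funext => x; rewrite cder_z !lderAY. Qed.

Lemma cder_z1c A : cder A z1c = fun x => conjc (cder A z1 x).
Proof. exact: (cder_conj A csmooth_z1). Qed.

Lemma cder_z2c A : cder A z2c = fun x => conjc (cder A z2 x).
Proof. exact: (cder_conj A csmooth_z2). Qed.

Lemma z1cK x : conjc (z1c x) = z1 x. Proof. exact: conjcK. Qed.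
Lemma z2cK x : conjc (z2c x) = z2 x. Proof. exact: conjcK. Qed.

Lemma conjcM (a b : C) : conjc (a * b) = conjc a * conjc b.
Proof. exact: rmorphM. Qed.

Lemma conjcD (a b : C) : conjc (a + b) = conjc a + conjc b.
Proof. exact: rmorphD. Qed.

Lemma conjcN (a : C) : conjc (- a) = - conjc a.
Proof. exact: rmorphN. Qed.

Definition zder := (cA0_z1, cA0_z2, cA1_z1, cA1_z2, cA2_z1, cA2_z2, cder_z1c, cder_z2c).

Lemma cA0_z1c : cder A0 z1c = fun x => - ii * z1c x.
Proof. by apply/funext => x; rewrite !zder conjcM conj_ii. Qed.

Lemma cA0_z2c : cder A0 z2c = fun x => - ii * z2c x.
Proof. by apply/funext => x; rewrite !zder conjcM conj_ii. Qed.

Lemma cA1_z1c : cder A1 z1c = fun x => - z2 x.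
Proof. by apply/funext => x; rewrite !zder conjcN z2cK. Qed.

Lemma cA1_z2c : cder A1 z2c = fun x => z1 x.
Proof. by apply/funext => x; rewrite !zder z1cK. Qed.

Lemma cA2_z1c : cder A2 z1c = fun x => ii * z2 x.
Proof. by apply/funext => x; rewrite !zder conjcN conjcM conj_ii z2cK mulNr opprK. Qed.

Lemma cA2_z2c : cder A2 z2c = fun x => - ii * z1 x.
Proof. by apply/funext => x; rewrite !zder conjcM conj_ii z1cK. Qed.

Lemma cAY_z1c : cder AY z1c = fun x => - ii * z1c x.
Proof. by apply/funext => x; rewrite cder_z1c cAY_z1 conjcM conj_ii. Qed.

Lemma cAY_z2c : cder AY z2c = fun x => 0.
Proof. by apply/funext => x; rewrite cder_z2c cAY_z2 rmorph0. Qed.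

Definition zders := (cA0_z1, cA0_z2, cA1_z1, cA1_z2, cA2_z1, cA2_z2, cA0_z1c, cA0_z2c,
  cA1_z1c, cA1_z2c, cA2_z1c, cA2_z2c, cAY_z1, cAY_z2, cAY_z1c, cAY_z2c).

Ltac gam_tac x := rewrite /gam !zders;
  have := z_sphere x; have := @ii_sqr R;
  move: (@ii R) (z1 x) (z2 x) (z1c x) (z2c x) => i a b a' b' hi h.

Lemma gam_z1_z2 x : gam z1 z2 x = - (z1 x * z2 x).
Proof.
gam_tac x.
transitivity ((i * i) * (a * b) - a' * b' - (i * i) * (a' * b')); first by ring.
by rewrite hi; ring.
Qed.

Lemma gam_z1_z2c x : gam z1 z2c x = - (z1 x * z2c x).
Proof.
gam_tac x.
transitivity (- (i * i) * (a * b') - a * b' + (i * i) * (a * b')); first by ring.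
by rewrite hi; ring.
Qed.

Lemma gam_z1c_z2 x : gam z1c z2 x = - (z1c x * z2 x).
Proof.
gam_tac x.
transitivity (- (i * i) * (a' * b) - a' * b + (i * i) * (a' * b)); first by ring.
by rewrite hi; ring.
Qed.

Lemma gam_z1c_z2c x : gam z1c z2c x = - (z1c x * z2c x).
Proof.
gam_tac x.
transitivity ((i * i) * (a' * b') - a * b - (i * i) * (a * b)); first by ring.
by rewrite hi; ring.
Qed.

(** The constant 2 is the only departure from $-FG$ among the pairings computed here, and it
    produces the lower-order term of [clap_mono]. *)
Lemma gam_z2_z2c x : gam z2 z2c x = 2 - z2 x * z2c x.
Proof.
gam_tac x.
transitivity (- (i * i) * (b * b') + a * a' - (i * i) * (a * a')); first by ring.
have -> : (2 : C) - b * b' = 2 * (a * a' + b * b') - b * b' by rewrite h mulr1.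
by rewrite hi; ring.
Qed.

Lemma gam_z1_z1 x : gam z1 z1 x = - (z1 x * z1 x).
Proof.
gam_tac x.
transitivity ((i * i) * (a * a) + b' * b' + (i * i) * (b' * b')); first by ring.
by rewrite hi; ring.
Qed.

Lemma gam_z1c_z1c x : gam z1c z1c x = - (z1c x * z1c x).
Proof.
gam_tac x.
transitivity ((i * i) * (a' * a') + b * b + (i * i) * (b * b)); first by ring.
by rewrite hi; ring.
Qed.

Lemma gam_z2_z2 x : gam z2 z2 x = - (z2 x * z2 x).
Proof.
gam_tac x.
transitivity ((i * i) * (b * b) + a' * a' + (i * i) * (a' * a')); first by ring.
by rewrite hi; ring.
Qed.

Lemma gam_z2c_z2c x : gam z2c z2c x = - (z2c x * z2c x).
Proof.
gam_tac x.
transitivity ((i * i) * (b' * b') + a * a + (i * i) * (a * a)); first by ring.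
by rewrite hi; ring.
Qed.

Lemma cderN A F : csmooth F -> cder A (fun x => - F x) = fun x => - cder A F x.
Proof.
move=> sF; rewrite (_ : (fun x => - F x) = fun x => -1 * F x); last first.
  by apply/funext => x; rewrite mulN1r.
by rewrite cderZ //; apply/funext => x; rewrite mulN1r.
Qed.

Lemma clap_z1 x : clap z1 x = - (3 * z1 x).
Proof.
have s := csmooth_z2c.
rewrite /clap !zders (cderZ A0 ii csmooth_z1) (cderN A1 s).
rewrite (cderN A2 (csmooth_mul (csmooth_cst ii) s)) (cderZ A2 ii s).
rewrite !zders; have := @ii_sqr R; move: (@ii R) (z1 x) => i a hi.
transitivity ((i * i) * a - a + (i * i) * a); first by ring.
by rewrite hi; ring.
Qed.

Lemma clap_z2 x : clap z2 x = - (3 * z2 x).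
Proof.
rewrite /clap !zders (cderZ A0 ii csmooth_z2) (cderZ A2 ii csmooth_z1c) !zders.
have := @ii_sqr R; move: (@ii R) (z2 x) => i a hi.
transitivity ((i * i) * a - a + (i * i) * a); first by ring.
by rewrite hi; ring.
Qed.

Lemma clap_conj F : csmooth F -> clap (fun x => conjc (F x)) = fun x => conjc (clap F x).
Proof.
move=> sF; apply/funext => x; rewrite /clap !cder_conj //; try exact: csmooth_cder.
by rewrite !conjcD.
Qed.

Lemma clap_z1c x : clap z1c x = - (3 * z1c x).
Proof. by rewrite (clap_conj csmooth_z1) clap_z1 conjcN conjcM conjc_nat. Qed.

Lemma clap_z2c x : clap z2c x = - (3 * z2c x).
Proof. by rewrite (clap_conj csmooth_z2) clap_z2 conjcN conjcM conjc_nat. Qed.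

(* Since both values of [b] give the same function for the exponent 0, monomials
   [mono b a c e] are indexed below with [b -> 0 < a]. *)
Definition gz (b : bool) : S -> C := if b then z1c else z1.

Lemma csmooth_gz b : csmooth (gz b).
Proof. by case: b; [exact: csmooth_z1c|exact: csmooth_z1]. Qed.

Definition mono (b : bool) (a c e : nat) : S -> C :=
  fun x => gz b x ^+ a * z2 x ^+ c * z2c x ^+ e.

Lemma csmooth_mono b a c e : csmooth (mono b a c e).
Proof.
apply: csmooth_mul; last by apply: csmooth_exp; exact: csmooth_z2c.
by apply: csmooth_mul; apply: csmooth_exp; [exact: csmooth_gz|exact: csmooth_z2].
Qed.

Definition sgn (b : bool) : C := if b then -1 else 1.

Lemma cA0_gz b : cder A0 (gz b) = fun x => sgn b * (ii * gz b x).
Proof. by case: b; apply/funext => x; rewrite /gz zders /sgn ?mulN1r ?mulNr ?mul1r. Qed.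

Lemma cAY_gz b : cder AY (gz b) = fun x => sgn b * (ii * gz b x).
Proof. by case: b; apply/funext => x; rewrite /gz zders /sgn ?mulN1r ?mulNr ?mul1r. Qed.

Lemma cder_exp_eigen A F (c : C) n x : csmooth F -> cder A F x = c * F x ->
  cder A (fun x => F x ^+ n) x = n%:R * c * F x ^+ n.
Proof.
move=> sF H; rewrite cder_exp // H.
by case: n => [|n]; rewrite ?mul0r //= exprS; move: (F x) (F x ^+ n) => *; ring.
Qed.

Lemma cder_mono A b a c e x (u v w : C) : cder A (gz b) x = u * gz b x ->
  cder A z2 x = v * z2 x -> cder A z2c x = w * z2c x ->
  cder A (mono b a c e) x = (a%:R * u + c%:R * v + e%:R * w) * mono b a c e x.
Proof.
move=> h1 h2 h3; rewrite /mono.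
have s1 := csmooth_exp a (csmooth_gz b).
have s2 := csmooth_exp c csmooth_z2; have s3 := csmooth_exp e csmooth_z2c.
rewrite (cderM A (csmooth_mul s1 s2) s3) (cderM A s1 s2).
rewrite (cder_exp_eigen a (csmooth_gz b) h1) (cder_exp_eigen c csmooth_z2 h2).
rewrite (cder_exp_eigen e csmooth_z2c h3).
by move: (gz b x ^+ a) (z2 x ^+ c) (z2c x ^+ e) => *; ring.
Qed.

Definition wt (b : bool) (a c e : nat) : C := sgn b * a%:R + c%:R - e%:R.

Lemma cA0_mono b a c e x : cder A0 (mono b a c e) x = ii * wt b a c e * mono b a c e x.
Proof.
rewrite (@cder_mono A0 b a c e x (sgn b * ii) ii (- ii)).
- by congr (_ * _); rewrite /wt; ring.
- by rewrite cA0_gz mulrA.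
- by rewrite zders.
- by rewrite zders.
Qed.

Lemma cAY_mono b a c e x :
  cder AY (mono b a c e) x = ii * (sgn b * a%:R) * mono b a c e x.
Proof.
rewrite (@cder_mono AY b a c e x (sgn b * ii) 0 0).
- by congr (_ * _); rewrite !mulr0 !addr0; ring.
- by rewrite cAY_gz mulrA.
- by rewrite zders mul0r.
- by rewrite zders mul0r.
Qed.

Lemma clap_gz b x : clap (gz b) x = - (3 * gz b x).
Proof. by case: b; rewrite /gz ?clap_z1 ?clap_z1c. Qed.

Lemma gam_gz_gz b x : gam (gz b) (gz b) x = - (gz b x * gz b x).
Proof. by case: b; rewrite /gz ?gam_z1_z1 ?gam_z1c_z1c. Qed.

Lemma gam_gz_z2 b x : gam (gz b) z2 x = - (gz b x * z2 x).
Proof. by case: b; rewrite /gz ?gam_z1_z2 ?gam_z1c_z2. Qed.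

Lemma gam_gz_z2c b x : gam (gz b) z2c x = - (gz b x * z2c x).
Proof. by case: b; rewrite /gz ?gam_z1_z2c ?gam_z1c_z2c. Qed.

Lemma gam_exp_eigen F G m n x : csmooth F -> csmooth G ->
  gam F G x = - (F x * G x) ->
  gam (fun x => F x ^+ m) (fun x => G x ^+ n) x = - (m%:R * F x ^+ m * (n%:R * G x ^+ n)).
Proof.
move=> sF sG H; rewrite gam_exp // H mulrN; congr (- _).
by rewrite mulrACA natr_pred_exp natr_pred_exp.
Qed.

(** Squares and cross terms add up to $n(n+2)$ with $n=a+c+e$. When [c] or [e] is 0 the truncated
    predecessors do no harm, since the coefficient vanishes. *)
Lemma clap_mono b a c e x : clap (mono b a c e) x =
  - (((a + c + e) * (a + c + e + 2))%:R * mono b a c e x)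
  + (4 * (c * e))%:R * mono b a c.-1 e.-1 x.
Proof.
have s1 := csmooth_exp a (csmooth_gz b).
have s2 := csmooth_exp c csmooth_z2; have s3 := csmooth_exp e csmooth_z2c.
rewrite {1}/mono (clapM x (csmooth_mul s1 s2) s3) (clapM x s1 s2).
rewrite (gam_sym _ (fun x => z2c x ^+ e)) (gam_mulr _ x s1 s2).
rewrite (gam_sym _ (fun x => gz b x ^+ a)) (gam_sym (fun x => z2c x ^+ e) (fun x => z2 x ^+ c)).
rewrite (clap_exp _ _ (csmooth_gz b) (clap_gz b) (gam_gz_gz b)).
rewrite (clap_exp _ _ csmooth_z2 clap_z2 gam_z2_z2) (clap_exp _ _ csmooth_z2c clap_z2c gam_z2c_z2c).
rewrite (gam_exp_eigen _ _ (csmooth_gz b) csmooth_z2 (gam_gz_z2 b x)).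
rewrite (gam_exp_eigen _ _ (csmooth_gz b) csmooth_z2c (gam_gz_z2c b x)).
rewrite (gam_exp c e x csmooth_z2 csmooth_z2c) gam_z2_z2c.
have -> : c%:R * z2 x ^+ c.-1 * (e%:R * z2c x ^+ e.-1) * (2 - z2 x * z2c x) =
    2 * (c * e)%:R * (z2 x ^+ c.-1 * z2c x ^+ e.-1) - (c%:R * z2 x ^+ c) * (e%:R * z2c x ^+ e).
  rewrite -(natr_pred_exp (z2 x)) -(natr_pred_exp (z2c x)) natrM.
  by move: (z2 x ^+ c.-1) (z2c x ^+ e.-1) (z2 x) (z2c x) => *; ring.
rewrite /mono !natrM !natrD.
move: (gz b x ^+ a) (z2 x ^+ c) (z2c x ^+ e) (z2 x ^+ c.-1) (z2c x ^+ e.-1).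
by move=> *; ring.
Qed.

(* The Jacobi operator in terms of F = f1 + i f2, where f1 and f2 are the
   coefficients of a variation field in the frame (e1, e2). *)
Definition Kop F : S -> C := fun x => - clap F x + 4 * ii * cder A0 F x.

Definition mono_eigvalC (b : bool) (a c e : nat) : C :=
  ((a + c + e) * (a + c + e + 2))%:R - 4 * wt b a c e.

Lemma Kop_mono b a c e x : Kop (mono b a c e) x =
  mono_eigvalC b a c e * mono b a c e x - (4 * (c * e))%:R * mono b a c.-1 e.-1 x.
Proof.
rewrite /Kop clap_mono cA0_mono /mono_eigvalC.
have -> : 4 * ii * (ii * wt b a c e * mono b a c e x) =
    4 * (ii * ii) * wt b a c e * mono b a c e x by ring.
rewrite ii_sqr.
by move: (mono b a c e x) (mono b a c.-1 e.-1 x) (wt b a c e) => *; ring.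
Qed.

End Monomials.

(** * Explicit eigenfunctions *)

Section Harmonics.
Context {R : realType}.
Notation C := (R[i]).
Notation S := (sphere R 3).
Implicit Types (F G : S -> C) (x : S) (A : 'M[R]_4).

Definition rc : R -> C := real_complex R.

Lemma conj_rc r : conjc (rc r) = rc r.
Proof. exact: conjc_real. Qed.

Lemma rcB (r s : R) : rc (r - s) = rc r - rc s. Proof. exact: rmorphB. Qed.
Lemma rcD (r s : R) : rc (r + s) = rc r + rc s. Proof. exact: rmorphD. Qed.
Lemma rcM (r s : R) : rc (r * s) = rc r * rc s. Proof. exact: rmorphM. Qed.
Lemma rc_nat n : rc n%:R = n%:R. Proof. exact: rmorph_nat. Qed.
Lemma rcX r n : rc (r ^+ n) = rc r ^+ n. Proof. exact: rmorphXn. Qed.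
Lemma rc_sum (J : finType) (f : J -> R) : rc (\sum_j f j) = \sum_j rc (f j).
Proof. exact: rmorph_sum. Qed.
Lemma rc0 : rc 0 = 0. Proof. exact: rmorph0. Qed.

Lemma csmooth_scale (c : C) F : csmooth F -> csmooth (fun x => c * F x).
Proof. by move=> sF; apply: csmooth_mul => //; exact: csmooth_cst. Qed.

Lemma csmooth_clap F : csmooth F -> csmooth (clap F).
Proof. by move=> sF; do 2?apply: csmooth_add; do 2!apply: csmooth_cder. Qed.

Lemma KopD F G x : csmooth F -> csmooth G ->
  Kop (fun x => F x + G x) x = Kop F x + Kop G x.
Proof.
move=> sF sG; rewrite /Kop clapD // cderD //.
by move: (clap F x) (clap G x) (cder A0 F x) (cder A0 G x) => *; ring.
Qed.

Lemma KopZ (c : C) F x : csmooth F -> Kop (fun x => c * F x) x = c * Kop F x.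
Proof.
move=> sF; rewrite /Kop clapZ // cderZ //.
by move: (clap F x) (cder A0 F x) => *; ring.
Qed.

Lemma Kop_sum (J : finType) (F : J -> S -> C) x : (forall i, csmooth (F i)) ->
  Kop (fun x => \sum_i F i x) x = \sum_i Kop (F i) x.
Proof.
by move=> sF; rewrite /Kop clap_sum // cder_sum // mulr_sumr -sumrN -big_split.
Qed.

Definition sgnr (b : bool) : R := if b then -1 else 1.
Definition wtr (b : bool) (a c e : nat) : R := sgnr b * a%:R + c%:R - e%:R.
Definition mono_eigval (b : bool) (a c e : nat) : R :=
  ((a + c + e) * (a + c + e + 2))%:R - 4 * wtr b a c e.

Lemma sgnC b : sgn b = rc (sgnr b).
Proof. by case: b; rewrite /sgn /sgnr /rc ?rmorphN rmorph1. Qed.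

Lemma wtC b a c e : wt b a c e = rc (wtr b a c e).
Proof. by rewrite /wt /wtr sgnC rcB rcD rcM !rc_nat. Qed.

Lemma mono_eigvalE b a c e : mono_eigvalC b a c e = rc (mono_eigval b a c e).
Proof. by rewrite /mono_eigvalC /mono_eigval wtC [RHS]rcB rcM !rc_nat. Qed.

Lemma wtr_sub b a c e j : (j <= minn c e)%N -> wtr b a (c - j) (e - j) = wtr b a c e.
Proof.
rewrite leq_min => /andP[jc je]; rewrite /wtr !natrB //; ring.
Qed.

Lemma mono_eigval_sub b a c e j : (0 < j)%N -> (j <= minn c e)%N ->
  mono_eigval b a (c - j) (e - j) < mono_eigval b a c e.
Proof.
move=> j0 jm; rewrite /mono_eigval wtr_sub // ltrD2r ltr_nat.
move: jm; rewrite leq_min => /andP[jc je].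
have h : (a + (c - j) + (e - j) < a + c + e)%N.
  by move: j0 jc je; lia.
by rewrite ltn_mul // ltn_add2r.
Qed.

(* [Kop] is triangular on the chain [mono b a (c - j) (e - j)], j = 0, 1, ...,
   with strictly decreasing diagonal entries, so it has an eigenvector with
   leading term [mono b a c e]. *)
Fixpoint harmonic_coef b a c e (j : nat) : R := match j with
  | 0 => 1
  | j'.+1 => (4 * ((c - j') * (e - j')))%:R * harmonic_coef b a c e j' /
             (mono_eigval b a (c - j'.+1) (e - j'.+1) - mono_eigval b a c e)
  end.

Definition harmonic b a c e : S -> C := fun x =>
  \sum_(j < (minn c e).+1) rc (harmonic_coef b a c e j) * mono b a (c - j) (e - j) x.

Lemma csmooth_harmonic b a c e : csmooth (harmonic b a c e).
Proof. by apply: csmooth_sum => j; apply: csmooth_scale; exact: csmooth_mono. Qed.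

(** The operator acts on a chain by $m_j\mapsto l_jm_j-k_jm_{j+1}$. The recurrence on [h] equates
    the coefficients of each $m_{j+1}$, and [k M = 0] ends the chain. *)
Lemma triangular_eigen M (h l k : nat -> R) (m : nat -> C) (L : R) :
  l 0%N = L -> k M = 0 ->
  (forall j, (j < M)%N -> k j * h j = h j.+1 * (l j.+1 - L)) ->
  \sum_(j < M.+1) (rc (h j * l j) * m j - rc (k j * h j) * m j.+1) =
  rc L * \sum_(j < M.+1) rc (h j) * m j.
Proof.
move=> l0 kM H.
rewrite sumrB mulr_sumr; apply/eqP; rewrite subr_eq addrC -subr_eq -sumrB; apply/eqP.
rewrite big_ord_recl [RHS]big_ord_recr /= kM mul0r rc0 mul0r addr0 l0.
rewrite rcM (_ : _ - _ = 0) ?add0r; last by ring.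
apply: eq_bigr => j _; rewrite /bump /= add1n H //.
by rewrite !rcM rcB; ring.
Qed.

Lemma Kop_harmonic b a c e x : Kop (harmonic b a c e) x =
  rc (mono_eigval b a c e) * harmonic b a c e x.
Proof.
rewrite /harmonic Kop_sum; last by move=> j; apply: csmooth_scale; exact: csmooth_mono.
set M := minn c e.
pose m j := mono b a (c - j) (e - j) x.
pose l j := mono_eigval b a (c - j) (e - j).
pose k j : R := (4 * ((c - j) * (e - j)))%:R.
rewrite -(@triangular_eigen M (harmonic_coef b a c e) l k m).
- apply: eq_bigr => j _; rewrite KopZ; last exact: csmooth_mono.
  rewrite Kop_mono mono_eigvalE -/(l j) -/(m j) -!subnS -/(m j.+1).
  rewrite /k !rcM rc_nat.
  by move: (rc (harmonic_coef b a c e j)) (rc (l j)) (m j) (m j.+1) => *; ring.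
- by rewrite /l !subn0.
- have E : ((c - M) * (e - M))%N = 0%N.
    by rewrite /M; case: (leqP c e) => _; rewrite subnn ?mul0n ?muln0.
  by rewrite /k E muln0.
- move=> j jM; rewrite /= -/(l j.+1) divfK //.
  by rewrite subr_eq0 lt_eqF // mono_eigval_sub.
Qed.

(** Lowering [c] and [e] together keeps $c-e$ and [a], so all terms of the chain have the same
    weight. *)
Lemma cA0_harmonic b a c e x : cder A0 (harmonic b a c e) x =
  ii * rc (wtr b a c e) * harmonic b a c e x.
Proof.
rewrite /harmonic cder_sum; last by move=> j; apply: csmooth_scale; exact: csmooth_mono.
rewrite mulr_sumr; apply: eq_bigr => j _.
rewrite cderZ; last exact: csmooth_mono.
rewrite cA0_mono wtC wtr_sub; last by rewrite -ltnS.
exact: mulrCA.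
Qed.

Lemma cAY_harmonic b a c e x : cder AY (harmonic b a c e) x =
  ii * rc (sgnr b * a%:R) * harmonic b a c e x.
Proof.
rewrite /harmonic cder_sum; last by move=> j; apply: csmooth_scale; exact: csmooth_mono.
rewrite mulr_sumr; apply: eq_bigr => j _.
rewrite cderZ; last exact: csmooth_mono.
rewrite cAY_mono sgnC rcM rc_nat; exact: mulrCA.
Qed.

(** At real points $(z_1,z_2)=(s,t)$ the value is $s^aq(t)$, where [q] has coefficient 1 in degree
    $c+e$; a nonzero polynomial cannot vanish at too many [t]. *)
Lemma harmonic_neq0 b a c e : exists x, harmonic b a c e x != 0.
Proof.
set M := minn c e.
have Mc : (M <= c)%N by exact: geq_minl.
have Me : (M <= e)%N by exact: geq_minr.
pose q : {poly R} := \sum_(j < M.+1) (harmonic_coef b a c e j)%:P * 'X^(c - j + (e - j)).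
have q0 : q != 0.
  apply/eqP => /(congr1 (fun p : {poly R} => p`_(c + e))).
  rewrite coef0 /q coef_sum big_ord_recl /= big1.
    by rewrite !subn0 mul1r coefXn eqxx addr0 => /eqP; rewrite oner_eq0.
  move=> j _; rewrite coefCM coefXn /bump /=.
  have -> : (c + e == c - (1 + j) + (e - (1 + j)))%N = false.
    apply/negbTE; have := ltn_ord j; move: Mc Me; lia.
  by rewrite mulr0.
(* Infinitely many distinct points in $(0,1)$, so that $s=\sqrt{1-t^2}$ is nonzero as well. *)
pose tt (k : nat) : R := (k.+2)%:R^-1.
have [k qk] : exists k, ~~ root q (tt k).
  apply: contrapT => H.
  have := @max_poly_roots _ q [seq tt k | k <- iota 0 (size q)] q0.
  rewrite size_map size_iota ltnn => /(_ _ _)/notF; apply.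
    apply/allP => t /mapP[k _ ->]; apply: contrapT => /negP nk; apply: H; by exists k.
  rewrite map_inj_uniq ?iota_uniq // => k l /invr_inj /eqP.
  by rewrite eqr_nat => /eqP [].
have t0 : 0 < tt k by rewrite invr_gt0 ltr0n.
have t1 : tt k < 1 by rewrite invf_lt1 ?ltr0n // ltr1n.
set t := tt k in t0 t1 qk.
pose s := Num.sqrt (1 - t ^+ 2).
have st : s ^+ 2 = 1 - t ^+ 2 by rewrite sqr_sqrtr // subr_ge0 expr_le1 // ltW.
have s0 : s != 0.
  by rewrite -sqrf_eq0 st subr_eq0 eq_sym lt_eqF // expr_lt1 // ltW.
pose p : 'rV[R]_4 := \row_j [:: s; 0; t; 0]`_j.
have pP : dot p p == 1.
  rewrite dot4 !mxE !inordK //= -!expr2 st; apply/eqP; ring.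
pose x : S := exist _ p pP.
exists x.
have c0E : cc 0 x = s by rewrite /cc /coord /= mxE inordK.
have c1E : cc 1 x = 0 by rewrite /cc /coord /= mxE inordK.
have c2E : cc 2 x = t by rewrite /cc /coord /= mxE inordK.
have c3E : cc 3 x = 0 by rewrite /cc /coord /= mxE inordK.
have z1E : z1 x = rc s by rewrite /z1 c0E c1E.
have z2E : z2 x = rc t by rewrite /z2 c2E c3E.
have gE : gz b x = rc s.
  by rewrite /gz; case: b {qk q0 q}; rewrite /z1c ?z1E ?conj_rc.
have -> : harmonic b a c e x = rc (s ^+ a * q.[t]).
  rewrite /harmonic /q horner_sum rcM rc_sum mulr_sumr; apply: eq_bigr => j _.
  rewrite /mono gE z2E /z2c z2E conj_rc hornerCM hornerXn exprD !rcM !rcX.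
  by move: (rc s ^+ a) (rc t ^+ (c - j)) (rc t ^+ (e - j)) => *; ring.
have : s ^+ a * q.[t] != 0 by rewrite mulf_neq0 ?expf_neq0.
by apply: contra => /eqP [->].
Qed.

End Harmonics.

(** * Orthogonality and completeness *)

Section Pairing.
Context {R : realType}.
Notation C := (R[i]).
Notation S := (sphere R 3).
Implicit Types (F G : S -> C) (x : S) (A : 'M[R]_4).

Variable I : (S -> R) -> R.
Hypothesis mI : invariant_mean I.

Definition cI F : C := Complex (I (re F)) (I (im F)).

Let sb (f : S -> R) : ssmooth f -> bounded_on_sphere f := @ssmooth_bounded R f.

Lemma cI_add F G : csmooth F -> csmooth G -> cI (fun x => F x + G x) = cI F + cI G.
Proof.
move=> [rF iF] [rG iG]; rewrite /cI.
have -> : re (fun x => F x + G x) = fun x => re F x + re G x.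
  by apply/funext => y; rewrite /re; case: (F y); case: (G y).
have -> : im (fun x => F x + G x) = fun x => im F x + im G x.
  by apply/funext => y; rewrite /im; case: (F y); case: (G y).
by rewrite !(mean_add mI) //; exact: sb.
Qed.

Lemma cI_scale (c : C) F : csmooth F -> cI (fun x => c * F x) = c * cI F.
Proof.
move=> [rF iF]; rewrite /cI.
have -> : re (fun x => c * F x) = fun x => complex.Re c * re F x + (- complex.Im c) * im F x.
  by apply/funext => y; rewrite /re /im cReM /= mulNr.
have -> : im (fun x => c * F x) = fun x => complex.Re c * im F x + complex.Im c * re F x.
  by apply/funext => y; rewrite /re /im cImM.
have b1 := sb rF; have b2 := sb iF.
have bZ r f : bounded_on_sphere f -> bounded_on_sphere (fun x => r * f x).
  by move=> bf; apply: bounded_mul => //; exact: bounded_cst.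
rewrite !(mean_add mI) ?(mean_scale mI); try by [|exact: bZ].
by apply: complexP; rewrite ?cReM ?cImM /= ?mulNr.
Qed.

Lemma cI_cder A F : A^T = - A -> csmooth F -> cI (cder A F) = 0.
Proof.
move=> skA [rF iF]; rewrite /cI.
by apply: complexP; rewrite /= [LHS](mean_lder mI).
Qed.

Lemma cI_conj F : csmooth F -> cI (fun x => conjc (F x)) = conjc (cI F).
Proof.
move=> [rF iF]; rewrite /cI.
have -> : re (fun x => conjc (F x)) = re F.
  by apply/funext => y; rewrite /re; case: (F y).
have -> : im (fun x => conjc (F x)) = fun y => -1 * im F y.
  by apply/funext => y; rewrite /im mulN1r; case: (F y).
by rewrite (mean_scale mI) ?mulN1r //; exact: sb.
Qed.

Definition hprod F G : C := cI (fun x => F x * conjc (G x)).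

Lemma csmooth_mulJ F G : csmooth F -> csmooth G -> csmooth (fun x => F x * conjc (G x)).
Proof. by move=> sF sG; apply: csmooth_mul => //; exact: csmooth_conj. Qed.

Lemma hprod_addl F1 F2 G : csmooth F1 -> csmooth F2 -> csmooth G ->
  hprod (fun x => F1 x + F2 x) G = hprod F1 G + hprod F2 G.
Proof.
move=> s1 s2 sG; rewrite /hprod -cI_add; try exact: csmooth_mulJ.
by congr cI; apply/funext => x; rewrite mulrDl.
Qed.

Lemma hprod_scalel c F G : csmooth F -> csmooth G -> hprod (fun x => c * F x) G = c * hprod F G.
Proof.
move=> sF sG; rewrite /hprod -cI_scale; last exact: csmooth_mulJ.
by congr cI; apply/funext => x; rewrite mulrA.
Qed.

Lemma hprod_sym F G : csmooth F -> csmooth G -> hprod G F = conjc (hprod F G).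
Proof.
move=> sF sG; rewrite /hprod -cI_conj; last exact: csmooth_mulJ.
by congr cI; apply/funext => x; rewrite conjcM conjcK mulrC.
Qed.

Lemma hprod_addr F G1 G2 : csmooth F -> csmooth G1 -> csmooth G2 ->
  hprod F (fun x => G1 x + G2 x) = hprod F G1 + hprod F G2.
Proof.
move=> sF s1 s2; rewrite hprod_sym ?hprod_addl //; last exact: csmooth_add.
by rewrite conjcD -!hprod_sym.
Qed.

Lemma hprod_scaler c F G : csmooth F -> csmooth G ->
  hprod F (fun x => c * G x) = conjc c * hprod F G.
Proof.
move=> sF sG; rewrite hprod_sym ?hprod_scalel //; last exact: csmooth_scale.
by rewrite conjcM -hprod_sym.
Qed.

Lemma hprod_sumr (J : finType) F (G : J -> S -> C) : csmooth F -> (forall j, csmooth (G j)) ->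
  hprod F (fun x => \sum_j G j x) = \sum_j hprod F (G j).
Proof.
move=> sF sG; pose P (g : S -> C) (z : C) := csmooth g /\ hprod F g = z.
have : P (\sum_j G j) (\sum_j hprod F (G j)).
  elim/big_ind2: _ => [|f1 f2 g1 g2 [s1 <-] [s2 <-]|i _]; last by split.
  - split; first exact: (csmooth_cst 0).
    have := hprod_scaler 0 sF (csmooth_cst 0); rewrite conjc0 [X in _ = X]mul0r => <-.
    by congr hprod; apply/funext => x; rewrite mul0r.
  - split; [exact: csmooth_add|exact: (hprod_addr sF s1 s2)].
by move=> [_ <-]; congr hprod; apply/funext => x; rewrite fct_sumE.
Qed.

Lemma hprod_cder A F G : A^T = - A -> csmooth F -> csmooth G ->
  hprod (cder A F) G = - hprod F (cder A G).
Proof.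
move=> skA sF sG; apply/eqP; rewrite -addr_eq0; apply/eqP.
rewrite /hprod -cI_add; try by apply: csmooth_mulJ => //; exact: csmooth_cder.
rewrite -[RHS](cI_cder skA (csmooth_mulJ sF sG)); congr cI.
by rewrite (cderM A sF (csmooth_conj sG)) (cder_conj A sG).
Qed.

Lemma hprod_clap F G : csmooth F -> csmooth G -> hprod (clap F) G = hprod F (clap G).
Proof.
move=> sF sG.
have D A : A^T = - A -> hprod (cder A (cder A F)) G = hprod F (cder A (cder A G)).
  by move=> skA; rewrite !hprod_cder // ?opprK //; do ?exact: csmooth_cder.
have s A K : csmooth K -> csmooth (cder A (cder A K)).
  by move=> sK; do 2!apply: csmooth_cder.
have f0 := s A0 _ sF; have f1 := s A1 _ sF; have f2 := s A2 _ sF.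
have g0 := s A0 _ sG; have g1 := s A1 _ sG; have g2 := s A2 _ sG.
rewrite [LHS](hprod_addl (csmooth_add f0 f1) f2 sG) (hprod_addl f0 f1 sG).
rewrite [RHS](hprod_addr sF (csmooth_add g0 g1) g2) (hprod_addr sF g0 g1).
exact: (f_equal2 +%R (f_equal2 +%R (D _ skew_A0) (D _ skew_A1)) (D _ skew_A2)).
Qed.

(** Multiplication by $i$ and the field [X0] are both skew-adjoint, so their product in the
    first-order term is self-adjoint. *)
Lemma hprod_Kop F G : csmooth F -> csmooth G -> hprod (Kop F) G = hprod F (Kop G).
Proof.
move=> sF sG.
have E K : Kop K = fun x => -1 * clap K x + (4 * ii) * cder A0 K x.
  by apply/funext => x; rewrite mulN1r.
have c1 := csmooth_clap sF; have c2 := csmooth_clap sG.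
have d1 := csmooth_cder A0 sF; have d2 := csmooth_cder A0 sG.
rewrite !E hprod_addl ?hprod_addr ?hprod_scalel ?hprod_scaler //; try exact: csmooth_scale.
rewrite hprod_clap // (hprod_cder skew_A0 sF sG) conjcN conjc1 conjcM conj_ii conjc_nat.
by move: (hprod F _) (hprod F _) => *; ring.
Qed.

Definition eigenK (l : R) F : Prop := csmooth F /\ forall x, Kop F x = rc l * F x.

Section Completeness.
Variables (l : R) (F : S -> C).
Hypothesis eF : eigenK l F.
Hypothesis orthF : forall (b : bool) a c e, (b -> 0 < a)%N -> mono_eigval b a c e = l ->
  hprod F (harmonic b a c e) = 0.

Let sF : csmooth F. Proof. by case: eF. Qed.

(** Strong induction on [e]. If the diagonal entry differs from [l], self-adjointness and the
    vanishing on lower terms force 0; if it equals [l], the monomial is an explicit eigenfunction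
    minus lower terms. *)
Lemma hprod_mono_norm (b : bool) a c e : (b -> 0 < a)%N -> hprod F (mono b a c e) = 0.
Proof.
move=> ba; have [n] := ubnP e; elim: n c e => // n IH c e; rewrite ltnS => en.
have low j : (0 < j)%N -> (j <= minn c e)%N -> hprod F (mono b a (c - j) (e - j)) = 0.
  move=> j0; rewrite leq_min => /andP[jc je]; apply: IH; move: j0 jc je en; lia.
have [L|L] := eqVneq (mono_eigval b a c e) l.
  have := orthF ba L; rewrite /harmonic hprod_sumr //; last first.
    by move=> j; apply: csmooth_scale; exact: csmooth_mono.
  rewrite big_ord_recl big1 /=.
    rewrite addr0 !subn0 hprod_scaler //; last exact: csmooth_mono.
    by rewrite conj_rc /rc rmorph1 mul1r.
  move=> j _; rewrite hprod_scaler //; last exact: csmooth_mono.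
  by rewrite low ?mulr0 // /bump /= add1n; exact: ltn_ord.
have K1 : hprod (Kop F) (mono b a c e) = rc l * hprod F (mono b a c e).
  rewrite -hprod_scalel //; last exact: csmooth_mono.
  by congr hprod; apply/funext => x; case: eF.
have K2 : hprod F (Kop (mono b a c e)) = rc (mono_eigval b a c e) * hprod F (mono b a c e).
  have -> : Kop (mono b a c e) = fun x => rc (mono_eigval b a c e) * mono b a c e x +
       (- (4 * (c * e))%:R) * mono b a c.-1 e.-1 x.
    by apply/funext => x; rewrite Kop_mono mono_eigvalE mulNr.
  rewrite hprod_addr //; try by apply: csmooth_scale; exact: csmooth_mono.
  rewrite !hprod_scaler //; try exact: csmooth_mono.
  rewrite conj_rc [X in _ + X](_ : _ = 0) ?addr0 //.
  have [m0|m0] := posnP (c * e); first by rewrite m0 muln0 oppr0 conjc0 mul0r.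
  rewrite -!subn1 low ?mulr0 //.
  by move: m0; rewrite muln_gt0 leq_min => /andP[-> ->].
have := hprod_Kop sF (csmooth_mono b a c e); rewrite K1 K2 => /eqP.
rewrite -subr_eq0 -mulrBl mulf_eq0 => /orP[|/eqP //].
by rewrite -rcB => /eqP [/eqP]; rewrite subr_eq0 eq_sym (negPf L).
Qed.

Definition mono4 a b c e : S -> C :=
  fun x => z1 x ^+ a * z1c x ^+ b * z2 x ^+ c * z2c x ^+ e.

Lemma csmooth_mono4 a b c e : csmooth (mono4 a b c e).
Proof.
do 3?apply: csmooth_mul; apply: csmooth_exp;
  [exact: csmooth_z1|exact: csmooth_z1c|exact: csmooth_z2|exact: csmooth_z2c].
Qed.

(* On the sphere z1 conj(z1) = 1 - z2 conj(z2), so mixed powers of z1 and its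
   conjugate reduce to pure ones. *)
Lemma hprod_mono4 a b c e : hprod F (mono4 a b c e) = 0.
Proof.
elim: b a c e => [|b IH] a c e.
  have N : false -> (0 < a)%N by [].
  have := @hprod_mono_norm false a c e N; congr (_ = _); congr hprod.
  by apply/funext => x; rewrite /mono4 /mono expr0 mulr1.
case: a => [|a].
  have := @hprod_mono_norm true b.+1 c e (fun _ => isT); congr (_ = _); congr hprod.
  by apply/funext => x; rewrite /mono4 /mono expr0 mul1r.
have -> : mono4 a.+1 b.+1 c e = fun x => mono4 a b c e x + -1 * mono4 a b c.+1 e.+1 x.
  apply/funext => x; rewrite /mono4 !exprS.
  have h : z1 x * z1c x = 1 - z2 x * z2c x by rewrite -(z_sphere x) addrK.
  transitivity ((z1 x * z1c x) * (z1 x ^+ a * z1c x ^+ b * z2 x ^+ c * z2c x ^+ e)).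
    by move: (z1 x ^+ a) (z1c x ^+ b) (z2 x ^+ c) (z2c x ^+ e) => *; ring.
  rewrite h.
  by move: (z1 x ^+ a) (z1c x ^+ b) (z2 x ^+ c) (z2c x ^+ e) => *; ring.
rewrite hprod_addr ?hprod_scaler ?IH ?mulr0 ?addr0 //; try exact: csmooth_mono4.
by apply: csmooth_scale; exact: csmooth_mono4.
Qed.

Lemma dot_z (x0 x : S) : rc (dot (val x0) (val x)) =
  (z1c x0 / 2) * z1 x + (z1 x0 / 2) * z1c x + (z2c x0 / 2) * z2 x + (z2 x0 / 2) * z2c x.
Proof.
have two : (2 : C) != 0 by rewrite pnatr_eq0.
apply: (mulfI two).
transitivity (z1c x0 * z1 x + z1 x0 * z1c x + z2c x0 * z2 x + z2 x0 * z2c x); last by field.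
have -> : (2 : C) = rc 2 by rewrite rc_nat.
rewrite -rcM dot4; apply: complexP; rewrite /= ?cReM ?cImM /= /cc /coord /=; ring.
Qed.

(** One factor $1+\langle x_0,x\rangle$ turns a [mono4] into a combination of five others, so the
    exponents must stay general in the induction. *)
Lemma hprod_concentrated (x0 : S) n a b c e :
  hprod F (fun x => rc (1 + dot (val x0) (val x)) ^+ n * mono4 a b c e x) = 0.
Proof.
elim: n a b c e => [|n IH] a b c e.
  rewrite -[RHS](hprod_mono4 a b c e); congr hprod; apply/funext => x.
  by rewrite expr0 mul1r.
pose k x := rc (1 + dot (val x0) (val x)).
have sk : csmooth k.
  have -> : k = fun x => 1 + ((z1c x0 / 2) * z1 x + (z1 x0 / 2) * z1c x
     + (z2c x0 / 2) * z2 x + (z2 x0 / 2) * z2c x).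
    by apply/funext => x; rewrite -dot_z /k rcD /rc rmorph1.
  apply: csmooth_add; first exact: csmooth_cst.
  do 3?apply: csmooth_add; apply: csmooth_scale;
   [exact: csmooth_z1|exact: csmooth_z1c|exact: csmooth_z2|exact: csmooth_z2c].
pose m a b c e x := k x ^+ n * mono4 a b c e x.
have sm a' b' c' e' : csmooth (m a' b' c' e').
  by apply: csmooth_mul; [exact: csmooth_exp|exact: csmooth_mono4].
have -> : (fun x => rc (1 + dot (val x0) (val x)) ^+ n.+1 * mono4 a b c e x) = fun x =>
    m a b c e x + ((z1c x0 / 2) * m a.+1 b c e x + ((z1 x0 / 2) * m a b.+1 c e x
     + ((z2c x0 / 2) * m a b c.+1 e x + (z2 x0 / 2) * m a b c e.+1 x))).
  apply/funext => x; rewrite -/(k x) exprS {1}/k rcD /rc rmorph1 -/rc dot_z /m /mono4 !exprS.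
  move: (z1 x ^+ a) (z1c x ^+ b) (z2 x ^+ c) (z2c x ^+ e) (k x ^+ n).
  move: (z1 x0 / 2) (z1c x0 / 2) (z2 x0 / 2) (z2c x0 / 2).
  by move: (z1 x) (z1c x) (z2 x) (z2c x) => *; ring.
have Hm a' b' c' e' : hprod F (m a' b' c' e') = 0 by exact: IH.
do 4!(rewrite hprod_addr //; try by do ?apply: csmooth_add; do ?exact: csmooth_scale).
by rewrite !hprod_scaler // !Hm !mulr0 !addr0.
Qed.

Lemma completeness x : F x = 0.
Proof.
have K (x0 : S) n : hprod F (fun x => rc ((1 + dot (val x0) (val x)) ^+ n)) = 0.
  rewrite -[RHS](hprod_concentrated x0 n 0 0 0 0); congr hprod; apply/funext => y.
  by rewrite rcX /mono4 !expr0 !mulr1.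
have [rF iF] := sF.
have E (x0 : S) n : (fun y => F y * conjc (rc ((1 + dot (val x0) (val y)) ^+ n))) =
   (fun y => F y * rc ((1 + dot (val x0) (val y)) ^+ n)).
  by apply/funext => y; rewrite conj_rc.
(* The test functions are real, so they annihilate the real and imaginary parts of [F]
   separately. *)
apply: complexP.
  apply: (concentration mI rF) => x0 n.
  have := congr1 (@complex.Re R) (K x0 n); rewrite /hprod E /cI /= => h; rewrite -[RHS]h.
  by congr I; apply/funext => y; rewrite /re cReM /= mulr0 subr0.
apply: (concentration mI iF) => x0 n.
have := congr1 (@complex.Im R) (K x0 n); rewrite /hprod E /cI /= => h; rewrite -[RHS]h.
by congr I; apply/funext => y; rewrite /im cImM /= mulr0 add0r.
Qed.

End Completeness.

End Pairing.

(** * Orthogonality and bases of eigenspaces *)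

Section Orthogonality.
Context {R : realType}.
Notation C := (R[i]).
Notation S := (sphere R 3).
Implicit Types (F G : S -> C) (x : S) (A : 'M[R]_4).

Variable I : (S -> R) -> R.
Hypothesis mI : invariant_mean I.

(** For nonnegative [f] the weighted function lies between 0 and $Mf$, so all its means vanish and
    [concentration] applies. *)
Lemma mean_faithful (f : S -> R) : ssmooth f -> (forall x, 0 <= f x) -> I f = 0 ->
  forall x, f x = 0.
Proof.
move=> sf f0 If; apply: (concentration mI sf) => x0 n.
pose k (y : S) := 1 + dot (val x0) (val y).
have sk : ssmooth k by apply: ssmooth_add; [exact: ssmooth_cst|exact: ssmooth_dot].
have [M HM] := ssmooth_bounded (ssmooth_exp n sk).
have sfk : ssmooth (fun y => f y * k y ^+ n) by apply: ssmooth_mul => //; exact: ssmooth_exp.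
have k0 y : 0 <= k y.
  have := dot_ge0 (val x0 + val y).
  by rewrite !dotDl !dotDr !sphere_dot (dotC (val y)) /k; lra.
apply/eqP; rewrite eq_le; apply/andP; split; last first.
  apply: (mean_ge0 mI); first exact: ssmooth_bounded.
  by move=> y; apply: mulr_ge0; [exact: f0|apply: exprn_ge0; exact: k0].
have -> : 0 = I (fun y => M * f y).
  by rewrite (mean_scale mI) ?If ?mulr0 //; exact: ssmooth_bounded.
apply: (mean_le mI); first exact: ssmooth_bounded.
  by apply: bounded_mul; [exact: bounded_cst|exact: ssmooth_bounded].
move=> y; rewrite mulrC ler_wpM2r //.
exact: le_trans (ler_norm _) (HM y).
Qed.

Notation Hp := (hprod I).

Lemma hprod_im0 F : csmooth F -> complex.Im (Hp F F) = 0.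
Proof.
move=> sF; have := congr1 (@complex.Im R) (hprod_sym mI sF sF).
case: (Hp F F) => a b /= /eqP; rewrite -addr_eq0 -mulr2n mulrn_eq0 /= => /eqP //.
Qed.

Lemma hprod_gt0 F : csmooth F -> (exists x, F x != 0) -> 0 < complex.Re (Hp F F).
Proof.
move=> sF [x Fx].
have [rF iF] := sF.
pose f y := re F y ^+ 2 + im F y ^+ 2.
have sf : ssmooth f by apply: ssmooth_add; exact: ssmooth_exp.
have f0 y : 0 <= f y by rewrite addr_ge0 // sqr_ge0.
have -> : complex.Re (Hp F F) = I f.
  rewrite /hprod /cI /=; congr I; apply/funext => y; rewrite /f /re /im cReM.
  case: (F y) => a b /=; ring.
rewrite lt_neqAle (mean_ge0 mI (ssmooth_bounded sf) f0) andbT eq_sym.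
apply: contra Fx => /eqP /(mean_faithful sf f0) /(_ x) /eqP.
rewrite /f paddr_eq0 ?sqr_ge0 // !sqrf_eq0 => /andP[/eqP h1 /eqP h2].
by apply/eqP; apply: complexP.
Qed.

Lemma hprod_skew_eigen A F G (u v : R) : A^T = - A -> csmooth F -> csmooth G ->
  (forall x, cder A F x = ii * rc u * F x) -> (forall x, cder A G x = ii * rc v * G x) ->
  u != v -> Hp F G = 0.
Proof.
move=> skA sF sG hF hG uv.
have := hprod_cder mI skA sF sG.
have -> : cder A F = fun x => ii * rc u * F x by apply/funext.
have -> : cder A G = fun x => ii * rc v * G x by apply/funext.
rewrite (hprod_scalel mI) // (hprod_scaler mI) // conjcM conj_ii conj_rc !mulNr opprK.
move=> /eqP; rewrite -subr_eq0 -mulrBl -mulrBr -rcB !mulf_eq0.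
case/orP => [|/eqP //] /orP[/eqP [/eqP]|/eqP [/eqP]]; first by rewrite oner_eq0.
by rewrite subr_eq0 (negPf uv).
Qed.

Lemma degree_inj (m k : nat) : (m * (m + 2) = k * (k + 2))%N -> m = k.
Proof.
have lt (p q : nat) : (p < q)%N -> (p * (p + 2) < q * (q + 2))%N.
  by move=> pq; apply: ltn_mul; rewrite ?ltn_add2r.
by case: (ltngtP m k) => // /lt h e; rewrite e ltnn in h.
Qed.

(** The [AY] eigenvalue gives the signed exponent $\pm a$, hence [b] and [a]; the [A0] weight then
    gives $c-e$, and together with the common eigenvalue it gives the degree, hence $c+e$. Distinct
    indices therefore differ under one of the two skew fields. *)
Lemma harmonic_orth (b b' : bool) a a' c c' e e' : (b -> 0 < a)%N -> (b' -> 0 < a')%N ->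
  mono_eigval b a c e = mono_eigval b' a' c' e' :> R -> (b, a, c, e) <> (b', a', c', e') ->
  Hp (harmonic b a c e) (harmonic b' a' c' e') = 0.
Proof.
move=> ba ba' L ne.
have [w|w] := eqVneq (wtr b a c e : R) (wtr b' a' c' e'); last first.
  by apply: (hprod_skew_eigen (@skew_A0 R) _ _ _ _ w);
   [exact: csmooth_harmonic|exact: csmooth_harmonic|exact: cA0_harmonic|exact: cA0_harmonic].
have [s|s] := eqVneq (sgnr b * a%:R : R) (sgnr b' * a'%:R); last first.
  by apply: (hprod_skew_eigen (@skew_AY R) _ _ _ _ s);
   [exact: csmooth_harmonic|exact: csmooth_harmonic|exact: cAY_harmonic|exact: cAY_harmonic].
case: ne; move: L; rewrite /mono_eigval w => /addIr /eqP; rewrite eqr_nat => /eqP n.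
have nn : (a + c + e = a' + c' + e')%N := degree_inj n.
have [eb ea] : b = b' /\ a = a'.
  have pos (k : nat) : (0 < k)%N -> (0 : R) < k%:R by rewrite ltr0n.
  case: b b' ba ba' s {w n} => -[] ba ba'; rewrite /sgnr ?mulN1r ?mul1r.
  - by move=> /oppr_inj /eqP; rewrite eqr_nat => /eqP.
  - have := pos _ (ba isT); have : (0 : R) <= a'%:R by rewrite ler0n.
    by move=> h1 h2 h3; exfalso; move: h1 h2 h3; clear; lra.
  - have := pos _ (ba' isT); have : (0 : R) <= a%:R by rewrite ler0n.
    by move=> h1 h2 h3; exfalso; move: h1 h2 h3; clear; lra.
  - by move=> /eqP; rewrite eqr_nat => /eqP.
move: w; rewrite /wtr s -addrA -[RHS]addrA => /addrI /eqP.
rewrite subr_eq addrAC eq_sym subr_eq -!natrD eqr_nat => /eqP ce.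
by subst b' a'; congr (_, _, _, _); move: nn ce; lia.
Qed.

Lemma harmonic_gt0 b a c e : 0 < complex.Re (Hp (harmonic b a c e) (harmonic b a c e)).
Proof. by apply: hprod_gt0; [exact: csmooth_harmonic|exact: harmonic_neq0]. Qed.

(* Dimensions are real, so each complex eigenfunction F counts twice, as F and i F. *)
Definition phase (s : bool) : C := if s then ii else 1.

Definition mode (t : bool * nat * nat * nat * bool) : S -> C :=
  let: (b, a, c, e, s) := t in fun x => phase s * harmonic b a c e x.

Definition valid_index (t : bool * nat * nat * nat * bool) : Prop :=
  let: (b, a, c, e, s) := t in (b -> 0 < a)%N.

Definition mode_eigval (t : bool * nat * nat * nat * bool) : R :=
  let: (b, a, c, e, s) := t in mono_eigval b a c e.

Definition rprod F G : R := complex.Re (Hp F G).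

Lemma mode_eigen t : eigenK (mode_eigval t) (mode t).
Proof.
case: t => [[[[b a] c] e] s]; split; first by apply: csmooth_scale; exact: csmooth_harmonic.
by move=> x; rewrite /= KopZ ?Kop_harmonic; [exact: mulrCA|exact: csmooth_harmonic].
Qed.

(** For two phases of one harmonic, the complex product is $\pm i$ times a real number and has real
    part 0. *)
Lemma mode_orth t t' : valid_index t -> valid_index t' ->
  mode_eigval t = mode_eigval t' -> t <> t' ->
  rprod (mode t) (mode t') = 0.
Proof.
case: t => [[[[b a] c] e] s]; case: t' => [[[[b' a'] c'] e'] s'] /= v v' L ne.
rewrite /rprod (hprod_scalel mI);
  [|exact: csmooth_harmonic|by apply: csmooth_scale; exact: csmooth_harmonic].
rewrite (hprod_scaler mI); try exact: csmooth_harmonic.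
have [E|E] := eqVneq (b, a, c, e) (b', a', c', e'); last first.
  by rewrite (harmonic_orth v v' L) ?mulr0 //; apply/eqP.
case: E ne => <- <- <- <- ne.
have := hprod_im0 (csmooth_harmonic b a c e); case: (Hp _ _) => p q /= ->.
by case: s s' ne => -[] // _; rewrite /phase ?conj_ii ?conjc1 !(cReM, cImM) /=; ring.
Qed.

Lemma mode_gt0 t : 0 < rprod (mode t) (mode t).
Proof.
case: t => [[[[b a] c] e] s].
rewrite /rprod (hprod_scalel mI);
  [|exact: csmooth_harmonic|by apply: csmooth_scale; exact: csmooth_harmonic].
rewrite (hprod_scaler mI); try exact: csmooth_harmonic.
have := harmonic_gt0 b a c e; case: (Hp _ _) => p q /= p0.
by case: s; rewrite /phase ?conj_ii ?conjc1 !(cReM, cImM) /=;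
  rewrite (_ : _ - _ = p) //; ring.
Qed.

(** Real orthogonality to both phases of a harmonic is complex orthogonality to it. *)
Lemma mode_complete l F : eigenK l F ->
  (forall t, valid_index t -> mode_eigval t = l -> rprod F (mode t) = 0) -> forall x, F x = 0.
Proof.
move=> eF oF; apply: (completeness mI eF) => b a c e v L.
have sF : csmooth F by case: eF.
have sh := csmooth_harmonic b a c e : csmooth (harmonic b a c e).
have h1 := oF (b, a, c, e, false) v L; have h2 := oF (b, a, c, e, true) v L.
move: h1 h2; rewrite /rprod /mode !(hprod_scaler mI) // /phase conjc1 conj_ii mul1r.
case: (Hp _ _) => p q; rewrite cReM /= => -> h.
by apply: complexP => //=; lra.
Qed.

Lemma rprod_addl F1 F2 G : csmooth F1 -> csmooth F2 -> csmooth G ->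
  rprod (fun x => F1 x + F2 x) G = rprod F1 G + rprod F2 G.
Proof.
by move=> s1 s2 sG; rewrite /rprod (hprod_addl mI).
Qed.

Lemma rprod_scalel r F G : csmooth F -> csmooth G ->
  rprod (fun x => rc r * F x) G = r * rprod F G.
Proof.
by move=> sF sG; rewrite /rprod (hprod_scalel mI) // cReM /= mul0r subr0.
Qed.

Lemma rprod_suml (J : finType) (F : J -> S -> C) G : csmooth G -> (forall j, csmooth (F j)) ->
  rprod (fun x => \sum_j F j x) G = \sum_j rprod (F j) G.
Proof.
move=> sG sF; pose Q (g : S -> C) (z : R) := csmooth g /\ rprod g G = z.
have : Q (\sum_j F j) (\sum_j rprod (F j) G).
  elim/big_ind2: _ => [|f1 f2 g1 g2 [s1 <-] [s2 <-]|i _]; last by split.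
  - split; first exact: (csmooth_cst 0).
    have := rprod_scalel 0 (csmooth_cst 0) sG; rewrite [X in _ = X]mul0r => <-.
    by congr rprod; apply/funext => x; rewrite mulr0.
  - split; [exact: csmooth_add|exact: (rprod_addl s1 s2 sG)].
by move=> [_ <-]; congr rprod; apply/funext => x; rewrite fct_sumE.
Qed.

Lemma eigenK_sum l (J : finType) (a : J -> R) (F : J -> S -> C) :
  (forall j, eigenK l (F j)) -> eigenK l (fun x => \sum_j rc (a j) * F j x).
Proof.
move=> eF; have s j : csmooth (fun x => rc (a j) * F j x).
  by apply: csmooth_scale; case: (eF j).
split; first exact: csmooth_sum.
move=> x; rewrite Kop_sum // mulr_sumr; apply: eq_bigr => j _.
by rewrite KopZ; [case: (eF j) => _ ->; exact: mulrCA|case: (eF j)].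
Qed.

Lemma eigenK_sub l F G : eigenK l F -> eigenK l G -> eigenK l (fun x => F x + -1 * G x).
Proof.
move=> [sF eF] [sG eG]; split; first by apply: csmooth_add => //; exact: csmooth_scale.
move=> x; rewrite KopD ?KopZ //; last exact: csmooth_scale.
by rewrite eF eG mulrDr; congr (_ + _); exact: mulrCA.
Qed.

Section Basis.
Variables (l : R) (T : finType) (t : T -> bool * nat * nat * nat * bool).
Hypothesis tinj : injective t.
Hypothesis tvalid : forall j, valid_index (t j).
Hypothesis tlam : forall j, mode_eigval (t j) = l.
Hypothesis tsurj : forall u, valid_index u -> mode_eigval u = l -> exists j, t j = u.

Let smooth_mode u : csmooth (mode u). Proof. by case: (mode_eigen u). Qed.

Lemma rprod_comb (a : T -> R) j :
  rprod (fun x => \sum_i rc (a i) * mode (t i) x) (mode (t j)) =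
  a j * rprod (mode (t j)) (mode (t j)).
Proof.
rewrite rprod_suml //; last by move=> i; exact: csmooth_scale.
rewrite (bigD1 j) //= big1 ?addr0 ?rprod_scalel // => i ij.
rewrite rprod_scalel // mode_orth ?mulr0 ?tlam //.
by move=> /tinj /eqP; rewrite (negPf ij).
Qed.

Lemma mode_free (a : T -> R) :
  (forall x, \sum_i rc (a i) * mode (t i) x = 0) -> forall j, a j = 0.
Proof.
move=> h j; have := rprod_comb a j.
have -> : (fun x => \sum_i rc (a i) * mode (t i) x) = fun x => rc 0 * mode (t j) x.
  by apply/funext => x; rewrite h rc0 mul0r.
rewrite rprod_scalel // mul0r => /esym /eqP; rewrite mulf_eq0 => /orP[/eqP //|].
by rewrite gt_eqF // mode_gt0.
Qed.

(** Subtracting from [F] its orthogonal projection on the modes leaves an eigenfunction orthogonal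
    to all of them, which [mode_complete] makes 0; finite dimension is not presupposed. *)
Lemma mode_span F : eigenK l F <->
  exists a : T -> R, forall x, F x = \sum_i rc (a i) * mode (t i) x.
Proof.
have eB j : eigenK l (mode (t j)) by rewrite -(tlam j); exact: mode_eigen.
split=> [eF|[a ha]]; last first.
  have -> : F = fun x => \sum_i rc (a i) * mode (t i) x by apply/funext.
  exact: eigenK_sum.
pose a j := rprod F (mode (t j)) / rprod (mode (t j)) (mode (t j)).
exists a => x.
pose G x := \sum_i rc (a i) * mode (t i) x.
have eG : eigenK l G by exact: eigenK_sum.
have := mode_complete (eigenK_sub eF eG).
suff oFG u : valid_index u -> mode_eigval u = l -> rprod (fun x => F x + -1 * G x) (mode u) = 0.
  by move=> /(_ oFG x) /eqP; rewrite mulN1r subr_eq0 => /eqP.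
move=> vu lu; have [j <-] := tsurj vu lu.
have sF : csmooth F by case: eF.
have sG : csmooth G by case: eG.
have m1 : rc (-1 : R) = -1 by apply: complexP; rewrite /= ?oppr0.
rewrite -m1 rprod_addl //; last exact: csmooth_scale.
rewrite rprod_scalel // rprod_comb /a divfK ?mulN1r ?subrr //.
by rewrite gt_eqF // mode_gt0.
Qed.

End Basis.

End Orthogonality.

(** * The spectrum *)

Section HasDim.
Context {R : realType}.

Lemma has_dim_fin (X : Type) (m : nat) (V : set (X -> 'rV[R]_m)) (T : finType)
    (b : T -> X -> 'rV[R]_m) :
  (forall a : T -> R, (forall x, \sum_t a t *: b t x = 0) -> forall t, a t = 0) ->
  (forall w, V w <-> exists a : T -> R, forall x, w x = \sum_t a t *: b t x) ->
  has_dim V #|T|.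
Proof.
move=> free span; exists (fun i => b (enum_val i)).
have E (a : 'I_#|T| -> R) x :
    \sum_(i < #|T|) a i *: b (enum_val i) x = \sum_t a (enum_rank t) *: b t x.
  rewrite [RHS](reindex (fun i : 'I_#|T| => enum_val i)) /=; last first.
    by exists enum_rank => t _; [exact: enum_valK|exact: enum_rankK].
  by apply: eq_bigr => i _; rewrite enum_valK.
split=> [a h i|w].
  rewrite -(enum_valK i); apply: (free (fun t => a (enum_rank t))) => x.
  by rewrite -E.
rewrite span; split=> [[a h]|[a h]].
  exists (fun i => a (enum_val i)) => x; rewrite h E.
  by apply: eq_bigr => t _; rewrite enum_rankK.
by exists (fun t => a (enum_rank t)) => x; rewrite h E.
Qed.

Lemma has_dim_ext (X : Type) (m : nat) (V W : set (X -> 'rV[R]_m)) d :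
  (forall w, V w <-> W w) -> has_dim V d -> has_dim W d.
Proof.
by move=> VW [b [fb sb]]; exists b; split=> // w; rewrite -VW.
Qed.

End HasDim.

(** * Counting the pairs $(n,k)$ *)

Section Spectrum.
Context {R : realType}.
Notation C := (R[i]).
Notation S := (sphere R 3).
Implicit Types (F G : S -> C) (x : S).

Definition field_of F : S -> 'rV[R]_3 := frame_field (re F) (im F).

Variable E : S -> 'I_3 -> S -> 'rV[R]_4.
Hypothesis hE : forall x, local_orthonormal_frame x (E x).

Lemma KopE F x : Kop F x =
  Complex (- lap (re F) x - 4 * lder A0 (im F) x) (- lap (im F) x + 4 * lder A0 (re F) x).
Proof.
have -> : Kop F x = - Complex (lap (re F) x) (lap (im F) x) +
    4 * ii * Complex (lder A0 (re F) x) (lder A0 (im F) x) by [].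
move: (lap (re F) x) (lap (im F) x) (lder A0 (re F) x) (lder A0 (im F) x) => a b c d.
have -> : (4 : C) = rc 4 by rewrite rc_nat.
by apply: complexP => /=; ring.
Qed.

(** Reading [f1 + i f2] as one function turns the coupled system of [jacobi_frame] into the single
    operator [Kop]. *)
Lemma eigenspaceP l w : eigenspace_jacobi E l w <->
  exists2 F, eigenK l F & w = field_of F.
Proof.
have J F x : csmooth F -> jacobi E (field_of F) x = field_of (Kop F) x.
  move=> [rF iF]; rewrite jacobi_frame // /field_of /frame_field.
  have -> : re (Kop F) x = - lap (re F) x - 4 * lder A0 (im F) x by rewrite /re KopE.
  by have -> : im (Kop F) x = - lap (im F) x + 4 * lder A0 (re F) x by rewrite /im KopE.
have Z F : field_of (fun x => rc l * F x) = fun x => l *: field_of F x.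
  apply/funext => x; rewrite /field_of /frame_field scalerDr !scalerA.
  by congr (_ *: _ + _ *: _); rewrite /re /im ?cReM ?cImM /=; ring.
split=> [[vw ew]|[F [sF eF] ->]].
  have [f1 [f2 [s1 s2 wE]]] := variation_frame vw.
  pose F x : C := Complex (f1 x) (f2 x).
  have sF : csmooth F by [].
  have wF : w = field_of F by rewrite wE.
  exists F => //; split=> // x.
  have := ew x; rewrite wF J // -[RHS]/((fun x => l *: field_of F x) x) -Z.
  by move=> /frame_field_inj [h1 h2]; apply: complexP.
split; first by case: sF => rF iF; exact: frame_field_variation.
move=> x; rewrite J // -[RHS]/((fun x => l *: field_of F x) x) -Z.
by congr (field_of _ x); apply/funext.
Qed.

Lemma field_of_sum (J : finType) (a : J -> R) (F : J -> S -> C) x :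
  field_of (fun x => \sum_j rc (a j) * F j x) x = \sum_j a j *: field_of (F j) x.
Proof.
rewrite /field_of /frame_field.
have rE : re (fun x => \sum_j rc (a j) * F j x) x = \sum_j a j * re (F j) x.
  rewrite /re; elim/big_ind2: _ => // [r1 u r2 v <- <-|j _].
    by case: u; case: v.
  by rewrite cReM /= mul0r subr0.
have iE : im (fun x => \sum_j rc (a j) * F j x) x = \sum_j a j * im (F j) x.
  rewrite /im; elim/big_ind2: _ => // [r1 u r2 v <- <-|j _].
    by case: u; case: v.
  by rewrite cImM /= mul0r addr0.
rewrite rE iE !scaler_suml -big_split; apply: eq_bigr => j _ /=.
by rewrite scalerDr !scalerA.
Qed.

Lemma field_of_eq0 F x : field_of F x = 0 -> F x = 0.
Proof.
move=> h.
have : field_of F x = frame_field (fun=> 0) (fun=> 0) x.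
  by rewrite h /frame_field !scale0r addr0.
by move=> /frame_field_inj[h1 h2]; apply: complexP.
Qed.

Definition hval (n q : nat) : int := hopf_value n (q.*2%:Z - n%:Z).

Lemma hval_ge n q : (n * n)%N%:Z - (2 * n)%N%:Z <= hval n q.
Proof. by rewrite /hval /hopf_value -mul2n; lia. Qed.

(** The value of a pair is at least $n^2-2n$, and this is at least [n] once $n\ge4$; hence $n<4$ or
    $n\le|l|$ for every pair of value [l]. *)
Definition degbound (l : R) : nat := (Num.truncn `|l|).+4.

Lemma hval_bound n q (l : R) : (hval n q)%:~R = l -> (n < degbound l)%N.
Proof.
move=> hl; rewrite ltnNge; apply/negP => Bn.
have n4 : (4 <= n)%N by apply: leq_trans Bn.
have ge_n : n%:Z <= hval n q by have := hval_ge n q; move: (hval n q) n4; clear; nia.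
move: ge_n.
rewrite -(ler_int R) hl; apply/negP; rewrite -ltNge.
apply: le_lt_trans (ler_norm l) _.
apply: lt_le_trans (truncnS_gt `|l|) _; rewrite -[leRHS]/(n%:R) ler_nat.
by apply: leq_trans Bn; rewrite /degbound ltnS -addn3 leq_addr.
Qed.

Definition pairs (l : R) : seq (nat * nat) :=
  [seq p <- [seq (n, q) | n <- iota 0 (degbound l), q <- iota 0 (degbound l)]
  | (p.2 <= p.1)%N && ((hval p.1 p.2)%:~R == l)].

Lemma pairs_uniq l : uniq (pairs l).
Proof. by apply: filter_uniq; apply: allpairs_uniq; rewrite ?iota_uniq // => -[? ?] [? ?]. Qed.

Lemma mem_pairs l n q : ((n, q) \in pairs l) = (q <= n)%N && ((hval n q)%:~R == l).
Proof.
rewrite mem_filter; apply/andb_idr => /andP[qn /eqP hl].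
have nB := hval_bound hl.
apply/allpairsPdep; exists n, q; rewrite !mem_iota !add0n; split=> //.
exact: leq_ltn_trans nB.
Qed.

Definition topair (p : nat * nat) : nat * int := (p.1, p.2.*2%:Z - p.1%:Z).

Lemma topair_inj : injective topair.
Proof. by move=> [n q] [n' q'] [<-] /addIr [/double_inj ->]. Qed.

Lemma hopf_pairsE l : hopf_pairs l = [set` map topair (pairs l)].
Proof.
apply/seteqP; split=> [[n k] [[j jn kE] hl]|p /mapP[[n q]]].
  rewrite /= in jn kE hl; apply/mapP; exists (n, j); last by rewrite /topair kE.
  by rewrite mem_pairs jn /hval -kE hl eqxx.
by rewrite mem_pairs => /andP[qn /eqP hl] ->; split; [exists q|].
Qed.

Definition pairn (l : R) (j : nat) := nth (0%N, 0%N) (pairs l) j.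

(** A pair, one of its $n+1$ monomials and one of two phases, so that the multiplicity is a
    cardinality. *)
Definition eigindex (l : R) : finType :=
  {j : 'I_(size (pairs l)) & ('I_((pairn l j).1 + 1) * bool)%type}.

Lemma card_eigindex l : #|eigindex l| = \sum_(p \in hopf_pairs l) (2 * (p.1 + 1))%N.
Proof.
rewrite hopf_pairsE -fsbig_seq; last by rewrite map_inj_uniq ?pairs_uniq //; exact: topair_inj.
rewrite big_map (big_nth (0%N, 0%N)) big_mkord card_tagged sumnE big_map big_enum /=.
by apply: eq_bigr => j _; rewrite card_prod card_ord card_bool mulnC.
Qed.

(* The n + 1 leading terms of bidegree (n - q, q) in (z, conj z); the eigenvalue
   belongs to k = 2 q - n. *)
Definition monoindex (n q i : nat) : bool * nat * nat * nat :=
  let p := (n - q)%N in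
  if (i <= p)%N then (false, i, p - i, q)%N else (true, i - p, p, n - i)%N.

Definition tindex (l : R) (t : eigindex l) : bool * nat * nat * nat * bool :=
  let: existT j (i, s) := t in
  (monoindex (pairn l j).1 (pairn l j).2 i, s).

Lemma pairnP l (j : 'I_(size (pairs l))) :
  ((pairn l j).2 <= (pairn l j).1)%N /\ (hval (pairn l j).1 (pairn l j).2)%:~R = l.
Proof.
have : pairn l j \in pairs l by apply: mem_nth.
by case: (pairn l j) => n q; rewrite mem_pairs => /andP[? /eqP].
Qed.

Lemma hval_mono_eigval n q i s : (q <= n)%N -> (i <= n)%N ->
  mode_eigval (monoindex n q i, s) = (hval n q)%:~R :> R.
Proof.
move=> qn im; rewrite /hval /hopf_value intrD intrM !intrB /= /monoindex.
have -> : (4%:Z)%:~R = 4 :> R by [].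
have -> : ((q.*2)%:Z)%:~R = 2 * q%:R :> R by rewrite -natrM mul2n.
have -> : (n%:Z)%:~R = n%:R :> R by [].
have -> : (((n * (n + 2))%N)%:Z)%:~R = (n * (n + 2))%:R :> R by [].
case: leqP => ip; rewrite /mode_eigval /mono_eigval /wtr /sgnr.
  have -> : (i + (n - q - i) + q)%N = n by lia.
  by rewrite !natrB //; ring.
have -> : (i - (n - q) + (n - q) + (n - i))%N = n by lia.
by rewrite !natrB //; [ring|exact: ltnW].
Qed.

Lemma tindex_lam l (t : eigindex l) : mode_eigval (tindex t) = l.
Proof.
case: t => j [i s]; have [qn hl] := pairnP j.
by rewrite /tindex hval_mono_eigval //; have := ltn_ord i; lia.
Qed.

Lemma tindex_valid l (t : eigindex l) : valid_index (tindex t).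
Proof.
case: t => j [i s]; rewrite /tindex /monoindex.
by case: leqP => //= h _; rewrite subn_gt0.
Qed.

Lemma monoindex_inj n q i n' q' i' : (q <= n)%N -> (i <= n)%N -> (q' <= n')%N -> (i' <= n')%N ->
  monoindex n q i = monoindex n' q' i' -> [/\ n = n', q = q' & i = i'].
Proof.
move=> qn im qn' im'; rewrite /monoindex.
by case: leqP => h; case: leqP => h' // [] *; split; lia.
Qed.

Lemma tindex_inj l : injective (@tindex l).
Proof.
move=> [j [i s]] [j' [i' s']]; rewrite /tindex => -[] H ss.
have [qn _] := pairnP j; have [qn' _] := pairnP j'.
have im : (i <= (pairn l j).1)%N by have := ltn_ord i; lia.
have im' : (i' <= (pairn l j').1)%N by have := ltn_ord i'; lia.
have [e1 e2 e3] := monoindex_inj qn im qn' im' H.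
have jj : j = j'.
  apply: val_inj; apply/eqP.
  rewrite -(nth_uniq (0%N, 0%N) (ltn_ord j) (ltn_ord j') (pairs_uniq l)) -!/(pairn l _).
  by apply/eqP; move: e1 e2; case: (pairn l j) => ? ?; case: (pairn l j') => ? ? /= -> ->.
move: jj i' e3 ss {H qn' im' e1 e2}; case: _ / => i' e3 ->.
by have -> : i = i' by exact: val_inj.
Qed.

Lemma tindex_surj l u : valid_index u -> mode_eigval u = l -> exists t : eigindex l, tindex t = u.
Proof.
case: u => [[[[b a] c] e] s] /= v L.
have [n [q [i [qn im M]]]] : exists n q i, [/\ (q <= n)%N, (i <= n)%N & monoindex n q i = (b, a, c, e)].
  (* The witness for [q] counts conjugate factors: [a + e] if $\bar z_1$ occurs, [e] otherwise. In
     the first case [i] is [a] shifted by $p=c$. *)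
  case: b v {L} => v.
    exists (a + c + e)%N, (a + e)%N, (a + c)%N; split; [lia|lia|].
    have a0 := v isT; rewrite /monoindex; case: (leqP (a + c) _) => h; first by lia.
    by apply/eqP; rewrite !xpair_eqE eqxx /=; lia.
  exists (a + c + e)%N, e, a; split; [lia|lia|].
  rewrite /monoindex; case: leqP => h; last by lia.
  by apply/eqP; rewrite !xpair_eqE eqxx /=; lia.
have hl : (hval n q)%:~R = l by rewrite -L -(@hval_mono_eigval n q i s qn im) M.
have mp : (n, q) \in pairs l by rewrite mem_pairs qn hl eqxx.
have jlt : (index (n, q) (pairs l) < size (pairs l))%N by rewrite index_mem.
pose j := Ordinal jlt.
have pj : pairn l j = (n, q) by rewrite /pairn nth_index.
have ilt : (i < (pairn l j).1 + 1)%N by rewrite pj /= addn1 ltnS.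
exists (existT _ j (Ordinal ilt, s)).
have G p : p = (n, q) -> (monoindex p.1 p.2 i, s) = (b, a, c, e, s) by move=> -> /=; rewrite M.
exact: G pj.
Qed.

Lemma eigenspace_dim l : has_dim (eigenspace_jacobi E l)
  (\sum_(p \in hopf_pairs l) (2 * (p.1 + 1))%N).
Proof.
have [I mI] := @invariant_mean_exists R.
rewrite -card_eigindex.
apply: (has_dim_fin (b := fun t => field_of (mode (tindex t)))) => [a h|w].
  apply: (mode_free mI (@tindex_inj l) (@tindex_valid l) (@tindex_lam l)) => x.
  apply: (field_of_eq0 (F := fun x => \sum_t rc (a t) * mode (tindex t) x)).
  by rewrite field_of_sum.
have span F := mode_span mI (@tindex_inj l) (@tindex_valid l) (@tindex_lam l)
  (@tindex_surj l) F.
rewrite eigenspaceP; split=> [[F /span [a ha] ->]|[a ha]].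
  by exists a => x; rewrite -field_of_sum; congr (field_of _ x); apply/funext.
exists (fun x => \sum_t rc (a t) * mode (tindex t) x); first by apply/span; exists a.
by apply/funext => x; rewrite ha field_of_sum.
Qed.

Lemma hopf_pairs_finite (l : R) : finite_set (hopf_pairs l).
Proof. by rewrite hopf_pairsE; exact: finite_seq. Qed.

Lemma eigenvalueP l : eigenvalue_jacobi E l <->
  exists n k, admissible n k /\ l = (hopf_value n k)%:~R.
Proof.
split=> [[w ew [x wx]]|[n [k [[q qn ->] ->]]]].
  (* Without pairs the eigenspace would have dimension 0, against $w(x)\ne0$. *)
  have [[|p s] r] : {s | pairs l = s} by exists (pairs l).
    have := eigenspace_dim l; rewrite hopf_pairsE r => -[b [_ sb]].
    have [a ha] := (sb w).1 ew.
    exfalso; apply: wx; rewrite ha.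
    move: b sb a ha; rewrite -fsbig_seq // big_nil => b _ a _.
    by rewrite big_ord0.
  have : p \in pairs l by rewrite r mem_head.
  case: p {r} => n q; rewrite mem_pairs => /andP[qn /eqP hl].
  by exists n, (q.*2%:Z - n%:Z); split; [exists q|].
have h0 := @hval_mono_eigval n q 0 false qn (leq0n n).
have v : valid_index (monoindex n q 0, false) by rewrite /monoindex leq0n.
pose t := (monoindex n q 0, false).
exists (field_of (mode t)).
  apply/eigenspaceP; exists (mode t) => //; rewrite -[_%:~R]h0; exact: mode_eigen.
have [x hx] : exists x, mode t x != 0.
  rewrite /t; case: (monoindex n q 0) => [[[b a] c] e].
  have [x hx] := @harmonic_neq0 R b a c e; exists x.
  by rewrite /mode /phase mul1r.
exists x => /field_of_eq0 /eqP; exact/negP.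
Qed.

(** With $k=2q-n$ the value is $n(n-2)+8q$, and $n(n-2)$ is negative only at $n=1$, where it is
    $-1$. *)
Lemma hopf_value_lt0 n k : admissible n k ->
  (hopf_value n k < 0 <-> n = 1%N /\ k = -1).
Proof.
move=> [q qn ->]; rewrite /hopf_value -mul2n; split=> [h|[-> h]].
  have n1 : n = 1%N by move: qn h; clear; nia.
  by split=> //; move: h; rewrite n1; clear; lia.
by rewrite h.
Qed.

Lemma neg_eigenvalue l : (eigenvalue_jacobi E l /\ l < 0) <->
  l = (hopf_value 1 (-1))%:~R.
Proof.
split=> [[/eigenvalueP [n [k [ank ->]]] l0]|->].
  have [-> ->] // : n = 1%N /\ k = -1.
  by apply/(hopf_value_lt0 ank); rewrite -(ltr_int R).
split; last by rewrite ltrz0.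
by apply/eigenvalueP; exists 1%N, (-1); split => //; exists 0%N.
Qed.

Lemma negative_spaceE w : negative_space_jacobi E w <->
  eigenspace_jacobi E ((hopf_value 1 (-1))%:~R) w.
Proof.
split=> [[r [l [v [linj vl wE]]]]|ew]; last first.
  exists 1%N, (fun=> (hopf_value 1 (-1))%:~R), (fun=> w); split.
  - by move=> i j _; rewrite !ord1.
  - by move=> _; split=> //; rewrite ltrz0.
  - by move=> x; rewrite big_ord1.
set l0 := (hopf_value 1 (-1))%:~R.
have ev i : eigenspace_jacobi E l0 (v i).
  have [li ei] := vl i.
  have [[x vx]|nz] := pselect (exists x, v i x <> 0).
    have -> : l0 = l i; last by [].
    by apply/esym/neg_eigenvalue; split=> //; exists (v i) => //; exists x.
  (* A zero summand: [l i] need not be an eigenvalue, but the zero field lies in every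
     eigenspace. *)
  have -> : v i = field_of (fun=> 0).
    apply/funext => x; rewrite /field_of /frame_field /re /im /= !scale0r addr0.
    by apply: contrapT => vx; apply: nz; exists x.
  apply/eigenspaceP; exists (fun=> 0) => //; split; first exact: csmooth_cst.
  by move=> x; rewrite /Kop /clap !cder_cst !addr0 !mulr0 oppr0 addr0.
have ex i : exists F, eigenK l0 F /\ v i = field_of F.
  by have /eigenspaceP [F eF vF] := ev i; exists F.
pose F i := sval (cid (ex i)).
have FP i : eigenK l0 (F i) /\ v i = field_of (F i) := svalP (cid (ex i)).
apply/eigenspaceP; exists (fun x => \sum_i rc 1 * F i x).
  by apply: (@eigenK_sum R l0 _ (fun=> 1)) => i; case: (FP i).
apply/funext => x; rewrite wE (field_of_sum (fun=> 1)); apply: eq_bigr => i _.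
by rewrite scale1r; case: (FP i) => _ <-.
Qed.

Lemma kernelE w : kernel_jacobi E w <-> eigenspace_jacobi E 0 w.
Proof. by split=> -[vw h]; split=> // x; rewrite h scale0r. Qed.

Lemma hopf_pairs_neg : hopf_pairs ((hopf_value 1 (-1))%:~R : R) = [set` [:: (1%N, -1 : int)]].
Proof.
apply/seteqP; split=> [[n k] [an /= /intr_inj hl]|p]; last first.
  by rewrite /= inE => /eqP ->; split=> //; exists 0%N.
have [-> ->] : n = 1%N /\ k = -1 by apply/(hopf_value_lt0 an); rewrite hl.
by rewrite /= inE.
Qed.

(** The equation $n(n-2)+8q=0$ forces $q=0$ and $n\in\{0,2\}$; these pairs contribute $2+6=8$ to the
    kernel. *)
Lemma hopf_pairs_0 : hopf_pairs (0 : R) = [set` [:: (0%N, 0 : int); (2%N, -2 : int)]].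
Proof.
apply/seteqP; split=> [[n k] [[q /= qn ->] /eqP]|p]; last first.
  rewrite /= !inE => /orP[] /eqP ->; split=> //; first by exists 0%N.
  by exists 0%N.
rewrite intr_eq0 /hopf_value -mul2n => /eqP h.
rewrite /= !inE !xpair_eqE; move: qn h; clear; nia.
Qed.

End Spectrum.

Theorem mainTheorem3 (R : realType)
    (E : sphere R 3 -> 'I_3 -> sphere R 3 -> 'rV[R]_4)
    (hE : forall x, local_orthonormal_frame x (E x)) :
  [/\ (* the eigenvalues *)
      forall l : R, eigenvalue_jacobi E l <->
        exists n k, admissible n k /\ l = (hopf_value n k)%:~R,
      (* their multiplicities *)
      forall l : R, finite_set (hopf_pairs l) /\
        has_dim (eigenspace_jacobi E l)
          (\sum_(p \in hopf_pairs l) (2 * (p.1 + 1))%N),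
      (* the negative eigenvalue *)
      (forall n k, admissible n k ->
         (hopf_value n k < 0 <-> n = 1%N /\ k = -1)) /\
      (forall l : R, (eigenvalue_jacobi E l /\ l < 0) <->
         l = (hopf_value 1 (-1))%:~R),
      has_dim (negative_space_jacobi E) 4 &
      has_dim (kernel_jacobi E) 8].
Proof.
split.
- by move=> l; exact: eigenvalueP.
- by move=> l; split; [exact: hopf_pairs_finite|exact: eigenspace_dim].
- by split=> [n k|l]; [exact: hopf_value_lt0|exact: neg_eigenvalue].
- apply: (@has_dim_ext _ _ _ (eigenspace_jacobi E (hopf_value 1 (-1))%:~R)).
    by move=> w; rewrite negative_spaceE.
  have := eigenspace_dim hE (hopf_value 1 (-1))%:~R.
  by rewrite hopf_pairs_neg -fsbig_seq // big_seq1.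
- apply: (@has_dim_ext _ _ _ (eigenspace_jacobi E 0)).
    by move=> w; rewrite kernelE.
  have := eigenspace_dim hE 0.
  by rewrite hopf_pairs_0 -fsbig_seq // big_cons big_seq1.
Qed.
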